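(* Let $K\subseteq\mathbb{R}^n$ be compact and let $\mathbb{I}=\{\mathbb{I}_1,\dots,\mathbb{I}_N\}$ be a random iterated function system on $K$ in which every map $S_{i,j}$ is a similarity contraction with ratio $\mathrm{Lip}(S_{i,j})\in(0,1)$. For each $i$ let $s_i$ solve $\sum_{j\in\mathcal{I}_i}\mathrm{Lip}(S_{i,j})^{s_i}=1$, and write $s_{\min}=\min_is_i$, $s_{\max}=\max_is_i$, $\mathcal{H}_{\min}=\inf_{\omega\in\Omega}\mathcal{H}^{s_{\min}}(F_\omega)$, $\mathcal{P}_{\max}=\sup_{\omega\in\Omega}\mathcal{P}^{s_{\max}}(F_\omega)$. Assume $\mathbb{I}$ satisfies the uniform open set condition and the $\mathcal{P}^{s_{\min}}$-measure separated condition. Then: (1) if $s_{\min}=s_{\max}=s$, then for a typical $\omega\in\Omega$, $\dim_{\mathrm H}F_\omega=\dim_{\mathrm P}F_\omega=s$ and $0<\mathcal{H}^s(F_\omega)=\mathcal{H}_{\min}\le\mathcal{P}_{\max}=\mathcal{P}^s(F_\omega)<\infty$; (2) if $s_{\min}<s_{\max}$, then for a typical $\omega\in\Omega$, $\dim_{\mathrm H}F_\omega=s_{\min}<s_{\max}=\dim_{\mathrm P}F_\omega$, $\mathcal{H}^{s_{\min}}(F_\omega)=\infty$ and $\mathcal{P}^{s_{\max}}(F_\omega)=0$.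
   Context: Here $\mathbb{I}_i=\{S_{i,j}\}_{j\in\mathcal{I}_i}$ with $\mathcal{I}_i$ finite nonempty and each $S_{i,j}:K\to K$ a similarity with ratio $\mathrm{Lip}(S_{i,j})$. $\Omega=\{1,\dots,N\}^{\mathbb{N}}$ with metric $d_\Omega(u,v)=2^{-\min\{n:u_n\ne v_n\}}$, and $F_\omega=\bigcap_k\bigcup_{i_1\in\mathcal{I}_{\omega_1},\dots,i_k\in\mathcal{I}_{\omega_k}}S_{\omega_1,i_1}\circ\cdots\circ S_{\omega_k,i_k}(K)$. ''Typical $\omega$'' means the set of such $\omega$ is residual in $(\Omega,d_\Omega)$. Uniform open set condition: there is a nonempty open $\mathcal{O}\subseteq K$ with $\bigcup_{j\in\mathcal{I}_i}S_{i,j}(\mathcal{O})\subseteq\mathcal{O}$, union disjoint, for every $i$. For a Borel measure $\mu$, the $\mu$-measure separated condition means: for all $\omega\in\Omega$, all $l$ and all $i\ne j$ in $\mathcal{I}_l$, $\mu(S_{l,i}(F_\omega)\cap S_{l,j}(F_\omega))=0$. $\mathcal{H}^s,\mathcal{P}^s$ are $s$-dimensional Hausdorff and packing measures; $\dim_{\mathrm H},\dim_{\mathrm P}$ Hausdorff and packing dimension. *)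

(* Defs.v *)
From HB Require Import structures.
From mathcomp Require Import all_boot all_order all_algebra.
From mathcomp Require Import all_classical all_reals all_analysis.
Set Implicit Arguments. Unset Strict Implicit. Unset Printing Implicit Defensive.
Import Order.TTheory GRing.Theory Num.Theory.
Import numFieldNormedType.Exports.
Local Open Scope classical_set_scope.
Local Open Scope ring_scope.

Section Defs.
Variables (R : realType) (n : nat).
Notation point := 'rV[R]_n.

Definition edist (x y : point) : R :=
  Num.sqrt (\sum_(i < n) (x ord0 i - y ord0 i) ^+ 2).

Definition eopen (O : set point) : Prop :=
  forall x, O x -> exists2 e : R, 0 < e & forall y, edist x y < e -> O y.

(* diameter (extended real; -oo for the empty set) *)
Definition diam (A : set point) : \bar R :=
  ereal_sup [set (edist xy.1 xy.2)%:E | xy in A `*` A].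

(* delta-approximation of the s-dimensional Hausdorff measure:
   countable (or finite: indices in J) covers by nonempty sets of diameter <= delta *)
Definition hausdorff_delta (s delta : R) (E : set point) : \bar R :=
  ereal_inf ((fun JU : set nat * (nat -> set point) =>
               \esum_(k in JU.1) ((fine (diam (JU.2 k))) `^ s)%:E) @` [set JU : set nat * (nat -> set point) |
                      (E `<=` \bigcup_(k in JU.1) JU.2 k) /\
                      (forall k, JU.1 k -> JU.2 k !=set0 /\ (diam (JU.2 k) <= delta%:E)%E)]).

Definition hausdorff (s : R) (E : set point) : \bar R :=
  ereal_sup [set hausdorff_delta s delta E | delta in [set d : R | 0 < d]].

Definition cball (x : point) (r : R) : set point := [set y | edist x y <= r].

(* delta-packing: countable (or finite) families of pairwise disjoint closed balls
   centred in E with radii in (0, delta]; the diameter of B(x,r) in R^n is 2r *)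
Definition packing_delta (s delta : R) (E : set point) : \bar R :=
  ereal_sup ((fun Jcr : set nat * (nat -> point) * (nat -> R) =>
               \esum_(k in Jcr.1.1) ((2 * Jcr.2 k) `^ s)%:E) @` [set Jcr : set nat * (nat -> point) * (nat -> R) |
                 (forall k, Jcr.1.1 k -> E (Jcr.1.2 k) /\ 0 < Jcr.2 k <= delta) /\
                 (forall k l, Jcr.1.1 k -> Jcr.1.1 l -> k <> l ->
                    cball (Jcr.1.2 k) (Jcr.2 k) `&` cball (Jcr.1.2 l) (Jcr.2 l) = set0)]).

Definition packing_pre (s : R) (E : set point) : \bar R :=
  ereal_inf [set packing_delta s delta E | delta in [set d : R | 0 < d]].

Definition packing (s : R) (E : set point) : \bar R :=
  ereal_inf [set \esum_(k in [set: nat]) packing_pre s (Es k)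
            | Es in [set Es : nat -> set point | E `<=` \bigcup_k Es k]].

Definition dimH (E : set point) : R := inf [set s : R | 0 <= s /\ hausdorff s E = 0%E].
Definition dimP (E : set point) : R := inf [set s : R | 0 <= s /\ packing s E = 0%E].

Definition similarity_on (K : set point) (S : point -> point) (r : R) : Prop :=
  forall x y, K x -> K y -> edist (S x) (S y) = r * edist x y.

End Defs.

Section RIFS.
Variables (R : realType) (n N : nat) (m : 'I_N -> nat)
  (S : forall i : 'I_N, 'I_(m i) -> 'rV[R]_n -> 'rV[R]_n).

Definition Phi (i : 'I_N) (A : set 'rV[R]_n) : set 'rV[R]_n :=
  [set y | exists j : 'I_(m i), exists2 x, A x & y = S j x].

(* iter_maps w k A = union over words of S_{w_0,i_0} o ... o S_{w_{k-1},i_{k-1}} (A) *)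
Fixpoint iter_maps (w : nat -> 'I_N) (k : nat) (A : set 'rV[R]_n) : set 'rV[R]_n :=
  match k with
  | 0 => A
  | k'.+1 => Phi (w 0%N) (iter_maps (fun p => w p.+1) k' A)
  end.

Definition F_omega (K : set 'rV[R]_n) (w : nat -> 'I_N) : set 'rV[R]_n :=
  \bigcap_k iter_maps w k K.
End RIFS.

(* Topology of Omega = {1..N}^N with metric 2^{-min{n : u_n <> v_n}}:
   the open balls are exactly the cylinder sets. *)
Definition Omega_open (N : nat) (U : set (nat -> 'I_N)) : Prop :=
  forall u, U u -> exists k, forall v, (forall p, (p < k)%N -> v p = u p) -> U v.

Definition Omega_dense (N : nat) (D : set (nat -> 'I_N)) : Prop :=
  forall u k, exists v, D v /\ forall p, (p < k)%N -> v p = u p.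

Definition residual (N : nat) (A : set (nat -> 'I_N)) : Prop :=
  exists G : nat -> set (nat -> 'I_N),
    (forall k, Omega_open (G k) /\ Omega_dense (G k)) /\ \bigcap_k G k `<=` A.

(* Main.v *)
(** Write [F w] for [F_omega S K w]. Since [F w] is the union of the similar copies [S j @` F (shift w)], whose
    overlaps are null, the [smin]-dimensional measures are multiplied by
    [sum_j r_j ^ smin >= 1] when a letter is prepended; the multiplier in
    dimension [smax] is at most [1]. The mass distribution giving a word [u] the
    weight [prod r ^ s_i] yields, uniformly in [w], a positive lower bound for
    the Hausdorff measure in dimensions [<= s_i] (this uses the open set
    condition) and a finite upper bound for the packing premeasure in dimensions
    [>= s_i].

    A bound on a Hausdorff content from above, or on a packing content from
    below, depends only on a prefix of [w], so it holds generically as soon as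
    it holds for all sequences with a common tail. If [smin = smax] the
    multipliers are [1], and nearly extremal tails show that generic [w] attain
    the infimum and the supremum; this uses that packing measure and premeasure
    agree on compact sets of finite premeasure. If [smin < smax], the constant
    tails of minimal and maximal similarity dimension fix the two dimensions,
    and infinitely many multipliers away from [1] give the measures [oo] and
    [0]. *)
From Pilot Require Import Defs.
From HB Require Import structures.
From mathcomp Require Import all_boot all_order all_algebra.
From mathcomp Require Import all_classical all_reals all_analysis.
From mathcomp Require Import ring lra.
Import Order.TTheory GRing.Theory Num.Theory.
Import numFieldNormedType.Exports.
(* mathcomp-analysis has an [edist] of its own. *)
Import Pilot.Defs.
Local Open Scope classical_set_scope.
Local Open Scope ring_scope.

Set Implicit Arguments.
Unset Strict Implicit.
Unset Printing Implicit Defensive.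

(** * Euclidean geometry *)

Section Euclid.
Context {R : realType} {n : nat}.
Notation point := 'rV[R]_n.
Implicit Types (x y z u v : point) (a b : R).

(** A generic bound must come from open conditions on [w], and such a condition can involve only
    finitely many sets or balls. Hence the predicates [hle], [ple] and [pge] on finite lists.
    Compactness of [F w] identifies [hle] with a bound on Hausdorff measure, but [ple] and [pge]
    speak of the packing premeasure: a lower bound on the packing measure is not visibly an open
    condition. The return to the packing measure is made in two ways. Where the premeasure is
    finite, the two agree on compact sets; in dimensions below [smax], where it is generically
    infinite if [smin < smax], a Baire argument inside [F w] replaces this.

    Upper bounds pass to unions by subadditivity, in every dimension. The opposite direction uses
    null overlaps, which are given for the packing measure of dimension [smin] alone. They are null
    for the Hausdorff measure because $\mathcal{H}^s \le \mathcal{P}^s$ on compact sets, and for the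
    premeasure once it is finite on [F w], as it is if [smin = smax]. For [smin < smax] the packing
    side relies on subadditivity and on single similar copies. *)

Definition dot u v : R := (u *m v^T) 0 0.

Lemma dotE u v : dot u v = \sum_(i < n) u 0 i * v 0 i.
Proof. by rewrite /dot mxE; apply: eq_bigr => i _; rewrite mxE. Qed.

Lemma dotC u v : dot u v = dot v u.
Proof. by rewrite !dotE; apply: eq_bigr => i _; rewrite mulrC. Qed.

Lemma dotDl u v z : dot (u + v) z = dot u z + dot v z.
Proof. by rewrite /dot mulmxDl mxE. Qed.

Lemma dotZl a u v : dot (a *: u) v = a * dot u v.
Proof. by rewrite /dot -scalemxAl mxE. Qed.

Lemma dotDr u v z : dot z (u + v) = dot z u + dot z v.
Proof. by rewrite dotC dotDl !(dotC z). Qed.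

Lemma dotZr a u v : dot u (a *: v) = a * dot u v.
Proof. by rewrite dotC dotZl dotC. Qed.

Lemma dotNl u v : dot (- u) v = - dot u v.
Proof. by rewrite -scaleN1r dotZl mulN1r. Qed.

Lemma dotNr u v : dot u (- v) = - dot u v.
Proof. by rewrite dotC dotNl dotC. Qed.

Lemma dot_ge0 u : 0 <= dot u u.
Proof. by rewrite dotE sumr_ge0 // => i _; rewrite -expr2 sqr_ge0. Qed.

Lemma dot_eq0 u : dot u u = 0 -> u = 0.
Proof.
rewrite dotE => /eqP; rewrite psumr_eq0; last by move=> i _; rewrite -expr2 sqr_ge0.
move=> /allP h; apply/rowP => i; rewrite mxE.
by have := h i (mem_index_enum _); rewrite /= -expr2 sqrf_eq0 => /eqP.
Qed.

Lemma edistE x y : edist x y = Num.sqrt (dot (x - y) (x - y)).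
Proof.
by rewrite /edist dotE; congr Num.sqrt; apply: eq_bigr => i _; rewrite !mxE expr2.
Qed.

Lemma sqr_edist x y : edist x y ^+ 2 = dot (x - y) (x - y).
Proof. by rewrite edistE sqr_sqrtr // dot_ge0. Qed.

Lemma edist_ge0 x y : 0 <= edist x y.
Proof. exact: sqrtr_ge0. Qed.

Lemma edistxx x : edist x x = 0.
Proof. by rewrite edistE subrr /dot mul0mx mxE sqrtr0. Qed.

Lemma edistC x y : edist x y = edist y x.
Proof. by rewrite !edistE -(opprB y x) dotNl dotNr opprK. Qed.

Lemma edist_eq0 x y : edist x y = 0 -> x = y.
Proof.
move=> h; apply/eqP; rewrite -subr_eq0; apply/eqP/dot_eq0.
by rewrite -sqr_edist h expr0n.
Qed.

Lemma cauchy_schwarz u v : dot u v ^+ 2 <= dot u u * dot v v.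
Proof.
have [v0|v0] := eqVneq (dot v v) 0.
  by rewrite (dot_eq0 v0) {1}/dot trmx0 mulmx0 mxE expr0n /= mulr_ge0 ?dot_ge0.
have vp : 0 < dot v v by rewrite lt_neqAle eq_sym v0 dot_ge0.
have := dot_ge0 (dot v v *: u - dot u v *: v).
rewrite !(dotDl, dotDr, dotNl, dotNr, dotZl, dotZr) (dotC v u) => h.
have {}h : 0 <= dot v v * (dot u u * dot v v - dot u v ^+ 2) by nra.
by rewrite pmulr_rge0 // subr_ge0 in h.
Qed.

Lemma edist_triangle y x z : edist x z <= edist x y + edist y z.
Proof.
have h0 := cauchy_schwarz (x - y) (y - z).
rewrite -[leLHS]ger0_norm ?edist_ge0// -[leRHS]ger0_norm ?addr_ge0 ?edist_ge0//.
rewrite -ler_sqr ?nnegrE// !real_normK ?num_real//.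
have -> : edist x z ^+ 2 = dot ((x - y) + (y - z)) ((x - y) + (y - z)).
  by rewrite sqr_edist addrA subrK.
rewrite !(dotDl (x - y)) !(dotDr (x - y)).
rewrite sqrrD !sqr_edist (dotC (y - z) (x - y)).
suff: dot (x - y) (y - z) <= edist x y * edist y z by lra.
apply: le_trans (ler_norm _) _.
rewrite -[leRHS]ger0_norm ?mulr_ge0 ?edist_ge0//.
by rewrite -ler_sqr ?nnegrE// !real_normK ?num_real// exprMn !sqr_edist.
Qed.

Lemma edistZ a u v : edist (a *: u) (a *: v) = `|a| * edist u v.
Proof.
by rewrite !edistE -scalerBr dotZl dotZr mulrA -expr2 sqrtrM ?sqr_ge0// sqrtr_sqr.
Qed.

Lemma edist_add2l x u v : edist (x + u) (x + v) = edist u v.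
Proof. by rewrite !edistE opprD addrACA subrr add0r. Qed.

Lemma coord_le_edist x y i : `|x 0 i - y 0 i| <= edist x y.
Proof.
rewrite -sqrtr_sqr edistE ler_sqrt ?dot_ge0// dotE (bigD1 i)//= !mxE expr2.
by rewrite lerDl sumr_ge0// => j _; rewrite -expr2 sqr_ge0.
Qed.

(** The factor [n.+1%:R], cruder than $\sqrt n$, is positive even for $n = 0$ and keeps the
    inequality strict. *)
Lemma edist_lt_coord x y a : 0 < a ->
  (forall i, `|x 0 i - y 0 i| < a) -> edist x y < a * n.+1%:R.
Proof.
move=> a0 h; have h1 : edist x y ^+ 2 <= (a * n%:R) ^+ 2.
  rewrite sqr_edist dotE; apply: (@le_trans _ _ (\sum_(i < n) a ^+ 2)).
    apply: ler_sum => i _; rewrite !mxE -expr2 -[leLHS]real_normK ?num_real//.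
    by rewrite ler_sqr ?nnegrE ?(ltW a0)// ltW.
  rewrite sumr_const card_ord exprMn -[leLHS]mulr_natr ler_wpM2l ?sqr_ge0//.
  by rewrite -natrX ler_nat; case: (n) => // k; rewrite -mulnn leq_pmulr.
have {}h1 : edist x y <= a * n%:R.
  by rewrite -ler_sqr ?nnegrE ?edist_ge0 ?mulr_ge0 ?(ltW a0).
by apply: le_lt_trans h1 _; rewrite ltr_pM2l// ltr_nat.
Qed.

(** If [edist x y <= a + b], the point dividing the segment from [x] to [y] in the ratio $a : b$
    lies in both balls. Packings thus become finitely many strict inequalities between centres and
    radii. *)
Lemma cball_disjoint x y a b : 0 < a -> 0 < b ->
  (cball x a `&` cball y b = set0) <-> a + b < edist x y.
Proof.
move=> a0 b0; split => [h|h]; last first.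
  apply/seteqP; split => // z [/= xz yz].
  have := edist_triangle z x y; rewrite (edistC z y) => t.
  by move: (lt_le_trans h t); rewrite ltNge lerD.
rewrite ltNge; apply/negP => le.
have ab : 0 < a + b by rewrite addr_gt0.
suff : (cball x a `&` cball y b) (x + (a / (a + b)) *: (y - x)) by rewrite h.
split; rewrite /cball /=.
  rewrite -{1}[x]addr0 edist_add2l -{1}(scaler0 _ (a / (a + b))) edistZ.
  rewrite ger0_norm ?divr_ge0 ?(ltW ab) ?(ltW a0)//.
  have -> : edist 0 (y - x) = edist x y by rewrite -(edist_add2l x) addr0 addrC subrK.
  by rewrite mulrAC ler_pdivrMr// ler_pM2l.
have -> : y = x + (y - x) by rewrite addrC subrK.
rewrite edist_add2l addrAC subrr add0r.
have -> : edist (y - x) (a / (a + b) *: (y - x)) = b / (a + b) * edist x y.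
  have -> : a / (a + b) *: (y - x) = (y - x) + (b / (a + b)) *: (x - y).
    rewrite -(opprB y x) scalerN -{2}(scale1r (y - x)) -scalerBl; congr (_ *: _).
    by rewrite -{1}(@divff _ (a + b)) ?gt_eqF// -mulrBl addrK.
  rewrite -{1}(addr0 (y - x)) edist_add2l -{1}(scaler0 _ (b / (a + b))) edistZ.
  rewrite ger0_norm ?divr_ge0 ?(ltW ab) ?(ltW b0)//; congr (_ * _).
  by rewrite -(edist_add2l y) addr0 addrC subrK edistC.
by rewrite mulrAC ler_pdivrMr// ler_pM2l.
Qed.

(* [f], normalised to fix the origin, preserves inner products, hence is given
   by an orthogonal matrix on the ball. *)
Lemma similarity_onto_ball (K : set point) (f : point -> point) (rho eps : R) (o : point) :
  0 < rho -> 0 < eps -> similarity_on K f rho ->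
  (forall x, edist o x < eps -> K x) ->
  forall y, edist (f o) y < rho * eps -> exists2 x, edist o x < eps & f x = y.
Proof.
move=> rho0 eps0 fsim ballK.
pose g u := rho^-1 *: (f (o + u) - f o).
have oadd u : edist o (o + u) = edist 0 u by rewrite -{1}(addr0 o) edist_add2l.
have d0 u : edist 0 u ^+ 2 = dot u u by rewrite sqr_edist sub0r dotNl dotNr opprK.
have giso u v : edist 0 u < eps -> edist 0 v < eps -> edist (g u) (g v) = edist u v.
  move=> ue ve; rewrite edistZ gtr0_norm ?invr_gt0//.
  rewrite -!(addrC (- f o)) edist_add2l fsim; first last.
  - by apply: ballK; rewrite oadd.
  - by apply: ballK; rewrite oadd.
  by rewrite edist_add2l mulrA mulVf ?gt_eqF// mul1r.
have g0 : g 0 = 0 by rewrite /g addr0 subrr scaler0.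
have zb : edist 0 (0 : point) < eps by rewrite edistxx.
have gdot u v : edist 0 u < eps -> edist 0 v < eps -> dot (g u) (g v) = dot u v.
  move=> ue ve.
  have h1 := giso _ _ ue ve; have h2 := giso _ _ zb ue; have h3 := giso _ _ zb ve.
  rewrite g0 in h2 h3.
  move/(congr1 (fun t : R => t ^+ 2)): h1; move/(congr1 (fun t : R => t ^+ 2)): h2.
  move/(congr1 (fun t : R => t ^+ 2)): h3; rewrite !d0 !sqr_edist.
  rewrite !(dotDl, dotDr, dotNl, dotNr) (dotC (g v) (g u)) (dotC v u); lra.
(* [g] is controlled only on the ball of radius [eps]; scaling by [c] puts the basis vectors inside
   it. *)
pose c := eps / 2.
have c0 : 0 < c by rewrite divr_gt0.
have cb i : edist 0 (c *: delta_mx 0 i : point) < eps.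
  rewrite -(scaler0 _ c) edistZ gtr0_norm//.
  suff -> : edist 0 (delta_mx 0 i : point) = 1 by rewrite mulr1 /c; lra.
  apply/eqP; rewrite -(@eqrXn2 _ 2) ?edist_ge0// d0 dotE (bigD1 i)//= !mxE !eqxx.
  rewrite big1 ?addr0 ?mulr1 ?expr1n// => j ji.
  by rewrite !mxE (negbTE ji) andbF mulr0.
have dotd u i : dot u (delta_mx 0 i) = u 0 i.
  rewrite dotE (bigD1 i)//= !mxE !eqxx mulr1 big1 ?addr0// => j ji.
  by rewrite !mxE (negbTE ji) andbF mulr0.
pose A : 'M[R]_n := \matrix_(i, j) (c^-1 * (g (c *: delta_mx 0 i)) 0 j).
have rowA u i : (u *m A^T) 0 i = c^-1 * dot u (g (c *: delta_mx 0 i)).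
  rewrite mxE dotE mulr_sumr; apply: eq_bigr => j _; rewrite !mxE; ring.
have gA u : edist 0 u < eps -> g u *m A^T = u.
  move=> ue; apply/rowP => i; rewrite rowA gdot// dotZr dotd mulrA mulVf ?gt_eqF//.
  by rewrite mul1r.
have AAT : A *m A^T = 1%:M.
  apply/matrixP => i j; rewrite -[LHS](_ : (row i A *m A^T) 0 j = _); last first.
    by rewrite -row_mul mxE.
  have -> : row i A = c^-1 *: g (c *: delta_mx 0 i) by apply/rowP => k; rewrite !mxE.
  rewrite -scalemxAl gA// scalerA mulVf ?gt_eqF// scale1r !mxE eqxx /=.
  by rewrite eq_sym.
(* For square matrices a one-sided inverse is two-sided: surjectivity comes from here. *)
have ATA : A^T *m A = 1%:M by exact: mulmx1C.
move=> y ylt; pose v := rho^-1 *: (y - f o); pose u := v *m A^T.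
have uv : edist 0 u = edist 0 v.
  apply/eqP; rewrite -(@eqrXn2 _ 2) ?edist_ge0// !d0 /dot /u trmx_mul trmxK.
  by rewrite mulmxA -(mulmxA v) ATA mulmx1.
have ue : edist 0 u < eps.
  rewrite uv /v -(scaler0 _ rho^-1) edistZ gtr0_norm ?invr_gt0//.
  rewrite -(edist_add2l (f o)) addr0 addrC subrK mulrC ltr_pdivrMr//.
  by rewrite mulrC.
exists (o + u); first by rewrite oadd.
have gu : g u = v by rewrite -[g u]mulmx1 -ATA mulmxA gA// /u -mulmxA ATA mulmx1.
have : rho *: g u = rho *: v by rewrite gu.
rewrite /g /v !scalerA mulfV ?gt_eqF// !scale1r => /(congr1 (fun z => z + f o)).
by rewrite !subrK.
Qed.

End Euclid.

Lemma finite_lower_bound {R : realType} (T : eqType) (l : seq T) (f : T -> R) :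
  (forall t, t \in l -> 0 < f t) ->
  exists2 e : R, 0 < e & forall t, t \in l -> e <= f t.
Proof.
elim: l => [|a l IH] h; first by exists 1.
have [|e e0 he] := IH; first by move=> t tl; apply: h; rewrite inE tl orbT.
exists (Num.min e (f a)); first by rewrite lt_min e0 h// inE eqxx.
by move=> t; rewrite inE ge_min => /predU1P[->|/he ->//]; rewrite lexx orbT.
Qed.

(** * Compactness for the Euclidean distance *)

Section Compactness.
Context {R : realType} {n : nat}.
Notation point := 'rV[R]_n.
Implicit Types (x y z u v : point) (A B F K : set point).

Lemma inv_nat_lt (e : R) : 0 < e -> exists k : nat, k.+1%:R^-1 < e.
Proof.
move=> e0; exists (Num.bound e^-1).
rewrite invf_plt ?posrE//; apply: lt_le_trans (_ : (Num.bound e^-1)%:R <= _).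
  by apply: archi_boundP; rewrite invr_ge0 ltW.
by rewrite ler_nat.
Qed.

Definition eclosed A := eopen (~` A).

(** Increasing sequences of open sets are the only covers needed below, and for them a finite
    subcover is a single member. *)
Definition ecompact F := forall U : nat -> set point,
  (forall k, eopen (U k)) -> (forall k, U k `<=` U k.+1) ->
  F `<=` \bigcup_k U k -> exists k, F `<=` U k.

Lemma increasing_le (U : nat -> set point) :
  (forall k, U k `<=` U k.+1) -> forall j k, (j <= k)%N -> U j `<=` U k.
Proof.
move=> h j; elim=> [|k IH]; first by rewrite leqn0 => /eqP ->.
by rewrite leq_eqVlt => /predU1P[->//|/IH jk]; apply: subset_trans jk (h k).
Qed.

Lemma eopen_ball x (e : R) : eopen [set y | edist x y < e].
Proof.
move=> y /= xy; exists (e - edist x y); first by rewrite subr_gt0.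
move=> z yz /=; apply: le_lt_trans (edist_triangle y x z) _.
by rewrite addrC -ltrBrDr.
Qed.

Lemma eopen_far x (e : R) : eopen [set y | e < edist x y].
Proof.
move=> y /= xy; exists (edist x y - e); first by rewrite subr_gt0.
move=> z yz /=; have := edist_triangle z x y; rewrite (edistC z y); lra.
Qed.

Lemma eopenU A B : eopen A -> eopen B -> eopen (A `|` B).
Proof.
move=> oA oB x [/oA|/oB] [e e0 h]; exists e => // y /h; [by left|by right].
Qed.

Lemma eopen_bigcup (T : Type) (D : set T) (U : T -> set point) :
  (forall t, D t -> eopen (U t)) -> eopen (\bigcup_(t in D) U t).
Proof.
by move=> oU x [t Dt /(oU _ Dt)[e e0 h]]; exists e => // y /h; exists t.
Qed.

Lemma eopen_open A : eopen A -> open A.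
Proof.
move=> oA; rewrite openE => x /oA[e e0 h]; apply/nbhs_ballP.
exists (e / n.+1%:R); first by rewrite /= divr_gt0.
move=> y xy; apply: h.
have -> : e = e / n.+1%:R * n.+1%:R by rewrite mulfVK// pnatr_eq0.
apply: edist_lt_coord => [|i]; first by rewrite divr_gt0.
exact: (xy.2 0 i).
Qed.

Lemma compact_ecompact K : compact K -> ecompact K.
Proof.
rewrite compact_cover => cK U oU incU KU.
have [||D _ DK] := cK nat setT U.
- by move=> k _; apply/eopen_open/oU.
- by move=> x /KU[k _ Ukx]; exists k.
exists (\max_(k <- finmap.enum_fset D) k)%N => x /DK[k /= kD Ukx].
by apply: increasing_le Ukx => //; apply: leq_bigmax_seq.
Qed.

Lemma ecompact_dist_pos F x : ecompact F -> ~ F x ->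
  exists2 e : R, 0 < e & forall y, F y -> e < edist x y.
Proof.
move=> cF nFx; have [|||k hk] := cF (fun k => [set y | k.+1%:R^-1 < edist x y]).
- by move=> k; apply: eopen_far.
- by move=> k y /=; apply: le_lt_trans; rewrite lef_pV2 ?posrE// ler_nat.
- move=> y Fy; have [|k hk] := @inv_nat_lt (edist x y); last by exists k.
  rewrite lt_neqAle edist_ge0 andbT eq_sym; apply/eqP => /edist_eq0 xy.
  by apply: nFx; rewrite xy.
- exists k.+1%:R^-1; first by rewrite invr_gt0.
  by move=> y /hk.
Qed.

Lemma ecompact_closed F : ecompact F -> eclosed F.
Proof.
move=> cF x /(ecompact_dist_pos cF)[e e0 h]; exists e => // y xy /h.
by rewrite ltNge (ltW xy).
Qed.

Lemma ecompact_subset A F : ecompact F -> eclosed A -> A `<=` F -> ecompact A.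
Proof.
move=> cF clA AF U oU incU AU.
have [|||k hk] := cF (fun k => U k `|` ~` A).
- by move=> k; apply: eopenU.
- by move=> k x [/incU|]; [left|right].
- move=> x Fx; case: (pselect (A x)) => [/AU[k _ h]|nA]; first by exists k => //; left.
  by exists 0%N => //; right.
- by exists k => x Ax; case: (hk x (AF _ Ax)) => //.
Qed.

Lemma ecompact_diff A F : ecompact F -> eopen A -> ecompact (F `\` A).
Proof.
move=> cF oA; apply: (ecompact_subset cF); last by move=> x [].
rewrite /eclosed setCD; apply: eopenU => //; exact: ecompact_closed.
Qed.

Lemma ecompactI A B : ecompact A -> ecompact B -> ecompact (A `&` B).
Proof.
move=> cA cB; apply: (ecompact_subset cA); last by move=> x [].
by rewrite /eclosed setCI; apply: eopenU; apply: ecompact_closed.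
Qed.

Lemma ecompact_dist A B : ecompact A -> ecompact B -> A `&` B = set0 ->
  exists2 e : R, 0 < e & forall x y, A x -> B y -> e < edist x y.
Proof.
move=> cA cB AB0.
(* The slack [e], uniform in [y], makes [U k] open. *)
pose U k := [set x | exists2 e : R, 0 < e & forall y, B y -> k.+1%:R^-1 + e < edist x y].
have [|||k hk] := cA U.
- move=> k x [e e0 h]; exists (e / 2); first by rewrite divr_gt0.
  move=> y xy; exists (e / 2); first by rewrite divr_gt0.
  move=> z /h; have := edist_triangle y x z.
  by set q := _^-1; lra.
- move=> k x [e e0 h]; exists e => // y /h; apply: le_lt_trans.
  by rewrite lerD2r lef_pV2 ?posrE// ler_nat.
- move=> x Ax; have [|e e0 h] := @ecompact_dist_pos B x cB.
    by move=> Bx; have : (A `&` B) x by []; rewrite AB0.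
  have [|k hk] := @inv_nat_lt (e / 2); first by rewrite divr_gt0.
  exists k => //; exists (e / 2); first by rewrite divr_gt0.
  by move=> y /h; move: hk; set q := _^-1; lra.
- exists k.+1%:R^-1; first by rewrite invr_gt0.
  by move=> x y /hk[e e0 h] /h; set q := _^-1; lra.
Qed.

Lemma ecompact_bounded K : ecompact K ->
  exists2 D : R, 0 < D & forall x y, K x -> K y -> edist x y < D.
Proof.
move=> cK; have [|||k hk] := cK (fun k => [set y | edist 0 y < k%:R]).
- by move=> k; apply: eopen_ball.
- by move=> k y /=; move/lt_le_trans; apply; rewrite ler_nat.
- move=> y _; exists (Num.bound (edist 0 y)) => //=.
  by rewrite (archi_boundP (edist_ge0 _ _)).
- exists (k%:R + k%:R + 1) => [|x y /hk/= x0 /hk/= y0]; first by rewrite ltr_wpDl// addr_ge0.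
  by have := edist_triangle 0 x y; rewrite (edistC x 0); lra.
Qed.

Lemma ecompact_image K (f : point -> point) (rho : R) A : 0 < rho ->
  similarity_on K f rho -> A `<=` K -> ecompact A -> ecompact (f @` A).
Proof.
move=> rho0 fs AK cA U oU incU fAU.
(* [f] is controlled on [K] only, so the preimage of an open set need not be open; [V k] is open,
   and its points in [A] are sent into [U k]. *)
pose V k := [set x | exists2 e : R, 0 < e &
  forall y, A y -> edist x y < e -> U k (f y)].
have [|||k hk] := cA V.
- move=> k x [e e0 h]; exists (e / 2); first by rewrite divr_gt0.
  move=> y xy; exists (e / 2); first by rewrite divr_gt0.
  by move=> z Az yz; apply: h => //; have := edist_triangle y x z; lra.
- by move=> k x [e e0 h]; exists e => // y Ay xy; apply/incU/h.
- move=> x Ax; have [|k _ /(oU k)[e e0 h]] := fAU (f x); first by exists x.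
  exists k => //; exists (e / rho); first by rewrite divr_gt0.
  move=> y Ay xy; apply: h; rewrite fs; [|exact: AK|exact: AK].
  by rewrite mulrC -ltr_pdivlMr.
- exists k => _ [x Ax <-]; have [e e0] := hk _ Ax.
  by apply=> //; rewrite edistxx.
Qed.

Lemma ecompact_finite_union (T : finType) (A : T -> set point) :
  (forall t, ecompact (A t)) -> ecompact (\bigcup_t A t).
Proof.
move=> cA U oU incU AU.
have /choice[k hk] : forall t, exists k, A t `<=` U k.
  by move=> t; apply: cA => // x Ax; apply: AU; exists t.
exists (\max_t k t)%N => x [t _ Atx].
by apply: increasing_le (hk _ _ Atx) => //; apply: leq_bigmax.
Qed.

Lemma ecompact_nested_sub K V (A : nat -> set point) :
  ecompact K -> eopen V -> (forall k, ecompact (A k)) ->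
  (forall k, A k.+1 `<=` A k) -> K `&` (\bigcap_k A k) `<=` V ->
  exists k, K `&` A k `<=` V.
Proof.
move=> cK oV cA decA AV; have [|||k hk] := cK (fun k => V `|` ~` A k).
- by move=> k; apply: eopenU => //; apply: ecompact_closed.
- by move=> k x [|nA]; [left|right => /decA].
- move=> x Kx; case: (pselect (forall k, A k x)) => [h|/existsNP[k h]].
    by exists 0%N => //; left; apply: AV; split => // k _.
  by exists k => //; right.
- by exists k => x [Kx Ax]; case: (hk x Kx).
Qed.

Lemma ecompact_nested_nonempty (A : nat -> set point) :
  (forall k, ecompact (A k)) -> (forall k, A k.+1 `<=` A k) ->
  (forall k, A k !=set0) -> \bigcap_k A k !=set0.
Proof.
move=> cA decA neA; apply/set0P/negP => /eqP A0.
have [||k hk] := @ecompact_nested_sub (A 0%N) set0 A (cA 0%N) _ cA decA.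
- by move=> x.
- by rewrite A0 setI0.
have [x Ax] := neA k; apply: (hk x); split => //.
elim: k {hk} Ax => // k IH /decA; exact: IH.
Qed.

End Compactness.

(** * Finite partial sums and continuity of powers *)

Section Sums.
Context {R : realType}.
Implicit Types (a b c s : R).

Lemma sum_le_esum (T : choiceType) (J : set T) (f : T -> R) (l : seq T) :
  uniq l -> (forall t, t \in l -> J t) -> (forall t, 0 <= f t) ->
  ((\sum_(t <- l) f t)%:E <= \esum_(t in J) (f t)%:E)%E.
Proof.
move=> ul lJ f0; apply: esum_ge; exists [set` l].
  by split; [exact: finite_seq|move=> t /= /lJ].
by rewrite -fsbig_seq// sumEFin.
Qed.

Lemma esum_le (T : choiceType) (J : set T) (f : T -> R) c :
  (forall l : seq T, uniq l -> (forall t, t \in l -> J t) -> \sum_(t <- l) f t <= c) ->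
  (\esum_(t in J) (f t)%:E <= c%:E)%E.
Proof.
move=> h; apply/ereal_supP => _ [A [finA AJ] <-].
rewrite fsbig_finite//= sumEFin lee_fin; apply: h; first exact: finmap.fset_uniq.
by move=> t; rewrite in_fset_set// inE => /AJ.
Qed.

Lemma powR_right_cont a s e : 0 <= a -> 0 <= s -> 0 < e ->
  exists2 b, a < b & b `^ s <= a `^ s + e.
Proof.
move=> a0; rewrite le_eqVlt => /predU1P[<-|s0] e0.
  by exists (a + 1); [rewrite ltrDl|rewrite !powRr0 lerDl ltW].
have v0 : 0 < a `^ s + e by rewrite ltr_wpDl// powR_ge0.
exists ((a `^ s + e) `^ s^-1); last first.
  by rewrite -powRrM mulVf ?gt_eqF// powRr1// ltW.
rewrite -[ltLHS](powRr1 a0) -(mulfV (lt0r_neq0 s0)) powRrM.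
by rewrite gt0_ltr_powR ?invr_gt0// ?nnegrE ?powR_ge0// ?(ltW v0)// ltrDl.
Qed.

Lemma powR_left_cont1 s c : 0 <= s -> c < 1 ->
  exists2 b, 0 < b < 1 & c <= b `^ s.
Proof.
rewrite le_eqVlt => /predU1P[<-|s0] c1.
  by exists 2^-1; rewrite ?powRr0 ?(ltW c1)//; lra.
pose v := Num.max c 2^-1.
have v0 : 0 < v by rewrite lt_max; apply/orP; right; lra.
have v1 : v < 1 by rewrite gt_max c1 /=; lra.
exists (v `^ s^-1); last first.
  by rewrite -powRrM mulVf ?gt_eqF// powRr1 ?(ltW v0)// le_max lexx.
rewrite powR_gt0//= -[ltRHS](congr1 (fun f => f s^-1) (@powR1 R)).
by rewrite gt0_ltr_powR ?invr_gt0// nnegrE ltW.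
Qed.

Lemma powR_small s e : 0 < s -> 0 < e -> exists2 b, 0 < b & b `^ s <= e.
Proof.
move=> s0 e0; have [b b0] := @powR_right_cont 0 s e (lexx _) (ltW s0) e0.
by rewrite powR0 ?gt_eqF// add0r; exists b.
Qed.

Lemma expr_small a e : 0 <= a < 1 -> 0 < e -> exists k, a ^+ k < e.
Proof.
move=> /andP[a0 a1] e0; have : (fun k => a ^+ k) @ \oo --> (0 : R).
  by apply: cvg_expr; rewrite ger0_norm.
move/cvgrPdist_lt/(_ e e0) => [k _ /(_ k (leqnn k))] /=.
by rewrite sub0r normrN ger0_norm ?exprn_ge0//; exists k.
Qed.

End Sums.

(** * Packing premeasure and packing measure *)

Section Packing.
Context {R : realType} {n : nat}.
Notation point := 'rV[R]_n.
Implicit Types (x y z : point) (A B E F K : set point) (s c d e : R).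
Implicit Types (l : seq (point * R)).

(** For positive radii this is disjointness of the closed balls with the given centres and radii, by
    [cball_disjoint]. *)
Definition separated (a b : point * R) := a.2 + b.2 < edist a.1 b.1.

Lemma separatedC a b : separated a b = separated b a.
Proof. by rewrite /separated addrC edistC. Qed.

Definition fpack E d l := pairwise separated l /\
  forall a, a \in l -> E a.1 /\ 0 < a.2 <= d.

Definition pmass s l := \sum_(a <- l) (2 * a.2) `^ s.

Lemma pmass_cat s l l' : pmass s (l ++ l') = pmass s l + pmass s l'.
Proof. exact: big_cat. Qed.

Lemma pmass_ge0 s l : 0 <= pmass s l.
Proof. by apply: sumr_ge0 => a _; exact: powR_ge0. Qed.

Lemma fpack_nil E d : fpack E d [::].
Proof. by []. Qed.

Lemma fpackS E F d d' l : E `<=` F -> d <= d' -> fpack E d l -> fpack F d' l.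
Proof.
move=> EF dd [pl hl]; split=> // a /hl[/EF Fa /andP[-> /le_trans->]] //.
Qed.

Lemma fpack_filter E d l (P : pred (point * R)) :
  fpack E d l -> fpack E d [seq a <- l | P a].
Proof.
move=> [pl hl]; split; first exact: pairwise_filter.
by move=> a; rewrite mem_filter => /andP[_ /hl].
Qed.

Lemma fpack_cat E F d l l' :
  (forall a b, a \in l -> b \in l' -> separated a b) ->
  fpack E d l -> fpack F d l' -> fpack (E `|` F) d (l ++ l').
Proof.
move=> sep [pl hl] [pl' hl']; split.
  by rewrite pairwise_cat pl pl' !andbT; apply/allrelP.
by move=> a; rewrite mem_cat => /orP[/hl|/hl'] [? ->]; split=> //; [left|right].
Qed.

(** An [esum] of nonnegative terms is determined by its finite partial sums, so lists of balls can
    replace countable families. *)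
Lemma packing_delta_le s d E c :
  (packing_delta s d E <= c%:E)%E <-> (forall l, fpack E d l -> pmass s l <= c).
Proof.
split=> [h l [pl hl]|h].
  rewrite -lee_fin; apply: le_trans h; apply: le_ereal_sup_tmp.
  pose a0 : point * R := (0, 0); pose J := [set k | (k < size l)%N].
  exists (\esum_(k in J) ((2 * (nth a0 l k).2) `^ s)%:E).
    exists (J, fun k => (nth a0 l k).1, fun k => (nth a0 l k).2) => //.
    split=> /= [k kl|k k' kl k'l kk']; first exact/hl/mem_nth.
    have [_ /andP[p _]] := hl _ (mem_nth a0 kl).
    have [_ /andP[p' _]] := hl _ (mem_nth a0 k'l).
    apply/cball_disjoint => //; move/(pairwiseP a0): pl => pl.
    case: (ltngtP k k') kk' => // lt _; first exact: pl.
    by rewrite -/(separated _ _) separatedC; apply: pl.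
  rewrite /pmass (big_nth a0) big_mkord -(big_mkord xpredT (fun k => (2 * (nth a0 l k).2) `^ s)).
  apply: (@sum_le_esum _ _ J (fun k => (2 * (nth a0 l k).2) `^ s)).
  - exact: iota_uniq.
  - by move=> k; rewrite mem_index_iota.
  - by move=> k; apply: powR_ge0.
apply/ereal_supP => _ [[[J x] r] /= [h1 h2] <-].
apply: (@esum_le _ _ J (fun k => (2 * r k) `^ s)) => l ul lJ.
have := h [seq (x k, r k) | k <- l]; rewrite /pmass big_map; apply; split; last first.
  by move=> a /mapP[k /lJ /h1 hk ->].
rewrite pairwise_map; move: ul; rewrite uniq_pairwise.
apply: (@sub_in_pairwise _ [pred k | k \in l]) => [k k' kl kl' /= /eqP kk'|].
  apply/cball_disjoint; last exact: h2 (lJ _ kl) (lJ _ kl') kk'.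
  - by have [_ /andP[]] := h1 _ (lJ _ kl).
  - by have [_ /andP[]] := h1 _ (lJ _ kl').
by apply/allP.
Qed.

(** [ple] and [pge] are upper and lower bounds for the packing premeasure, expressed by finite
    packings; [packing_pre_le] and [packing_pre_ge] prove the equivalence. *)
Definition ple s E c := forall c', c < c' ->
  exists2 d, 0 < d & forall l, fpack E d l -> pmass s l <= c'.

Definition pge s E c := forall c' d, c' < c -> 0 < d ->
  exists2 l, fpack E d l & c' < pmass s l.

Lemma packing_pre_le s E c : (packing_pre s E <= c%:E)%E <-> ple s E c.
Proof.
split=> [h c' cc'|h].
  have /ereal_inf_lt[_ [d /= d0 <-] hd] : (packing_pre s E < c'%:E)%E.
    by apply: le_lt_trans h _; rewrite lte_fin.
  by exists d => //; apply/packing_delta_le/ltW.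
apply/lee_addgt0Pr => e e0; have [|d d0 hd] := h (c + e); first by rewrite ltrDl.
rewrite -EFinD; apply: ge_ereal_inf; exists (packing_delta s d E); first by exists d.
exact/packing_delta_le.
Qed.

Lemma packing_pre_ge s E c : (c%:E <= packing_pre s E)%E <-> pge s E c.
Proof.
split=> [h c' d cc' d0|h].
  apply: contrapT => nl; suff : (packing_pre s E <= c'%:E)%E.
    by move=> /(le_trans h); rewrite lee_fin leNgt cc'.
  apply: ge_ereal_inf; exists (packing_delta s d E); first by exists d.
  apply/packing_delta_le => l hl; rewrite leNgt; apply/negP => lt.
  by apply: nl; exists l.
apply: le_ereal_inf_tmp => _ [d /= d0 <-]; rewrite leNgt; apply/negP => lt.
(* The empty packing excludes [-oo], so that the case analysis leaves a real value. *)
have pd0 : (0 <= packing_delta s d E)%E.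
  by apply: ereal_sup_ubound; exists (set0, fun=> 0, fun=> 0); rewrite ?esum_set0//; split.
case: (packing_delta s d E) lt pd0 (packing_delta_le s d E) => // p.
rewrite lte_fin => pc _ hp.
have [l hl] := h p d pc d0; have [/(_ (lexx _)) /(_ l hl) ple _] := hp p.
by rewrite ltNge ple.
Qed.

End Packing.

Section PackingContent.
Context {R : realType} {n : nat}.
Notation point := 'rV[R]_n.
Implicit Types (x y z : point) (A B E F K : set point) (s c d e : R).
Implicit Types (l : seq (point * R)).

Lemma ple_ge0 s E c : ple s E c -> 0 <= c.
Proof.
move=> h; rewrite leNgt; apply/negP => c0.
have [|d _ hd] := h (c / 2); first by lra.
by have := hd [::] (fpack_nil _ _); rewrite /pmass big_nil; lra.
Qed.

Lemma pleS s E F c c' : E `<=` F -> c <= c' -> ple s F c -> ple s E c'.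
Proof.
move=> EF cc' h c2 /(le_lt_trans cc')/h[d d0 hd]; exists d => // l hl.
by apply: hd; apply: fpackS hl.
Qed.

Lemma ple_set0 s : ple s (set0 : set point) 0.
Proof.
move=> c c0; exists 1 => // -[_|a l]; first by rewrite /pmass big_nil ltW.
by move=> [_ /(_ a)]; rewrite inE eqxx => /(_ isT)[].
Qed.

Lemma ple_lim s E c : (forall e, 0 < e -> ple s E (c + e)) -> ple s E c.
Proof.
move=> h c' cc'; have [||d d0 hd] := h ((c' - c) / 2) _ c'; [lra|lra|by exists d].
Qed.

Lemma pge_ple s E c c' : pge s E c -> ple s E c' -> c <= c'.
Proof.
move=> h h'; rewrite leNgt; apply/negP => lt.
have [|d d0 hd] := h' ((c + c') / 2); first by lra.
have [||l /hd] := h ((c + c') / 2) d; [lra|by []|lra].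
Qed.

Lemma npge_ple s E c : ~ pge s E c -> exists2 c', c' < c & ple s E c'.
Proof.
move=> /existsNP[c' /existsNP[d /not_implyP[c'c /not_implyP[d0 h]]]].
exists c' => // c2 c'c2; exists d => // l hl; rewrite leNgt; apply/negP => lt.
by apply: h; exists l => //; apply: lt_trans lt.
Qed.

Lemma pleU s E F c c' : ple s E c -> ple s F c' -> ple s (E `|` F) (c + c').
Proof.
move=> hE hF c2 lt; pose e := (c2 - (c + c')) / 2.
have [|d d0 hd] := hE (c + e); first by rewrite ltrDl /e; lra.
have [|d' d'0 hd'] := hF (c' + e); first by rewrite ltrDl /e; lra.
exists (Num.min d d'); first by rewrite lt_min d0.
move=> l [pl hl]; pose P (a : point * R) := `[< E a.1 >].
rewrite /pmass (bigID P)/= -!(big_filter l).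
have le1 : pmass s [seq a <- l | P a] <= c + e.
  apply: hd; split; first exact: pairwise_filter.
  move=> a; rewrite mem_filter => /andP[/asboolP Ea /hl[_]]; rewrite le_min.
  by move=> /and3P[-> -> _].
have le2 : pmass s [seq a <- l | ~~ P a] <= c' + e.
  apply: hd'; split; first exact: pairwise_filter.
  move=> a; rewrite mem_filter => /andP[/asboolPn nEa /hl[]]; rewrite le_min.
  by move=> [//|Fa] /and3P[-> _ ->].
by move: le1 le2; rewrite /pmass /e; lra.
Qed.

Lemma pge_diff s A U a b : pge s A a -> ple s (A `&` U) b -> pge s (A `\` U) (a - b).
Proof.
move=> hA hU; apply: contrapT => /npge_ple[c' lt h].
have : ple s A (b + c').
  apply: pleS (pleU hU h) => // x Ax.
  by case: (pselect (U x)) => [Ux|nUx]; [left|right].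
by move=> /(pge_ple hA); lra.
Qed.

Lemma pgeS s E F c c' : E `<=` F -> c' <= c -> pge s E c -> pge s F c'.
Proof.
move=> EF cc' h c2 d lt d0; have [|l hl lm] := h c2 d _ d0; first exact: lt_le_trans cc'.
by exists l => //; apply: fpackS hl.
Qed.

Lemma ple_bigU s (T : eqType) (l : seq T) (E : T -> set point) (c : T -> R) :
  (forall t, t \in l -> ple s (E t) (c t)) ->
  ple s (\bigcup_(t in [set` l]) E t) (\sum_(t <- l) c t).
Proof.
elim: l => [_|t l IH h].
  by rewrite big_nil; apply: pleS (ple_set0 s) => // x [].
rewrite big_cons; apply: (@pleS _ _ (E t `|` \bigcup_(t in [set` l]) E t) _ _ _ (lexx _)).
  by move=> x [t']; rewrite /= inE => /predU1P[->|t'l]; [left|right; exists t'].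
apply: pleU; first by apply: h; rewrite inE eqxx.
by apply: IH => t' t'l; apply: h; rewrite inE t'l orbT.
Qed.

(** Balls of diameter at most [b] satisfy $(2r)^t \le b^{t-s} (2r)^s$, and [b] can be taken
    arbitrarily small. *)
Lemma ple_exponent s t E c : 0 <= s -> s < t -> ple s E c -> ple t E 0.
Proof.
move=> s0 st h e e0; have c0 := ple_ge0 h.
have [|d d0 hd] := h (c + 1); first by rewrite ltrDl.
have [||b b0 hb] := @powR_small R (t - s) (e / (c + 1)); first by rewrite subr_gt0.
  by rewrite divr_gt0 ?ltr_wpDl.
exists (Num.min d (b / 2)); first by rewrite lt_min d0 divr_gt0.
move=> l hl; apply: (@le_trans _ _ (\sum_(a <- l) (e / (c + 1)) * (2 * a.2) `^ s)).
  rewrite /pmass !big_seq; apply: ler_sum => a /(hl.2 a)[_].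
  rewrite le_min => /and3P[a0 _ ab].
  rewrite -{1}(subrK s t) powRD ?ler_wpM2r ?powR_ge0//; last first.
    by rewrite subrK gt_eqF ?(le_lt_trans s0 st).
  apply: le_trans hb; apply: ge0_ler_powR; rewrite ?nnegrE ?subr_ge0 ?(ltW st) ?(ltW b0) //.
    by rewrite mulr_ge0// ltW.
  by lra.
rewrite -mulr_sumr -/(pmass s l).
apply: (@le_trans _ _ (e / (c + 1) * (c + 1))); last by rewrite mulfVK ?gt_eqF ?ltr_wpDl.
rewrite ler_wpM2l ?divr_ge0 ?(ltW e0) ?addr_ge0//; apply: hd.
by apply: fpackS hl => //; rewrite ge_min lexx.
Qed.

Lemma ple_exponent_le s t E c : 0 <= s -> s <= t -> ple s E c -> exists c', ple t E c'.
Proof.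
move=> s0; rewrite le_eqVlt => /predU1P[<-|st h]; first by exists c.
by exists 0; apply: ple_exponent h.
Qed.

(** Finitely many strict inequalities leave room to move the centres while radii, hence masses, stay
    fixed. The halving of [d] allows for both centres of a pair moving. *)
Lemma separated_perturb l : pairwise separated l ->
  exists2 e, 0 < e & forall g : point -> point,
    (forall a, a \in l -> edist a.1 (g a.1) < e) ->
    pairwise separated [seq (g a.1, a.2) | a <- l].
Proof.
elim: l => [_|a l IH /= /andP[al /IH[e e0 he]]]; first by exists 1.
have [|d d0 hd] := @finite_lower_bound R _ l (fun b => edist a.1 b.1 - (a.2 + b.2)).
  by move=> b /(allP al); rewrite subr_gt0.
exists (Num.min e (d / 2)); first by rewrite lt_min e0 divr_gt0.
move=> g hg; apply/andP; split; last first.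
  by apply: he => b bl; have := hg b; rewrite inE bl orbT lt_min => /(_ isT)/andP[].
apply/allP => _ /mapP[b bl ->]; rewrite /separated /=.
have := hg a; rewrite inE eqxx => /(_ isT); have := hg b; rewrite inE bl orbT => /(_ isT).
rewrite !lt_min => /andP[_ h1] /andP[_ h2]; have := hd _ bl.
have := edist_triangle (g a.1) a.1 b.1; have := edist_triangle (g b.1) (g a.1) b.1.
rewrite (edistC (g b.1) b.1); lra.
Qed.

Lemma fpack_perturb E d l : fpack E d l -> exists2 e, 0 < e &
  forall F, (forall a, a \in l -> exists2 y, F y & edist a.1 y < e) ->
    forall s, exists2 l', fpack F d l' & pmass s l' = pmass s l.
Proof.
move=> [/separated_perturb[e e0 he] hl]; exists e => // F hF s.
have /choice[g hg] : forall x, exists y,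
    (exists2 a, a \in l & a.1 = x) -> F y /\ edist x y < e.
  move=> x; case: (pselect (exists2 a, a \in l & a.1 = x)) => [[a /hF[y Fy xy] <-]|no].
    by exists y.
  by exists x.
exists [seq (g a.1, a.2) | a <- l]; last by rewrite /pmass big_map.
split; first by apply: he => a al; case: (hg a.1) => //; exists a.
move=> _ /mapP[a al ->] /=; have [_ ->] := hl a al; split=> //.
by case: (hg a.1) => //; exists a.
Qed.

(** The centres of a packing of [F] can be moved into [E], by [fpack_perturb]: passing to a closure
    does not increase the premeasure. *)
Lemma ple_dense s E F c :
  (forall x e, F x -> 0 < e -> exists2 y, E y & edist x y < e) ->
  ple s E c -> ple s F c.
Proof.
move=> dense h c' /h[d d0 hd]; exists d => // l hl.
have [e e0 he] := fpack_perturb hl.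
have [|l' /hd hl' <- //] := he E _ s.
by move=> a /hl.2[Fa _]; exact: dense.
Qed.

Lemma fpack_image K (f : point -> point) (rho d : R) E l : 0 < rho ->
  similarity_on K f rho -> E `<=` K -> fpack E d l ->
  fpack (f @` E) (rho * d) [seq (f a.1, rho * a.2) | a <- l].
Proof.
move=> rho0 fs EK [pl hl]; split; last first.
  move=> _ /mapP[a /hl[Ea /andP[a0 ad]] ->] /=; split; first by exists a.1.
  by rewrite mulr_gt0// ler_pM2l.
rewrite pairwise_map; have : all [in l] l by apply/allP.
move=> /sub_in_pairwise; apply; last exact: pl.
move=> a b /hl[Ea _] /hl[Eb _]; rewrite /separated /= fs; [|exact: EK|exact: EK].
by rewrite -mulrDr ltr_pM2l.
Qed.

Lemma pmass_scale s (rho : R) (g : point * R -> point) E d l : 0 <= rho -> fpack E d l ->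
  pmass s [seq (g a, rho * a.2) | a <- l] = rho `^ s * pmass s l.
Proof.
move=> rho0 [_ hl]; rewrite /pmass big_map mulr_sumr !big_seq.
apply: eq_bigr => a /hl[_ /andP[a0 _]] /=.
by rewrite mulrCA (@powRM _ rho)// mulr_ge0// ltW.
Qed.

Lemma pge_image K (f : point -> point) (rho : R) s E c : 0 < rho ->
  similarity_on K f rho -> E `<=` K -> pge s E c -> pge s (f @` E) (rho `^ s * c).
Proof.
move=> rho0 fs EK h c' d lt d0.
have r0 : 0 < rho `^ s by rewrite powR_gt0.
have [||l hl hc] := h (c' / rho `^ s) (d / rho).
- by rewrite ltr_pdivrMr// mulrC.
- by rewrite divr_gt0.
exists [seq (f a.1, rho * a.2) | a <- l].
  have := fpack_image rho0 fs EK hl; rewrite mulrCA mulfV ?gt_eqF// mulr1; exact.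
by rewrite (@pmass_scale s rho (fun a => f a.1) _ _ _ (ltW rho0) hl) mulrC -ltr_pdivrMr.
Qed.

Lemma ple_image K (f : point -> point) (rho : R) s E c : 0 < rho ->
  similarity_on K f rho -> E `<=` K -> ple s E c -> ple s (f @` E) (rho `^ s * c).
Proof.
move=> rho0 fs EK h c' lt.
have r0 : 0 < rho `^ s by rewrite powR_gt0.
have [|d d0 hd] := h (c' / rho `^ s); first by rewrite ltr_pdivlMr// mulrC.
exists (rho * d); first by rewrite mulr_gt0.
move=> l [pl hl].
have /choice[g hg] : forall y, exists x, (f @` E) y -> E x /\ f x = y.
  move=> y; case: (pselect ((f @` E) y)) => [[x Ex <-]|no]; first by exists x.
  by exists y.
have hl' : fpack E d [seq (g a.1, rho^-1 * a.2) | a <- l].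
  split; last first.
    move=> _ /mapP[a /hl[/hg[Ea _] /andP[a0 ad]] ->] /=; split=> //.
    by rewrite mulr_gt0 ?invr_gt0//= mulrC ler_pdivrMr// mulrC.
  rewrite pairwise_map; have : all [in l] l by apply/allP.
  move=> /sub_in_pairwise; apply; last exact: pl.
  move=> a b /hl[/hg[Ea fa] _] /hl[/hg[Eb fb] _]; rewrite /separated /= -{1}fa -{1}fb.
  rewrite fs; [|exact: EK|exact: EK].
  by rewrite -mulrDr ltr_pdivrMl.
have := hd _ hl'; rewrite (@pmass_scale _ _ (fun a => g a.1) (f @` E) (rho * d)) ?invr_ge0 ?(ltW rho0)//.
rewrite -powR_inv1 ?(ltW rho0)// -powRrM mulN1r powRN mulrC ler_pM2r ?invr_gt0//.
Qed.

End PackingContent.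

(** * Neighbourhoods, and packing measure against premeasure *)

Section Neighborhood.
Context {R : realType} {n : nat}.
Notation point := 'rV[R]_n.
Implicit Types (x y z : point) (A B E F K : set point) (s c d e : R).
Implicit Types (l : seq (point * R)).

Definition enbhd A e : set point := [set y | exists2 x, A x & edist x y < e].

Lemma eopen_enbhd A e : eopen (enbhd A e).
Proof.
move=> y [x Ax xy]; exists (e - edist x y); first by rewrite subr_gt0.
by move=> z yz; exists x => //; move: yz; have := edist_triangle y x z; lra.
Qed.

Lemma subset_enbhd A e : 0 < e -> A `<=` enbhd A e.
Proof. by move=> e0 x Ax; exists x => //; rewrite edistxx. Qed.

(* Otherwise packings of [F] near [A] have mass [> a + e] at every scale. The
   balls centred within [theta] times their radius of [A] can be moved into
   [A], so those further away keep mass at least [e / 2]; shrunk by [theta / 2]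
   they stay off a neighbourhood of [A], which leaves room for a new generation
   of such balls closer to [A]. Infinitely many generations contradict
   [packing_pre s F < oo]. *)
Lemma ple_enbhd s F A C a e : 0 <= s -> A `<=` F -> ple s F C -> ple s A a ->
  0 < e -> exists2 eta, 0 < eta & ple s (F `&` enbhd A eta) (a + e).
Proof.
move=> s0 AF hF hA e0; have a0 := ple_ge0 hA.
have [|dA dA0 hdA] := hA (a + e / 4); first by lra.
(* [theta] is chosen with $(1-\theta)^s (a + e/2) \ge a + e/4$: moving a centre by at most $\theta$
   times its radius is paid for by shrinking the radius by the factor $1-\theta$. *)
have [|theta' th'] := @powR_left_cont1 R s ((a + e / 4) / (a + e / 2)) s0.
  by rewrite ltr_pdivrMr; lra.
rewrite ler_pdivrMr; last by lra.
pose theta := 1 - theta'; rewrite (_ : theta' = 1 - theta); last by rewrite /theta; lra.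
have th : 0 < theta < 1 by rewrite /theta; lra.
move: th => /andP[th0 th1] {th'} hth.
have [|dF dF0 hdF] := hF (C + 1); first by lra.
apply: contrapT => nex.
have big eta d : 0 < eta -> 0 < d ->
    exists2 l, fpack (F `&` enbhd A eta) d l & a + e < pmass s l.
  move=> eta0 d0; apply: contrapT => nl; apply: nex; exists eta => // c' cc'.
  exists d => // l hl; rewrite leNgt; apply/negP => lt; apply: nl; exists l => //.
  exact: lt_trans lt.
pose kappa := (theta / 2) `^ s * (e / 2).
have kappa0 : 0 < kappa by rewrite mulr_gt0 ?powR_gt0 ?divr_gt0.
have stage eta : 0 < eta -> exists2 l, fpack (F `&` enbhd A eta) (Num.min dF eta) l &
    kappa <= pmass s l /\ exists2 z, 0 < z &
      forall b y, b \in l -> A y -> b.2 + z < edist b.1 y.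
  move=> eta0; have [|l hl lm] := big eta (Num.min dA (Num.min dF eta)) eta0.
    by rewrite !lt_min dA0 dF0.
  pose good (b : point * R) := `[< exists2 y, A y & edist b.1 y <= theta * b.2 >].
  pose lg := [seq b <- l | good b]; pose lb := [seq b <- l | ~~ good b].
  have split_mass : pmass s l = pmass s lg + pmass s lb.
    by rewrite /pmass (bigID good)/= -!(big_filter l).
  have lgm : pmass s lg <= a + e / 2.
    have /choice[g hg] : forall b, exists y, b \in lg -> A y /\ edist b.1 y <= theta * b.2.
      move=> b; case: (boolP (b \in lg)) => [|_]; last by exists 0.
      by rewrite mem_filter => /andP[/asboolP[y Ay yb] _]; exists y.
    have hlg : fpack F dF lg.
      apply: fpack_filter; apply: (fpackS _ _ hl); first by move=> x [].
      by rewrite ge_min ge_min lexx orbT.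
    have : pmass s [seq (g b, (1 - theta) * b.2) | b <- lg] <= a + e / 4.
      apply: hdA; split; last first.
        move=> _ /mapP[b blg ->] /=; split; first by case: (hg b blg).
        move: blg; rewrite mem_filter => /andP[_ /hl.2[_]]; rewrite le_min.
        by move=> /and3P[b0 bd _]; apply/andP; split; nra.
      rewrite pairwise_map; have : all [in lg] lg by apply/allP.
      move=> /sub_in_pairwise; apply; last exact: hlg.1.
      move=> b b' blg b'lg; rewrite /separated /=.
      have [_ h1] := hg b blg; have [_ h2] := hg b' b'lg.
      have := edist_triangle (g b) b.1 b'.1; have := edist_triangle (g b') (g b) b'.1.
      rewrite (edistC (g b') b'.1); move: h1 h2; set q1 := edist _ _; set q2 := edist _ _.
      nra.
    rewrite (@pmass_scale _ _ s (1 - theta) g _ _ _ _ hlg); last by lra.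
    move=> /le_trans/(_ hth); rewrite ler_pM2l// powR_gt0//; lra.
  have lbm : e / 2 <= pmass s lb by lra.
  have hlb : fpack (F `&` enbhd A eta) (Num.min dF eta) lb.
    apply: fpack_filter; apply: (fpackS _ _ hl) => //.
    by rewrite ge_min lexx orbT.
  exists [seq (b.1, theta / 2 * b.2) | b <- lb].
    split; last first.
      move=> _ /mapP[b /hlb.2[? /andP[b0 bd]] ->] /=; split=> //.
      by apply/andP; split; [nra|apply: le_trans bd; nra].
    rewrite pairwise_map; have : all [in lb] lb by apply/allP.
    move=> /sub_in_pairwise; apply; last exact: hlb.1.
    move=> b b' /hlb.2[_ /andP[b0 _]] /hlb.2[_ /andP[b'0 _]]; rewrite /separated /=.
    by apply: le_lt_trans; nra.
  split.
    rewrite (@pmass_scale _ _ s (theta / 2) (fun b => b.1) _ _ _ _ hlb); last by lra.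
    by rewrite ler_pM2l// powR_gt0// divr_gt0.
  have [|z z0 hz] := @finite_lower_bound R _ lb (fun b => theta / 2 * b.2).
    by move=> b /hlb.2[_ /andP[b0 _]]; nra.
  exists z => // _ y /mapP[b blb ->] Ay /=; have := hz b blb.
  move: blb; rewrite mem_filter => /andP[/asboolPn nb _].
  have : theta * b.2 < edist b.1 y.
    by rewrite ltNge; apply/negP => le; apply: nb; exists y.
  lra.
(* Each generation adds mass at least [kappa] and stays at a positive distance from [A], while the
   total mass of any such packing is at most $C + 1$. *)
have iter q : exists2 l, fpack F dF l & q%:R * kappa <= pmass s l /\
    exists2 z, 0 < z & forall b y, b \in l -> A y -> b.2 + z < edist b.1 y.
  elim: q => [|q [l hl [lm [z z0 hz]]]].
    by exists [::] => //; rewrite mul0r pmass_ge0; split=> //; exists 1.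
  (* New centres within $z/2$ of [A] and new radii at most $z/2$ keep the new balls separated from
     the old ones, whose margin is [z]. *)
  have [|l' hl' [lm' [z' z'0 hz']]] := stage (z / 2); first by rewrite divr_gt0.
  exists (l ++ l').
    apply: (@fpackS _ _ (F `|` (F `&` enbhd A (z / 2))) _ dF dF) => //.
      by move=> x [|[]].
    apply: fpack_cat => //; last first.
      by apply: fpackS hl' => //; rewrite ge_min lexx.
    move=> b b' bl /hl'.2[[_ [x Ax xb']]]; rewrite le_min => /and3P[_ _ b'z].
    have := hz b x bl Ax; have := edist_triangle b'.1 b.1 x.
    rewrite /separated (edistC b'.1 x); lra.
  split; first by rewrite pmass_cat -natr1 mulrDl mul1r lerD.
  exists (Num.min z z'); first by rewrite lt_min z0.
  move=> b y; rewrite mem_cat => /orP[bl|bl] Ay.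
    by apply: le_lt_trans (hz b y bl Ay); rewrite lerD2l ge_min lexx.
  by apply: le_lt_trans (hz' b y bl Ay); rewrite lerD2l ge_min lexx orbT.
have [l /hdF lC [lm _]] := iter (Num.bound ((C + 1) / kappa)).
have : (C + 1) / kappa < (Num.bound ((C + 1) / kappa))%:R.
  by apply: archi_boundP; rewrite divr_ge0 ?(ltW kappa0)// addr_ge0// (ple_ge0 hF).
by rewrite ltr_pdivrMr// ltNge (le_trans lm lC).
Qed.

Lemma geometric_sum_le e k : 0 <= e -> \sum_(j <- iota 0 k) e / 2 ^+ j.+1 <= e.
Proof.
move=> e0; suff -> : \sum_(j <- iota 0 k) e / 2 ^+ j.+1 = e * (1 - (2 ^+ k)^-1).
  by rewrite ler_piMr// gerBl invr_ge0 exprn_ge0.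
elim: k => [|k IH]; first by rewrite big_nil expr0 invr1 subrr mulr0.
rewrite -addn1 iotaD big_cat /= IH big_seq1 add0n addn1 exprS.
have : 2 ^+ k != 0 :> R by rewrite expf_neq0.
by move: (2 ^+ k) => q q0; field.
Qed.

Lemma packing_pre_ge0 s E : (0 <= packing_pre s E)%E.
Proof. by apply/packing_pre_ge => c' d c'0 d0; exists [::]; rewrite // /pmass big_nil. Qed.

Lemma packing_le_pre s E : (packing s E <= packing_pre s E)%E.
Proof.
apply: ge_ereal_inf; exists (\esum_(k in [set: nat])
    packing_pre s (if k == 0%N then E else set0)).
  by exists (fun k => if k == 0%N then E else set0) => // x Ex; exists 0%N.
have pre0 : packing_pre s (set0 : set point) = 0%E.
  by apply/eqP; rewrite eq_le packing_pre_ge0 andbT; apply/packing_pre_le/ple_set0.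
rewrite -[leRHS](@esum_set1 R nat 0%N (fun=> packing_pre s E)) ?packing_pre_ge0//.
rewrite [leRHS]esum_mkcond; apply: le_esum => k _.
case: ifPn => [/eqP ->|k0]; first by rewrite mem_set.
by rewrite memNset ?pre0// => /= k0'; rewrite k0' eqxx in k0.
Qed.

Lemma packing_le_cover s E c : (packing s E < c%:E)%E ->
  exists (A : nat -> set point) (p : nat -> R), [/\ E `<=` \bigcup_k A k,
    forall k, ple s (A k) (p k) & (\esum_(k in [set: nat]) (p k)%:E < c%:E)%E].
Proof.
move=> /ereal_inf_lt[_ [A EA <-] lt].
have fin k : packing_pre s (A k) \is a fin_num.
  rewrite ge0_fin_numE ?packing_pre_ge0//; apply: le_lt_trans (ltry c).
  apply: le_trans (ltW lt); apply: esum_ge; exists [set k]; first by split.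
  by rewrite fsbig_set1.
exists A, (fun k => fine (packing_pre s (A k))); split=> //.
  by move=> k; apply/packing_pre_le; rewrite fineK.
by under eq_esum do rewrite fineK//.
Qed.

(* Due to Feng, Hua and Wen. *)
Lemma packing_compact s F C : 0 <= s -> ecompact F -> ple s F C ->
  packing s F = packing_pre s F.
Proof.
move=> s0 cF hF; apply/eqP; rewrite eq_le packing_le_pre /=.
rewrite leNgt; apply/negP => lt.
have Fin : packing_pre s F \is a fin_num.
  by rewrite ge0_fin_numE ?packing_pre_ge0//; apply: le_lt_trans (ltry C); apply/packing_pre_le.
move: lt; rewrite -(fineK Fin); set c := fine _ => lt.
have [c' c'c lt'] : exists2 c', c' < c & (packing s F < c'%:E)%E.
  case: (packing s F) lt => [p| |]//.
    by rewrite lte_fin => pc; exists ((p + c) / 2); rewrite ?lte_fin; lra.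
  by move=> _; exists (c - 1); rewrite ?ltNyr//; lra.
suff : ple s F c' by move=> /packing_pre_le; rewrite -(fineK Fin) lee_fin leNgt c'c.
have [A [p [FA hA /ltW hp]]] := packing_le_cover lt'.
apply: ple_lim => e e0.
(* Each piece of a countable cover is fattened to a relatively open set at the cost $e/2^{k+1}$;
   finitely many then cover [F], and the premeasure is finitely subadditive. *)
have /choice[eta heta] : forall k, exists eta, 0 < eta /\
    ple s (F `&` enbhd (A k `&` F) eta) (p k + e / 2 ^+ k.+1).
  move=> k; have [||||eta eta0 h] := @ple_enbhd s F (A k `&` F) C (p k) (e / 2 ^+ k.+1) s0.
  - by move=> x [].
  - by [].
  - by apply: pleS (hA k) => // x [].
  - by rewrite divr_gt0// exprn_gt0.
  - by exists eta.
pose U k := \bigcup_(j in [set j | (j <= k)%N]) enbhd (A j `&` F) (eta j).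
have [|||k hk] := cF U.
- by move=> k; apply: eopen_bigcup => j _; apply: eopen_enbhd.
- by move=> k x [j /= jk jx]; exists j => //=; apply: leq_trans jk _.
- move=> x Fx; have [k _ Akx] := FA x Fx; exists k => //; exists k => //=.
  by apply: subset_enbhd; [case: (heta k)|split].
have p0 j : 0 <= p j by apply: ple_ge0 (hA j).
apply: pleS (ple_bigU (l := iota 0 k.+1) (fun j _ => (heta j).2)).
  move=> x Fx; have [j /= jk jx] := hk x Fx; exists j => //.
  by suff : j \in iota 0 k.+1 by []; rewrite mem_iota add0n ltnS.
have geo := geometric_sum_le k.+1 (ltW e0).
have : \sum_(j <- iota 0 k.+1) p j <= c'.
  rewrite -lee_fin; apply: le_trans hp; apply: sum_le_esum => //.
  exact: iota_uniq.
by move: geo; rewrite big_split; move: (iota 0 k.+1) => r h1 h2; rewrite /= lerD.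
Qed.

End Neighborhood.

(** * Hausdorff measure *)

Section HausdorffContent.
Context {R : realType} {n : nat}.
Notation point := 'rV[R]_n.
Implicit Types (x y z : point) (A B E F K V : set point) (s c d e : R).
Implicit Types (l : seq (set point * R)).

Definition diam_le (a : set point * R) := forall x y, a.1 x -> a.1 y -> edist x y <= a.2.

(** A covering set carries a positive upper bound [a.2] for its diameter instead of the diameter
    itself, which leaves room to enlarge the set and keeps all bases of powers positive. *)
Definition fcover E d l :=
  (forall x, E x -> exists2 a, a \in l & a.1 x) /\
  forall a, a \in l -> diam_le a /\ 0 < a.2 < d.

Definition cmass s l := \sum_(a <- l) a.2 `^ s.

(* Strict inequalities make [hcov] stable under small enlargements of the
   covering sets. *)
Definition hcov s d E c := exists2 l, fcover E d l & cmass s l < c.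

(** Only finite covers are allowed. This always implies the bound on [hausdorff] for $s \ge 0$, and
    is equivalent to it on compact sets. *)
Definition hle s E c := forall d c', 0 < d -> c < c' -> hcov s d E c'.

Lemma cmass_cat s l l' : cmass s (l ++ l') = cmass s l + cmass s l'.
Proof. exact: big_cat. Qed.

Lemma cmass_ge0 s l : 0 <= cmass s l.
Proof. by apply: sumr_ge0 => a _; exact: powR_ge0. Qed.

Lemma fcoverS E F d d' l : E `<=` F -> d <= d' -> fcover F d l -> fcover E d' l.
Proof.
move=> EF dd [cl hl]; split=> [x /EF/cl//|a /hl[h /andP[-> ad]]].
by split=> //; apply: lt_le_trans dd.
Qed.

Lemma hcovS s E F d d' c c' : E `<=` F -> d <= d' -> c <= c' ->
  hcov s d F c -> hcov s d' E c'.
Proof.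
move=> EF dd cc [l hl lc]; exists l; first exact: fcoverS hl.
exact: lt_le_trans cc.
Qed.

Lemma hleS s E F c c' : E `<=` F -> c <= c' -> hle s F c -> hle s E c'.
Proof.
by move=> EF cc' h d c2 d0 lt; apply: (hcovS EF (lexx d) (lexx c2)); apply: h => //; lra.
Qed.

Lemma hle_lim s E c : (forall e, 0 < e -> hle s E (c + e)) -> hle s E c.
Proof.
by move=> h d c' d0 cc'; apply: (h ((c' - c) / 2)) => //; lra.
Qed.

Lemma hle_ge0 s E c : hle s E c -> 0 <= c.
Proof.
move=> h; rewrite leNgt; apply/negP => c0.
have [||l _ lt] := h 1 (c / 2); [by []|lra|].
by have := cmass_ge0 s l; lra.
Qed.

Lemma hcovU s d E F c c' : hcov s d E c -> hcov s d F c' -> hcov s d (E `|` F) (c + c').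
Proof.
move=> [l [cl hl] lc] [l' [cl' hl'] lc']; exists (l ++ l'); last by rewrite cmass_cat; lra.
split; last by move=> a; rewrite mem_cat => /orP[/hl|/hl'].
by move=> x [/cl|/cl'] [a al ax]; exists a; rewrite // mem_cat al ?orbT.
Qed.

Lemma hleU s E F c c' : hle s E c -> hle s F c' -> hle s (E `|` F) (c + c').
Proof.
move=> hE hF d c2 d0 lt; rewrite (_ : c2 = (c + (c2 - (c + c')) / 2) + (c' + (c2 - (c + c')) / 2)); last lra.
by apply: hcovU; [apply: hE|apply: hF] => //; lra.
Qed.

Lemma hle_set0 s : hle s (set0 : set point) 0.
Proof. by move=> d c d0 c0; exists [::]; rewrite ?/cmass ?big_nil. Qed.

Lemma hle_bigU s (T : eqType) (l : seq T) (E : T -> set point) (c : T -> R) :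
  (forall t, t \in l -> hle s (E t) (c t)) ->
  hle s (\bigcup_(t in [set` l]) E t) (\sum_(t <- l) c t).
Proof.
elim: l => [_|t l IH h].
  by rewrite big_nil; apply: hleS (hle_set0 s) => // x [].
rewrite big_cons; apply: (@hleS _ _ (E t `|` \bigcup_(t in [set` l]) E t) _ _ _ (lexx _)).
  by move=> x [t']; rewrite /= inE => /predU1P[->|t'l]; [left|right; exists t'].
apply: hleU; first by apply: h; rewrite inE eqxx.
by apply: IH => t' t'l; apply: h; rewrite inE t'l orbT.
Qed.

Lemma fcover_open s E d c l : 0 <= s -> fcover E d l -> cmass s l < c ->
  exists l', [/\ fcover E d l', cmass s l' < c & forall a, a \in l' -> eopen a.1].
Proof.
move=> s0; elim: l E c => [|a l IH] E c [cl hl] lc.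
  by exists [::]; split.
have [da /andP[a0 ad]] := hl a (mem_head _ _).
pose E' := [set x | exists2 b, b \in l & b.1 x].
have lc' : cmass s l < c - a.2 `^ s by move: lc; rewrite /cmass big_cons; lra.
have [|l' [[cl' hl'] lm' ol']] := IH E' _ _ lc'.
  by split=> // b bl; apply: hl; rewrite inE bl orbT.
have [|b ab hb] := @powR_right_cont R a.2 s ((c - a.2 `^ s - cmass s l') / 2) (ltW a0) s0.
  by lra.
(* [b] protects the mass bound and the midpoint the scale [d]; the gain $b' - a_2$ pays for a
   neighbourhood of half that radius. *)
pose b' := Num.min b ((a.2 + d) / 2).
have b'a : a.2 < b' by rewrite lt_min ab; lra.
have b'0 : 0 < b' by lra.
have b'm : b' `^ s <= b `^ s.
  by apply: ge0_ler_powR => //; rewrite ?nnegrE ?ge_min ?lexx//; lra.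
have b'd : b' < d by apply: (@le_lt_trans _ _ ((a.2 + d) / 2)); [rewrite ge_min lexx orbT|lra].
exists ((enbhd a.1 ((b' - a.2) / 2), b') :: l'); split.
- split.
    move=> x /cl[b2]; rewrite inE => /predU1P[->|bl] bx.
      exists (enbhd a.1 ((b' - a.2) / 2), b'); first exact: mem_head.
      by apply: subset_enbhd bx; lra.
    by have [|b3 b3l b3x] := cl' x; [exists b2|exists b3; rewrite // inE b3l orbT].
  move=> b2; rewrite inE => /predU1P[->|/hl'//]; split; last by rewrite /= b'0.
  move=> x y [x' ax' xx'] [y' ay' yy'] /=; have := da _ _ ax' ay'.
  have := edist_triangle x' x y; have := edist_triangle y' x' y.
  rewrite (edistC x x'); lra.
- by rewrite /cmass big_cons /= -/(cmass s l'); lra.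
- by move=> b2; rewrite inE => /predU1P[->|/ol'//]; exact: eopen_enbhd.
Qed.

Lemma hcov_nbhd s E d c : 0 <= s -> hcov s d E c ->
  exists V, [/\ eopen V, E `<=` V & hcov s d V c].
Proof.
move=> s0 [l hl lc]; have [l' [[cl' hl'] lc' ol']] := fcover_open s0 hl lc.
exists [set x | exists2 a, a \in l' & a.1 x]; split.
- move=> x [a al ax]; have [e e0 he] := ol' a al x ax.
  by exists e => // y /he; exists a.
- by move=> x /cl'.
- by exists l'.
Qed.

Lemma hle_exponent s t E c : 0 <= s -> s < t -> hle s E c -> hle t E 0.
Proof.
move=> s0 st h d e d0 e0; have c0 := hle_ge0 h.
have [||b b0 hb] := @powR_small R (t - s) (e / (c + 1)); first by rewrite subr_gt0.
  by rewrite divr_gt0 ?ltr_wpDl.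
have [||l [cl hl] lc] := h (Num.min d b) (c + 1); [by rewrite lt_min d0|by rewrite ltrDl|].
exists l.
  by split=> // a /hl[da]; rewrite lt_min => /and3P[-> -> _].
apply: (@le_lt_trans _ _ (\sum_(a <- l) (e / (c + 1)) * a.2 `^ s)).
  rewrite /cmass !big_seq; apply: ler_sum => a /hl[_].
  rewrite lt_min => /and3P[a0 _ ab].
  rewrite -{1}(subrK s t) powRD; last by rewrite subrK gt_eqF ?(le_lt_trans s0 st).
  rewrite ler_wpM2r ?powR_ge0//.
  apply: le_trans hb; apply: ge0_ler_powR; rewrite ?nnegrE ?subr_ge0 ?(ltW st) ?(ltW b0) ?(ltW a0)//.
  exact: ltW.
rewrite -mulr_sumr -/(cmass s l).
apply: (@lt_le_trans _ _ (e / (c + 1) * (c + 1))); last by rewrite mulfVK ?gt_eqF ?ltr_wpDl.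
by rewrite ltr_pM2l// divr_gt0// ltr_wpDl.
Qed.

Lemma hcov_image K (f : point -> point) (rho : R) s d E c : 0 < rho ->
  similarity_on K f rho -> E `<=` K -> hcov s d E c ->
  hcov s (rho * d) (f @` E) (rho `^ s * c).
Proof.
move=> rho0 fs EK [l [cl hl] lc].
exists [seq (f @` (a.1 `&` E), rho * a.2) | a <- l].
  split=> [_ [x Ex <-]|_ /mapP[a /hl[da /andP[a0 ad]] ->]].
    have [a al ax] := cl x Ex; exists (f @` (a.1 `&` E), rho * a.2).
      by apply/mapP; exists a.
    by exists x.
  split=> [_ _ [x [ax Ex] <-] [y [ay Ey] <-] /=|].
    by rewrite fs ?ler_pM2l//; [exact: da|exact: EK|exact: EK].
  by rewrite /= mulr_gt0// ltr_pM2l.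
rewrite /cmass big_map /= big_seq.
rewrite (eq_bigr (fun a => rho `^ s * a.2 `^ s)) => [|a /hl[_ /andP[a0 _]]].
  by rewrite -mulr_sumr -big_seq ltr_pM2l// powR_gt0.
by rewrite powRM// ltW.
Qed.

Lemma hle_image K (f : point -> point) (rho : R) s E c : 0 < rho ->
  similarity_on K f rho -> E `<=` K -> hle s E c -> hle s (f @` E) (rho `^ s * c).
Proof.
move=> rho0 fs EK h d c' d0 lt; have r0 : 0 < rho `^ s by rewrite powR_gt0.
have -> : d = rho * (d / rho) by rewrite mulrCA mulfV ?gt_eqF// mulr1.
have -> : c' = rho `^ s * (c' / rho `^ s) by rewrite mulrCA mulfV ?gt_eqF// mulr1.
apply: (hcov_image rho0 fs EK); apply: h; first by rewrite divr_gt0.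
by rewrite ltr_pdivlMr// mulrC.
Qed.

Lemma fcover_preimage K (f : point -> point) (rho : R) d E l : 0 < rho ->
  similarity_on K f rho -> E `<=` K -> fcover (f @` E) (rho * d) l ->
  fcover E d [seq (E `&` f @^-1` a.1, rho^-1 * a.2) | a <- l].
Proof.
move=> rho0 fs EK [cl hl]; split=> [x Ex|_ /mapP[a /hl[da /andP[a0 ad]] ->]].
  have [|a al ax] := cl (f x); first by exists x.
  by exists (E `&` f @^-1` a.1, rho^-1 * a.2); [apply/mapP; exists a|].
split=> [x y [Ex ax] [Ey ay] /=|].
  have := da _ _ ax ay; rewrite fs; [|exact: EK|exact: EK].
  by rewrite ler_pdivlMl.
by rewrite /= mulr_gt0 ?invr_gt0//= ltr_pdivrMl.
Qed.

Lemma cmass_scale s (rho : R) (g : set point * R -> set point) E d l : 0 <= rho ->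
  fcover E d l -> cmass s [seq (g a, rho * a.2) | a <- l] = rho `^ s * cmass s l.
Proof.
move=> rho0 [_ hl]; rewrite /cmass big_map mulr_sumr !big_seq.
by apply: eq_bigr => a /hl[_ /andP[a0 _]] /=; rewrite powRM// ltW.
Qed.

Lemma powRV (rho s : R) : 0 <= rho -> rho^-1 `^ s = (rho `^ s)^-1.
Proof. by move=> rho0; rewrite -powR_inv1// -powRrM mulN1r powRN. Qed.

Lemma hausdorff_hle s E c : 0 <= s -> hle s E c -> (hausdorff s E <= c%:E)%E.
Proof.
move=> s0 h; apply/ereal_supP => _ [d /= d0 <-].
apply/lee_addgt0Pr => e e0; rewrite -EFinD.
have [|l [cl hl] lc] := h d (c + e) d0; first by rewrite ltrDl.
pose a0 : set point * R := (set0, 0).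
(* [hausdorff_delta] admits nonempty sets only, so the indices of empty ones are dropped. *)
pose J := [set k | (k < size l)%N /\ (nth a0 l k).1 !=set0].
apply: ge_ereal_inf; exists (\esum_(k in J) ((fine (diam (nth a0 l k).1)) `^ s)%:E).
  exists (J, fun k => (nth a0 l k).1) => //=; split.
    move=> x /cl[a al ax]; exists (index a l); last by rewrite nth_index.
    by split; [rewrite index_mem|exists x; rewrite nth_index].
  move=> k [kl kne]; split=> //; have [da /andP[_ /ltW ad]] := hl _ (mem_nth a0 kl).
  apply/ereal_supP => _ [[x y] [/= kx ky] <-]; rewrite lee_fin.
  by apply: le_trans ad; exact: da.
apply: (@esum_le _ _ J (fun k => fine (diam (nth a0 l k).1) `^ s)) => r ur rJ.
apply: le_trans (ltW lc).
apply: (@le_trans _ _ (\sum_(k <- r) (nth a0 l k).2 `^ s)).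
  rewrite !big_seq; apply: ler_sum => k /rJ[kl [x kx]].
  have [da /andP[ap _]] := hl _ (mem_nth a0 kl).
  have d1 : (diam (nth a0 l k).1 <= ((nth a0 l k).2)%:E)%E.
    by apply/ereal_supP => _ [[y z] [/= ky kz] <-]; rewrite lee_fin; exact: da.
  have d2 : (0 <= diam (nth a0 l k).1)%E.
    by apply: le_ereal_sup_tmp; exists 0%E => //; exists (x, x); rewrite //= edistxx.
  apply: ge0_ler_powR => //; rewrite ?nnegrE ?fine_ge0 ?(ltW ap)//.
  by rewrite -lee_fin fineK// ge0_fin_numE//; apply: le_lt_trans d1 (ltry _).
rewrite /cmass (big_nth a0) big_mkord -(big_mkord xpredT (fun k => (nth a0 l k).2 `^ s)).
rewrite [leRHS](bigID (fun k => k \in r)) /= ler_wpDr ?sumr_ge0//.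
  by move=> k _; exact: powR_ge0.
rewrite -[leRHS]big_filter le_eqVlt; apply/orP; left; apply/eqP/perm_big/uniq_perm => //.
  by rewrite filter_uniq// iota_uniq.
move=> k; rewrite mem_filter mem_index_iota /=.
by case: (boolP (k \in r)) => //= /rJ[-> _].
Qed.

(** The sets of a countable cover are fattened to open ones at the cost $e/2^{k+1}$ each, and
    compactness leaves finitely many. Starting from scale $d/2$ gives room below [d]. *)
Lemma hle_hausdorff s F c : 0 <= s -> ecompact F -> (hausdorff s F <= c%:E)%E -> hle s F c.
Proof.
move=> s0 cF hF d c' d0 cc'.
have : (hausdorff_delta s (d / 2) F < ((c + c') / 2)%:E)%E.
  apply: (@le_lt_trans _ _ c%:E); last by rewrite lte_fin; lra.
  by apply: le_trans hF; apply: ereal_sup_ubound; exists (d / 2) => //=; rewrite divr_gt0.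
move=> /ereal_inf_lt[_ [[J U] /= [FU hU] <-] lt].
pose e := (c' - c) / 2; have e0 : 0 < e by rewrite /e; lra.
pose dk k : R := fine (diam (U k)).
have dk0 k : J k -> 0 <= dk k.
  move=> /hU[[x Ux] _]; apply: fine_ge0.
  by apply: le_ereal_sup_tmp; exists 0%E => //; exists (x, x); rewrite //= edistxx.
have dkE k : J k -> (diam (U k) = (dk k)%:E)%E.
  move=> Jk; have [[x Ux] dU] := hU k Jk; rewrite /dk fineK// ge0_fin_numE.
    exact: le_lt_trans dU (ltry _).
  by apply: le_ereal_sup_tmp; exists 0%E => //; exists (x, x); rewrite //= edistxx.
have dkd k : J k -> dk k <= d / 2.
  by move=> Jk; have [_] := hU k Jk; rewrite dkE// lee_fin.
have /choice[b hb] : forall k, exists b, J k ->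
    dk k < b < d /\ b `^ s <= dk k `^ s + e / 2 ^+ k.+1.
  move=> k; case: (pselect (J k)) => [Jk|nJ]; last by exists 0.
  have [|b bk hb] := @powR_right_cont R (dk k) s (e / 2 ^+ k.+1) (dk0 k Jk) s0.
    by rewrite divr_gt0// exprn_gt0.
  have := dkd k Jk => dk2; pose b' := Num.min b ((dk k + d) / 2).
  have b1 : dk k < b' by rewrite lt_min bk; lra.
  have b2 : b' < d by rewrite gt_min; apply/orP; right; lra.
  exists b' => _; split; first by rewrite b1.
  have := dk0 k Jk => dk0k.
  apply: le_trans hb; apply: ge0_ler_powR => //; rewrite ?nnegrE ?ge_min ?lexx//; lra.
pose V k := \bigcup_(j in [set j | (j <= k)%N /\ J j]) enbhd (U j) ((b j - dk j) / 2).
have [|||k hk] := cF V.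
- by move=> k; apply: eopen_bigcup => j _; apply: eopen_enbhd.
- by move=> k x [j /= [jk Jj] jx]; exists j => //=; split=> //; apply: leq_trans jk _.
- move=> x /FU[k Jk Ukx]; exists k => //; exists k => //=.
  by apply: subset_enbhd Ukx; have [/andP[]] := hb k Jk; lra.
pose r := [seq j <- iota 0 k.+1 | `[< J j >]].
have rJ j : j \in r -> J j by rewrite mem_filter => /andP[/asboolP].
exists [seq (enbhd (U j) ((b j - dk j) / 2), b j) | j <- r].
  split=> [x /hk[j [jk Jj] jx]|_ /mapP[j /rJ Jj ->]].
    exists (enbhd (U j) ((b j - dk j) / 2), b j) => //; apply/mapP; exists j => //.
    rewrite /r mem_filter mem_iota add0n ltnS jk leq0n !andbT; exact/asboolP.
  have [/andP[b1 b2] _] := hb j Jj; have := dk0 j Jj => dk0j; split=> /=.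
    move=> x y /= [x' Ux' xx'] [y' Uy' yy'].
    have : edist x' y' <= dk j.
      by rewrite -lee_fin -dkE//; apply: ereal_sup_ubound; exists (x', y').
    have := edist_triangle x' x y; have := edist_triangle y' x' y.
    rewrite (edistC x x'); lra.
  by rewrite b2 andbT; lra.
rewrite /cmass big_map /=.
apply: (@le_lt_trans _ _ (\sum_(j <- r) dk j `^ s + \sum_(j <- r) e / 2 ^+ j.+1)).
  by rewrite -big_split !big_seq; apply: ler_sum => j /rJ /hb[].
have h1 : \sum_(j <- r) dk j `^ s < (c + c') / 2.
  rewrite -lte_fin; apply: le_lt_trans lt.
  apply: (@sum_le_esum _ _ J (fun j => dk j `^ s)) => //.
    by rewrite filter_uniq// iota_uniq.
  by move=> j; exact: powR_ge0.
have h2 : \sum_(j <- r) e / 2 ^+ j.+1 <= e.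
  apply: le_trans (geometric_sum_le k.+1 (ltW e0)).
  rewrite big_filter big_mkcond /=; apply: ler_sum => j _.
  by case: ifP => // _; rewrite divr_ge0 ?exprn_ge0// ltW.
by rewrite /e in h2; lra.
Qed.

End HausdorffContent.

(** * Hausdorff measure is at most packing measure *)

Section HausdorffPacking.
Context {R : realType} {n : nat}.
Notation point := 'rV[R]_n.
Implicit Types (x y z : point) (A B E F G K V : set point) (s c d e : R).

Lemma sum_const_seq (T : Type) (t : seq T) (c : R) : \sum_(x <- t) c = (size t)%:R * c.
Proof.
by elim: t => [|x t IH]; rewrite ?big_nil ?mul0r// big_cons IH -natr1 mulrDl mul1r addrC.
Qed.

Lemma maximal_net (G : set point) (rho : R) (M : nat) :
  (forall t : seq point, (forall x, x \in t -> G x) ->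
     pairwise (fun x y => rho < edist x y) t -> (size t <= M)%N) ->
  exists t : seq point, [/\ forall x, x \in t -> G x,
    pairwise (fun x y => rho < edist x y) t &
    forall x, G x -> exists2 y, y \in t & edist x y <= rho].
Proof.
move=> bnd; pose P k := `[< exists t : seq point, [/\ size t = k,
  forall x, x \in t -> G x & pairwise (fun x y => rho < edist x y) t] >].
have exP : exists k, P k by exists 0%N; apply/asboolP; exists [::].
have leP k : P k -> (k <= M)%N by move=> /asboolP[t [<- tG tp]]; exact: bnd.
case: (ex_maxnP exP leP) => k /asboolP[t [tk tG tp]] kmax.
exists t; split=> // x Gx; apply: contrapT => nx.
suff /kmax : P k.+1 by rewrite ltnn.
apply/asboolP; exists (x :: t); split; first by rewrite /= tk.
  by move=> y; rewrite inE => /predU1P[->|/tG].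
rewrite /= tp andbT; apply/allP => y yt; rewrite ltNge; apply/negP => le.
by apply: nx; exists y.
Qed.

Lemma fpack_near_max s E d C e : 0 < e -> (forall l, fpack E d l -> pmass s l <= C) ->
  exists2 l, fpack E d l & forall l', fpack E d l' -> pmass s l' <= pmass s l + e.
Proof.
move=> e0 hC; pose X := [set pmass s l | l in fpack E d].
have supX : has_sup X.
  split; first by exists (pmass s ([::] : seq (point * R))); exists [::].
  by exists C => _ [l hl <-]; exact: hC.
have [_ [l hl <-] lt] := sup_adherent e0 supX.
exists l => // l' hl'; have : pmass s l' <= sup X.
  by apply: ub_le_sup; [exact: supX.2|exists l'].
lra.
Qed.

(* A nearly maximal packing leaves a remainder carrying little packing mass;
   its balls, slightly enlarged, and the balls of a net of the remainder cover. *)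
Lemma ple_hle s E p : 0 <= s -> ple s E p -> hle s E p.
Proof.
move=> s0 hp d c' d0 pc; have p0 := ple_ge0 hp.
have two1 : 1 <= 2 `^ s :> R by have := @ler_powR R 2 _ 0 s s0; rewrite powRr0; apply; lra.
(* The enlarged balls will cost at most $p + e + g$ and the net at most $g$; since $e \le g$, the
   sum stays below $p + 4g = c'$. *)
pose g := (c' - p) / 4; have g0 : 0 < g by rewrite /g; lra.
(* The sets around net points are twice as wide as the balls packed at these points, whence
   $2^s$. *)
pose e := g / 2 `^ s; have e0 : 0 < e by rewrite divr_gt0//; lra.
have eg : e <= g by rewrite ler_pdivrMr; nra.
have e2 : 2 `^ s * e = g by rewrite mulrC divfK// gt_eqF//; lra.
have [|b' b'1 hb'] := @powR_right_cont R 1 s (g / (p + e)) ler01 s0.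
  by rewrite divr_gt0//; lra.
pose b := Num.min b' 2; have b1 : 1 < b by rewrite lt_min b'1; lra.
have b2 : b <= 2 by rewrite ge_min lexx orbT.
have hb : b `^ s * (p + e) <= p + e + g.
  have -> : p + e + g = (1 `^ s + g / (p + e)) * (p + e).
    by rewrite powR1 mulrDl mul1r mulfVK// gt_eqF//; lra.
  rewrite ler_wpM2r//; first by lra.
  apply: le_trans hb'; apply: ge0_ler_powR => //; rewrite ?nnegrE ?ge_min ?lexx//; lra.
have [|d1 d10 hd1] := hp (p + e); first by lra.
pose dl := Num.min d1 (d / 8); have dl0 : 0 < dl by rewrite lt_min d10; lra.
have dl8 : dl <= d / 8 by rewrite ge_min lexx orbT.
have hdl l : fpack E dl l -> pmass s l <= p + e.
  by move=> hl; apply: hd1; apply: fpackS hl => //; rewrite ge_min lexx.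
have [l hl lmax] := fpack_near_max e0 hdl.
have [|eta eta0 heta] := @finite_lower_bound R _ l (fun a => (b - 1) * a.2).
  by move=> a /hl.2[_ /andP[a0 _]]; rewrite mulr_gt0//; lra.
pose G := [set x | E x /\ forall a, a \in l -> b * a.2 <= edist a.1 x].
(* [rho] is less than every gap $(b-1) a_2$, so balls of radius at most [rho] centred in [G] can be
   added to the packing [l]; near-maximality of [l] bounds their mass by [e]. *)
pose rho := Num.min dl (eta / 2); have rho0 : 0 < rho by rewrite lt_min dl0; lra.
have rhodl : rho <= dl by rewrite ge_min lexx.
have rhoeta : rho <= eta / 2 by rewrite ge_min lexx orbT.
have hG l' : fpack G rho l' -> pmass s l' <= e.
  move=> hl'; suff /lmax : fpack E dl (l ++ l') by rewrite pmass_cat; lra.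
  apply: (@fpackS _ _ (E `|` G) _ dl dl) => //; first by move=> x [|[]].
  apply: fpack_cat => //; last by apply: fpackS hl'.
  move=> a a' al /hl'.2[[_ /(_ a al) h] /andP[_ ar]]; have := heta a al.
  rewrite /separated; lra.
have netm (t : seq point) : (forall x, x \in t -> G x) ->
    pairwise (fun x y => 2 * rho < edist x y) t -> (size t)%:R * (2 * rho) `^ s <= e.
  move=> tG tp; have : fpack G rho [seq (x, rho) | x <- t].
    split; last by move=> _ /mapP[x /tG Gx ->]; rewrite /= rho0 lexx.
    rewrite pairwise_map; apply: sub_pairwise tp => x y; rewrite /separated /=; lra.
  move=> /hG; rewrite /pmass big_map /=.
  by rewrite sum_const_seq.
pose M := Num.bound (e / (2 * rho) `^ s).
have pr0 : 0 < (2 * rho) `^ s by rewrite powR_gt0//; lra.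
have [t tG tp|t [tG tp tcov]] := @maximal_net G (2 * rho) M.
  have := netm t tG tp; rewrite -ler_pdivlMr// => h.
  have h2 : e / (2 * rho) `^ s < M%:R by apply: archi_boundP; rewrite divr_ge0// ltW.
  by rewrite -(ler_nat R); apply: le_trans h (ltW h2).
pose l1 : seq (set point * R) := [seq ([set y | edist a.1 y < b * a.2], 2 * b * a.2) | a <- l].
pose l2 : seq (set point * R) := [seq ([set y | edist x y <= 2 * rho], 4 * rho) | x <- t].
exists (l1 ++ l2).
  split.
    move=> x Ex; case: (pselect (exists2 a, a \in l & edist a.1 x < b * a.2)).
      move=> [a al ax]; exists ([set y | edist a.1 y < b * a.2], 2 * b * a.2) => //.
      by rewrite mem_cat; apply/orP; left; apply/mapP; exists a.
    move=> nx; have [|y yt yx] := tcov x.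
      split=> // a al; rewrite leNgt; apply/negP => lt; apply: nx; by exists a.
    exists ([set z | edist y z <= 2 * rho], 4 * rho); last by rewrite /= edistC.
    by rewrite mem_cat; apply/orP; right; apply/mapP; exists y.
  move=> a; rewrite mem_cat => /orP[/mapP[q ql ->]|/mapP[q ql ->]] /=.
    have [_ /andP[q0 qd]] := hl.2 q ql; split=> /=.
      move=> x y /= xq yq; have := edist_triangle q.1 x y; rewrite (edistC x q.1); lra.
    by apply/andP; split; nra.
  split; last by apply/andP; split; lra.
  move=> x y /= xq yq; have := edist_triangle q x y; rewrite (edistC x q); lra.
rewrite cmass_cat.
have -> : cmass s l1 = b `^ s * pmass s l.
  rewrite /cmass big_map mulr_sumr !big_seq; apply: eq_bigr => a /hl.2[_ /andP[a0 _]] /=.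
  by rewrite (mulrC 2 b) -mulrA (@powRM _ b) ?mulr_ge0 ?(ltW a0)//; lra.
have -> : cmass s l2 = 2 `^ s * ((size t)%:R * (2 * rho) `^ s).
  rewrite /cmass big_map /= sum_const_seq.
  have -> : 4 * rho = 2 * (2 * rho) by lra.
  by rewrite (@powRM _ 2)// 1?mulrCA//; lra.
have h1 := netm t tG tp.
have h2 : 2 `^ s * ((size t)%:R * (2 * rho) `^ s) <= g by rewrite -e2 ler_pM2l//; lra.
have h3 : b `^ s * pmass s l <= b `^ s * (p + e) by rewrite ler_wpM2l ?powR_ge0// hdl.
by rewrite /g in h2 hb g0 eg *; lra.
Qed.

(** [ple_hle] bounds each piece of a countable cover, the resulting covers may be taken open, and
    compactness leaves finitely many pieces. This turns overlaps that are null for packing measure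
    into null sets for Hausdorff measure. *)
Lemma hle_packing s F c : 0 <= s -> ecompact F -> (packing s F <= c%:E)%E -> hle s F c.
Proof.
move=> s0 cF hF; apply: hle_lim => e0 e00 d c' d0 lt.
have [A [p [FA hA hp]]] : exists (A : nat -> set point) (p : nat -> R),
    [/\ F `<=` \bigcup_k A k, forall k, ple s (A k) (p k) &
      (\esum_(k in [set: nat]) (p k)%:E < (c + e0)%:E)%E].
  by apply: packing_le_cover; apply: le_lt_trans hF _; rewrite lte_fin ltrDl.
pose e := c' - (c + e0); have e1 : 0 < e by rewrite subr_gt0.
have /choice[V hV] : forall k, exists V,
    [/\ eopen V, A k `<=` V & hcov s d V (p k + e / 2 ^+ k.+1)].
  move=> k; apply: hcov_nbhd => //; apply: (ple_hle s0 (hA k)) => //.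
  by rewrite ltrDl divr_gt0// exprn_gt0.
pose U k := \bigcup_(j in [set j | (j <= k)%N]) V j.
have [|||k hk] := cF U.
- by move=> k; apply: eopen_bigcup => j _; case: (hV j).
- by move=> k x [j /= jk jx]; exists j => //=; apply: leq_trans jk _.
- move=> x Fx; have [k _ Akx] := FA x Fx; exists k => //; exists k => //=.
  by case: (hV k) => _ + _; apply.
have p0 j : 0 <= p j by apply: ple_ge0 (hA j).
have sp : \sum_(j <- iota 0 k.+1) p j < c + e0.
  rewrite -lte_fin; apply: le_lt_trans hp; apply: sum_le_esum => //; exact: iota_uniq.
have se := geometric_sum_le k.+1 (ltW e1).
have kU q : exists2 l, fcover (\bigcup_(j in [set j | (j < q)%N]) V j) d l &
    cmass s l <= \sum_(j <- iota 0 q) (p j + e / 2 ^+ j.+1).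
  elim: q => [|q [l hl lc]].
    by exists [::]; [split=> // x []|rewrite /cmass !big_nil].
  have [_ _ [l' hl' lc']] := hV q.
  exists (l ++ l').
    split; last by move=> a; rewrite mem_cat => /orP[/hl.2|/hl'.2].
    move=> x [j /=]; rewrite ltnS leq_eqVlt => /predU1P[->|jq] jx.
      by have [a al ax] := hl'.1 x jx; exists a; rewrite // mem_cat al orbT.
    have [|a al ax] := hl.1 x; first by exists j.
    by exists a; rewrite // mem_cat al.
  rewrite cmass_cat -[q.+1]addn1 iotaD big_cat/= big_seq1 add0n.
  by apply: lerD => //; exact: ltW.
have [l hl lc] := kU k.+1; exists l.
  by apply: fcoverS hl => // x /hk[j jk jx]; exists j.
apply: le_lt_trans lc _; rewrite big_split; move: sp se.
by move: (iota 0 k.+1) => r; rewrite /= /e; lra.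
Qed.

End HausdorffPacking.

(** * Lower additivity over pieces with null overlaps *)

Section Additivity.
Context {R : realType} {n : nat}.
Notation point := 'rV[R]_n.
Implicit Types (x y z : point) (B E F G K V : set point) (s c d e : R).

Lemma finite_disjoint_dist (T : finType) (B : T -> set point) :
  (forall t, ecompact (B t)) -> (forall t t', t <> t' -> B t `&` B t' = set0) ->
  exists2 z : R, 0 < z & forall t t' x y, t <> t' -> B t x -> B t' y -> z < edist x y.
Proof.
move=> cB disj.
have /choice[z hz] : forall tt : T * T, exists z : R, 0 < z /\
    (tt.1 <> tt.2 -> forall x y, B tt.1 x -> B tt.2 y -> z < edist x y).
  move=> [t t']; case: (pselect (t = t')) => [->|tt']; first by exists 1; split.
  by have [z z0 h] := ecompact_dist (cB t) (cB t') (disj _ _ tt'); exists z.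
have [|z' z'0 hz'] := @finite_lower_bound R _ (enum {: T * T}) z.
  by move=> tt _; case: (hz tt).
exists z' => // t t' x y tt' Bx By; apply: le_lt_trans (hz' (t, t') _) _.
  by rewrite mem_enum.
exact: (hz (t, t')).2.
Qed.

(** The overlaps have premeasure zero by [packing_compact], hence by [ple_enbhd] neighbourhoods of
    small premeasure in [F]. Removing these leaves disjoint compact sets at positive distance, and
    fine packings of such sets can be put together. *)
Lemma pge_additive s (T : finType) (A : T -> set point) (a : T -> R) F C : 0 <= s ->
  (forall t, ecompact (A t)) -> (forall t, A t `<=` F) -> ple s F C ->
  (forall t t', t <> t' -> packing s (A t `&` A t') = 0%E) ->
  (forall t, pge s (A t) (a t)) -> pge s F (\sum_t a t).
Proof.
move=> s0 cA AF hF null hA c' d lt d0.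
(* Each of the $|T|$ pieces loses at most $|T| e$; the extra [1] makes the estimates strict and
   allows [T] to be empty. *)
pose N : R := #|T|%:R + 1.
have N1 : 1 <= N by rewrite /N lerDr.
pose e := (\sum_t a t - c') / (N * N).
have e0 : 0 < e by rewrite divr_gt0 ?subr_gt0// mulr_gt0//; lra.
have eN : N * N * e = \sum_t a t - c'.
  by rewrite mulrC divfK// gt_eqF// mulr_gt0//; lra.
have /choice[V hV] : forall tt : T * T, exists V, tt.1 <> tt.2 ->
    [/\ eopen V, A tt.1 `&` A tt.2 `<=` V & ple s (F `&` V) e].
  move=> [t t']; case: (pselect (t = t')) => [->|tt']; first by exists set0.
  have I0 : ple s (A t `&` A t') 0.
    apply/packing_pre_le; rewrite -(@packing_compact _ _ s _ C) ?null//.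
      exact: ecompactI.
    by apply: pleS hF => // x [/AF].
  have [|eta eta0 heta] := @ple_enbhd _ _ s F _ C 0 e s0 _ hF I0 e0; first by move=> x [/AF].
  exists (enbhd (A t `&` A t') eta) => _; split; first exact: eopen_enbhd.
    exact: subset_enbhd.
  by rewrite add0r in heta.
pose U t := \bigcup_(t' in [set t' | t <> t']) V (t, t').
have hU t : ple s (F `&` U t) (\sum_(t' <- enum T) e).
  have /ple_bigU : forall t', t' \in enum T ->
      ple s (F `&` (if t == t' then set0 else V (t, t'))) e.
    move=> t' _; case: eqP => [_|tt']; last by have [] := hV (t, t') tt'.
    by rewrite setI0; apply: pleS (ple_set0 s) => //; exact: ltW.
  apply: pleS => // x [Fx [t' tt' Vx]]; exists t'; rewrite /= ?mem_enum//.
  by split=> //; case: eqP.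
pose B t := A t `\` U t.
have cB t : ecompact (B t).
  by apply: ecompact_diff => //; apply: eopen_bigcup => t' tt'; have [] := hV (t, t') tt'.
have disjB t t' : t <> t' -> B t `&` B t' = set0.
  move=> tt'; apply/seteqP; split=> // x [[Ax nU] [A'x _]]; apply: nU.
  by exists t' => //; have [_ h _] := hV (t, t') tt'; apply: h.
have [z z0 hz] := finite_disjoint_dist cB disjB.
have hB t : exists2 l, fpack (B t) (Num.min d (z / 2)) l & a t - N * e < pmass s l.
  have : pge s (B t) (a t - \sum_(t' <- enum T) e).
    by apply: pge_diff => //; apply: pleS (hU t) => // x [/AF].
  apply; last by rewrite lt_min d0; lra.
  rewrite ltrD2l ltrN2 big_enum /= sumr_const -mulr_natl ltr_pM2r//.
  by rewrite /N ltrDl.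
have /choice[l hl] : forall t, exists l, fpack (B t) (Num.min d (z / 2)) l /\ a t - N * e < pmass s l.
  by move=> t; have [l ? ?] := hB t; exists l.
have /= [L hL Lm] : exists2 L, fpack (\bigcup_(t in [set` enum T]) B t) (Num.min d (z / 2)) L &
    \sum_(t <- enum T) (a t - N * e) <= pmass s L.
  elim: (enum T) (enum_uniq T) => [_|t r IH /= /andP[tr /IH[L hL Lm]]].
    by exists [::]; rewrite // big_nil /pmass big_nil.
  exists (l t ++ L); last by rewrite big_cons pmass_cat lerD// ltW// (hl t).2.
  apply: (@fpackS _ _ (B t `|` \bigcup_(t in [set` r]) B t) _ _ _ _ _ (lexx _)).
    by move=> x [Bx|[t' t'r Bx]]; [exists t|exists t'] => //=; rewrite inE ?eqxx ?t'r ?orbT.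
  apply: fpack_cat => //; last exact: (hl t).1.
  move=> b b' /(hl t).1.2[Bb /andP[_ bz]] /hL.2[[t' t'r Bb'] /andP[_ bz']].
  have tt' : t <> t' by move=> tt'; rewrite /= -tt' (negbTE tr) in t'r.
  have := hz t t' _ _ tt' Bb Bb'; move: bz bz'; rewrite !le_min => /andP[_ ?] /andP[_ ?].
  by rewrite /separated; lra.
exists L.
  apply: fpackS hL; first by move=> x [t _ [/AF]].
  by rewrite ge_min lexx.
apply: lt_le_trans Lm; rewrite big_enum /= big_split /= sumr_const -mulr_natl.
have -> : c' = \sum_t a t - N * N * e by rewrite eN; lra.
by rewrite ltrD2l mulrN ltrN2 mulrA ltr_pM2r// ltr_pM2r ?/N ?ltrDl//.
Qed.

(** Once small neighbourhoods of the overlaps are removed, the pieces are [z] apart, so a set of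
    diameter below [z] meets at most one of them. A fine cover of [F] therefore splits into disjoint
    sublists, and its mass is distributed over the pieces. *)
Lemma hcov_additive s (T : finType) (A : T -> set point) F c d c' : 0 <= s ->
  (forall t, ecompact (A t)) -> (forall t, A t `<=` F) -> hle s F c ->
  (forall t t', t <> t' -> hle s (A t `&` A t') 0) -> 0 < d -> c < c' ->
  exists2 h : T -> R, (forall t, hcov s d (A t) (h t)) & \sum_t h t <= c'.
Proof.
move=> s0 cA AF hF null d0 lt.
pose N : R := #|T|%:R + 1.
have N1 : 1 <= N by rewrite /N lerDr.
pose e := (c' - c) / 2 / (N * N + 1).
have NN : 0 < N * N + 1 by nra.
have e0 : 0 < e by rewrite divr_gt0//; lra.
have eN : (N * N + 1) * e = (c' - c) / 2 by rewrite mulrC divfK// gt_eqF.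
have /choice[V hV] : forall tt : T * T, exists V, tt.1 <> tt.2 ->
    [/\ eopen V, A tt.1 `&` A tt.2 `<=` V & hcov s d V e].
  move=> [t t']; case: (pselect (t = t')) => [->|tt']; first by exists set0.
  have := null t t' tt' d e d0 e0; move=> /(hcov_nbhd s0)[V [oV IV hV]].
  by exists V.
pose U t := \bigcup_(t' in [set t' | t <> t']) V (t, t').
have hU t : hcov s d (U t) (N * e).
  suff h r : hcov s d (\bigcup_(t' in [set t' | t <> t' /\ t' \in r]) V (t, t'))
      (((size r)%:R + 1) * e).
    have := h (enum T); rewrite -cardE; apply: hcovS => // x [t' tt' Vx].
    by exists t' => //=; split=> //; rewrite mem_enum.
  elim: r => [|t' r IH].
    exists [::]; last by rewrite /cmass big_nil add0r mul1r.
    by split=> // x [? []].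
  rewrite /= -natr1 -addrA [_ + (1 + 1)]addrA mulrDl mul1r.
  case: (pselect (t = t')) => [tt'|tt'].
    apply: hcovS IH => //; last by rewrite lerDl ltW.
    by move=> x [t2 [tt2]]; rewrite inE => /predU1P[|t2r Vx]; [move=> e2; case: tt2; rewrite e2|exists t2].
  have [_ _ h] := hV (t, t') tt'; apply: hcovS (hcovU IH h) => //.
  move=> x [t2 [tt2]]; rewrite inE => /predU1P[->|t2r] Vx; [by right|left].
  by exists t2.
pose B t := A t `\` U t.
have cB t : ecompact (B t).
  by apply: ecompact_diff => //; apply: eopen_bigcup => t' tt'; have [] := hV (t, t') tt'.
have disjB t t' : t <> t' -> B t `&` B t' = set0.
  move=> tt'; apply/seteqP; split=> // x [[Ax nU] [A'x _]]; apply: nU.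
  by exists t' => //; have [_ h _] := hV (t, t') tt'; apply: h.
have [z z0 hz] := finite_disjoint_dist cB disjB.
have [||l hl lm] := hF (Num.min d z) ((c + c') / 2); [by rewrite lt_min d0|lra|].
pose meets t (a : set point * R) := `[< exists2 x, B t x & a.1 x >].
pose L t := [seq a <- l | meets t a].
have LB t : fcover (B t) d (L t).
  split=> [x Bx|a]; last first.
    rewrite mem_filter => /andP[_ /hl.2[da /andP[a0]]].
    by rewrite lt_min => /andP[ad _]; rewrite a0.
  have [|a al ax] := hl.1 x; first by apply: (AF t); case: Bx.
  by exists a => //; rewrite mem_filter al andbT; apply/asboolP; exists x.
exists (fun t => (cmass s (L t) + e) + N * e).
  move=> t; apply: (@hcovS _ _ _ _ (B t `|` U t) d d) => //.
    by move=> x Ax; case: (pselect (U t x)); [right|left].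
  by apply: hcovU => //; exists (L t) => //; rewrite ltrDl.
have sumL : \sum_t cmass s (L t) <= cmass s l.
  rewrite /cmass; under eq_bigr do rewrite big_filter big_mkcond.
  rewrite exchange_big /= !big_seq; apply: ler_sum => a al.
  have [t mt|nm] := pickP (meets^~ a); last first.
    by rewrite big1 ?powR_ge0// => t _; rewrite nm.
  rewrite (bigD1 t)//= mt big1 ?addr0// => t' t't; case: ifP => // /asboolP[x Bx ax].
  move: mt => /asboolP[y By ay]; have [da /andP[_]] := hl.2 a al.
  rewrite lt_min => /andP[_ az]; move: t't => /eqP t't.
  by have := hz _ _ _ _ t't Bx By; have := da _ _ ax ay; lra.
rewrite !big_split /= !sumr_const -[e *+ _]mulr_natl -[(N * e) *+ _]mulr_natl.
have : #|T|%:R * e + #|T|%:R * (N * e) <= (N * N + 1) * e.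
  by rewrite mulrA -mulrDl ler_pM2r//; rewrite /N; nra.
by rewrite eN; lra.
Qed.

(** By averaging, some piece has content at most its proportional share $\rho_j^s c'$, and pulling
    its cover back by [f j] covers [G]. The index [j] may vary with the scale, which is harmless as
    every piece is a copy of the same [G]. *)
Lemma hle_image_union s (m : nat) K (f : 'I_m -> point -> point) (rho : 'I_m -> R) G c :
  (0 < m)%N -> 0 <= s -> (forall j, 0 < rho j) -> (forall j, similarity_on K (f j) (rho j)) ->
  G `<=` K -> ecompact G ->
  (forall j j', j <> j' -> hle s (f j @` G `&` f j' @` G) 0) ->
  hle s (\bigcup_j f j @` G) c -> hle s G (c / \sum_j rho j `^ s).
Proof.
move=> m0 s0 rho0 fs GK cG null h d c' d0 lt.
pose M := \sum_j rho j `^ s.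
have M0 : 0 < M.
  rewrite /M (bigD1 (Ordinal m0))//= ltr_pwDl ?powR_gt0// sumr_ge0// => j _.
  exact: powR_ge0.
have lt' : c < c' * M by rewrite -ltr_pdivrMr.
have [|z z0 hz] := @finite_lower_bound R _ (enum 'I_m) rho; first by move=> j _; exact: rho0.
(* As [z] is below every ratio, a cover of any piece at scale [z * d] pulls back to one at scale
   [d]. *)
have [|||hh hh1 hh2] := @hcov_additive s _ (fun j => f j @` G) _ c (z * d) (c' * M) s0 _ _ h null _ lt'.
- by move=> j; apply: ecompact_image (fs j) GK cG.
- by move=> j x fx; exists j.
- by rewrite mulr_gt0.
have [j hj] : exists j, hh j <= rho j `^ s * c'.
  apply: contrapT => /forallNP nle.
  suff : c' * M < \sum_j hh j by rewrite ltNge hh2.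
  rewrite /M mulr_sumr (bigD1 (Ordinal m0))//= [ltRHS](bigD1 (Ordinal m0))//=.
  apply: ltr_leD; first by rewrite mulrC ltNge; apply/negP/nle.
  by apply: ler_sum => j _; rewrite mulrC ltW// ltNge; apply/negP/nle.
have [l hl lc] := hh1 j.
have zd : z * d <= rho j * d by rewrite ler_pM2r// hz// mem_enum.
have hl2 := fcoverS (@subset_refl _ _) zd hl.
exists [seq (G `&` f j @^-1` a.1, (rho j)^-1 * a.2) | a <- l].
  exact: (fcover_preimage (rho0 j) (fs j)).
rewrite (@cmass_scale _ _ s (rho j)^-1 (fun a => G `&` f j @^-1` a.1) _ _ _ _ hl2).
  by rewrite powRV ?(ltW (rho0 j))// ltr_pdivrMl ?powR_gt0// (lt_le_trans lc).
by rewrite invr_ge0 ltW.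
Qed.

End Additivity.

(** * Category *)

Section Baire.
Context {R : realType} {n : nat}.
Notation point := 'rV[R]_n.
Implicit Types (x y z : point) (F : set point).

(** If no [A k] were dense near a point of [F], each closed ball centred in [F] would contain a
    smaller one, also centred in [F], avoiding the next [A k]; the nested balls would meet in a
    point of [F] outside all of them. *)
Lemma ecompact_baire F (A : nat -> set point) : ecompact F -> F !=set0 ->
  F `<=` \bigcup_k A k ->
  exists k x (e : R), [/\ F x, 0 < e & forall y, F y -> edist x y < e ->
    forall e', 0 < e' -> exists2 z, A k z & edist y z < e'].
Proof.
move=> cF [x0 Fx0] FA; apply: contrapT => no.
have /choice[step hstep] : forall kp : nat * (point * R), exists p' : point * R,
    F kp.2.1 -> 0 < kp.2.2 -> [/\ F p'.1, 0 < p'.2 & forall z,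
      edist p'.1 z <= p'.2 -> edist kp.2.1 z <= kp.2.2 /\ ~ A kp.1 z].
  move=> [k [x e]] /=; case: (pselect (F x /\ 0 < e)) => [[Fx e0]|nxe]; last first.
    by exists (x, e) => Fx e0; case: nxe.
  have [y [Fy xy [e' e'0 hy]]] : exists y, [/\ F y, edist x y < e &
      exists2 e', 0 < e' & forall z, A k z -> e' <= edist y z].
    apply: contrapT => ny; apply: no; exists k, x, e; split=> // y Fy xy e' e'0.
    apply: contrapT => nz; apply: ny; exists y; split=> //; exists e' => // z Akz.
    by rewrite leNgt; apply/negP => yz; apply: nz; exists z.
  pose e2 := Num.min ((e - edist x y) / 2) (e' / 2).
  have e21 : e2 <= (e - edist x y) / 2 by rewrite ge_min lexx.
  have e22 : e2 <= e' / 2 by rewrite ge_min lexx orbT.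
  exists (y, e2) => _ _; split=> //=; first by rewrite lt_min !divr_gt0 ?subr_gt0.
  move=> z yz; split; first by have := edist_triangle y x z; lra.
  by move=> /hy; lra.
pose q := nat_rect (fun=> (point * R)%type) (x0, 1) (fun k p => step (k, p)).
have qP k : F (q k).1 /\ 0 < (q k).2.
  by elim: k => [//|k [Fk ek]]; have [] := hstep (k, q k) Fk ek.
have qS k z : edist (q k.+1).1 z <= (q k.+1).2 -> edist (q k).1 z <= (q k).2 /\ ~ A k z.
  by have [Fk ek] := qP k; have [_ _] := hstep (k, q k) Fk ek; exact.
have [|||z hz] := @ecompact_nested_nonempty R n (fun k => F `\` [set z | (q k).2 < edist (q k).1 z]).
- by move=> k; apply: ecompact_diff => //; exact: eopen_far.
- move=> k z [Fz /negP]; rewrite -leNgt => /qS[h _]; split=> //=.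
  by apply/negP; rewrite -leNgt.
- move=> k; have [Fk ek] := qP k; exists (q k).1; split=> //=.
  by rewrite edistxx; apply/negP; rewrite -leNgt ltW.
have [Fz _] := hz 0%N I; have [k _ Akz] := FA z Fz.
have [_ /negP] := hz k.+1 I; rewrite -leNgt => /qS[_]; exact.
Qed.

End Baire.

(** * Dimensions read off from vanishing measures *)

Section Dimensions.
Context {R : realType} {n : nat}.
Notation point := 'rV[R]_n.
Implicit Types (E : set point) (d t : R).

Lemma inf_eq (X : set R) (d : R) : (forall t, d < t -> X t) -> (forall t, X t -> d <= t) -> inf X = d.
Proof.
move=> above below; apply/eqP; rewrite eq_le; apply/andP; split.
  rewrite leNgt; apply/negP => lt; have : inf X <= (inf X + d) / 2.
    by apply: ge_inf; [exists d; exact: below|apply: above; lra].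
  by lra.
by apply: lb_le_inf => //; exists (d + 1); apply: above; rewrite ltrDl.
Qed.

Lemma hausdorff_ge0 t E : (0 <= hausdorff t E)%E.
Proof.
apply: le_ereal_sup_tmp; exists (hausdorff_delta t 1 E); first by exists 1 => //=.
apply: le_ereal_inf_tmp => _ [JU _ <-]; apply: esum_ge0 => k _.
by rewrite lee_fin powR_ge0.
Qed.

Lemma hausdorff_eq0 t E : 0 <= t -> ecompact E -> hausdorff t E = 0%E <-> hle t E 0.
Proof.
move=> t0 cE; split=> [h|h]; first by apply: hle_hausdorff => //; rewrite h.
by apply/eqP; rewrite eq_le hausdorff_ge0 andbT; exact: hausdorff_hle.
Qed.

Lemma packing_ge0 t E : (0 <= packing t E)%E.
Proof.
apply: le_ereal_inf_tmp => _ [A _ <-]; apply: esum_ge0 => k _.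
exact: packing_pre_ge0.
Qed.

Lemma ple_packing_eq0 t E : ple t E 0 -> packing t E = 0%E.
Proof.
move=> h; apply/eqP; rewrite eq_le packing_ge0 andbT.
by apply: le_trans (packing_le_pre _ _) _; apply/packing_pre_le.
Qed.

Lemma dimH_eq E d : 0 <= d -> ecompact E -> (forall t, d < t -> hle t E 0) ->
  (forall t, 0 <= t < d -> ~ hle t E 0) -> dimH E = d.
Proof.
move=> d0 cE above below; apply: inf_eq => [t dt|t [t0 /(hausdorff_eq0 t0 cE) h]].
  by have t0 := le_trans d0 (ltW dt); split=> //; apply/(hausdorff_eq0 t0 cE)/above.
by rewrite leNgt; apply/negP => td; apply: (below t); rewrite ?t0.
Qed.

Lemma dimP_eq E d : 0 <= d -> (forall t, d < t -> ple t E 0) ->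
  (forall t, 0 <= t < d -> packing t E <> 0%E) -> dimP E = d.
Proof.
move=> d0 above below; apply: inf_eq => [t dt|t [t0 h]].
  by split; [exact: le_trans d0 (ltW dt)|exact/ple_packing_eq0/above].
by rewrite leNgt; apply/negP => td; apply: (below t); rewrite ?t0.
Qed.

End Dimensions.

(** * Residual sets of sequences *)

Section Residual.
Context {N : nat}.
Implicit Types (w u v : nat -> 'I_N) (A B U : set (nat -> 'I_N)).

Definition shift w : nat -> 'I_N := fun p => w p.+1.

Definition glue k u w : nat -> 'I_N := fun p => if (p < k)%N then u p else w (p - k)%N.

Lemma iter_shiftE L w p : iter L shift w p = w (L + p)%N.
Proof. by elim: L p => [//|L IH] p /=; rewrite /shift IH addnS addSn. Qed.

Lemma shift_glue k u w : shift (glue k.+1 u w) = glue k (shift u) w.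
Proof. by apply/funext => p; rewrite /shift /glue ltnS subSS. Qed.

(** The source of density: a property that survives prepending a letter holds for all sequences with
    tail [w], and these are dense by [glue_dense]. *)
Lemma glue_ind (Q : (nat -> 'I_N) -> Prop) w : (forall v, Q (shift v) -> Q v) ->
  Q w -> forall k u, Q (glue k u w).
Proof.
move=> QS Qw; elim=> [|k IH] u; last by apply: QS; rewrite shift_glue.
by rewrite (_ : glue 0 u w = w)//; apply/funext => p; rewrite /glue subn0.
Qed.

Lemma glue_dense A w : (forall k u, A (glue k u w)) -> Omega_dense A.
Proof. by move=> h u k; exists (glue k u w); split=> // p pk; rewrite /glue pk. Qed.

Lemma residualS A B : A `<=` B -> residual A -> residual B.
Proof. by move=> AB [G [hG GA]]; exists G; split=> //; exact: subset_trans AB. Qed.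

Lemma residual_bigcap (A : nat -> set (nat -> 'I_N)) :
  (forall k, residual (A k)) -> residual (\bigcap_k A k).
Proof.
move=> /choice[G hG].
(* Numbers that code no pair default to $(0,0)$, which merely repeats one set. *)
pose dec p : nat * nat := odflt (0%N, 0%N) (unpickle p).
exists (fun p => G (dec p).1 (dec p).2); split.
  by move=> p; exact: (hG (dec p).1).1.
move=> w hw k _; apply: (hG k).2 => j _.
by have := hw (pickle (k, j)) I; rewrite /dec pickleK.
Qed.

Lemma residualI A B : residual A -> residual B -> residual (A `&` B).
Proof.
move=> rA rB; have : residual (\bigcap_k (if k == 0%N then A else B)).
  by apply: residual_bigcap => k; case: ifP.
apply: residualS => w h; split; first exact: (h 0%N I).
exact: (h 1%N I).
Qed.

Lemma residual_open_dense U : Omega_open U -> Omega_dense U -> residual U.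
Proof. by move=> oU dU; exists (fun=> U); split=> // w /(_ 0%N I). Qed.

Lemma residual_shift A : residual A -> residual [set w | A (shift w)].
Proof.
move=> [G [hG GA]]; exists (fun k => [set w | G k (shift w)]); split; last first.
  by move=> w h; apply: GA => k _; exact: h.
move=> k; have [oG dG] := hG k; split.
  move=> u /oG[q hq]; exists q.+1 => v vu; apply: hq => p pq; exact: vu.
move=> u q; have [v [Gv vu]] := dG (shift u) q.
exists (fun p => if p is p'.+1 then v p' else u 0%N); split; first exact: Gv.
by case=> [//|p] pq; apply: vu; exact: ltnW.
Qed.

Lemma residual_infinitely_often (i : 'I_N) : residual [set w : nat -> 'I_N | forall k, exists2 q, (k <= q)%N & w q = i].
Proof.
apply: (@residualS (\bigcap_k [set w : nat -> 'I_N | exists2 q, (k <= q)%N & w q = i])).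
  by move=> w h k; exact: h.
apply: residual_bigcap => k; apply: residual_open_dense.
  move=> w [q kq wq]; exists q.+1 => v vw; exists q => //.
  by rewrite vw.
move=> u q; exists (glue q u (fun=> i)); split; last by move=> p pq; rewrite /glue pq.
by exists (maxn k q); rewrite ?leq_maxl// /glue ltnNge leq_maxr.
Qed.

End Residual.

(** * Cylinders *)

Section Grid.
Context {R : realType} {n : nat}.
Notation point := 'rV[R]_n.

(** Pigeonhole on a grid of mesh $t/(n+1)$: points in the same cell are less than [t] apart, and the
    number of cells near [z] depends on [q] and [n] only. *)
Lemma separated_count (q : R) : exists M : nat, forall (T : eqType) (l : seq T)
  (y : T -> point) (z : point) (t : R), 0 < t -> uniq l ->
  (forall v, v \in l -> edist z (y v) <= q * t) ->
  (forall v v', v \in l -> v' \in l -> v <> v' -> t <= edist (y v) (y v')) ->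
  (size l <= M)%N.
Proof.
pose B := (Num.bound (2 * `|q| * n.+1%:R)).
exists (#|{ffun 'I_n -> 'I_B.+1}|) => T l y z t t0 ul near sep.
pose u := t / n.+1%:R; have u0 : 0 < u by rewrite divr_gt0.
pose cell v : {ffun 'I_n -> 'I_B.+1} :=
  [ffun i => inord (Num.truncn ((y v 0 i - z 0 i + `|q| * t) / u))].
have cellP v i : v \in l -> 0 <= (y v 0 i - z 0 i + `|q| * t) / u /\
    (Num.truncn (((y v 0 i - z 0 i + `|q| * t) / u)%R) < B.+1)%N.
  move=> vl; have h1 : `|z 0 i - y v 0 i| <= `|q| * t.
    apply: le_trans (coord_le_edist _ _ _) _; apply: le_trans (near v vl) _.
    by rewrite ler_pM2r// ler_norm.
  have h2 : 0 <= (y v 0 i - z 0 i + `|q| * t) / u.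
    by apply: divr_ge0; [move: h1; rewrite ler_norml; lra|exact: ltW].
  split=> //; rewrite ltnS -(ler_nat R).
  have/andP[h3 _] := truncn_itv h2; apply: le_trans h3 _.
  apply: (@le_trans _ _ (2 * `|q| * n.+1%:R)); last first.
    by apply/ltW/archi_boundP; rewrite !mulr_ge0.
  have uE : n.+1%:R * u = t by rewrite /u mulrC mulfVK// pnatr_eq0.
  rewrite ler_pdivrMr// -[leRHS]mulrA uE.
  by move: h1; rewrite ler_norml; lra.
suff uc : uniq (map cell l) by rewrite -(size_map cell) -(card_uniqP uc) max_card.
rewrite map_inj_in_uniq// => v v' vl v'l /ffunP eqc.
apply: contrapT => vv'; have := sep v v' vl v'l vv'; rewrite leNgt => /negP; apply.
have -> : t = u * n.+1%:R by rewrite /u mulfVK// pnatr_eq0.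
apply: edist_lt_coord => // i; have := eqc i; rewrite !ffunE => /(congr1 val) /=.
have [p1 p2] := cellP v i vl; have [p1' p2'] := cellP v' i v'l.
rewrite !inordK// => eqt.
have /andP[a1 a2] := truncn_itv p1; have /andP[a1' a2'] := truncn_itv p1'.
have unscale x (k : nat) : k%:R <= x / u -> x / u < k.+1%:R -> k%:R * u <= x < k%:R * u + u.
  by rewrite ler_pdivlMr// ltr_pdivrMr// -natr1 mulrDl mul1r => -> ->.
rewrite eqt in a1 a2; move: (unscale _ _ a1 a2) (unscale _ _ a1' a2').
by move: (_%:R * u) => k; rewrite ltr_norml; lra.
Qed.

End Grid.

Section Words.
Context {R : realType} {n N : nat}.
Notation point := 'rV[R]_n.
Context (K : set point) (m : 'I_N -> nat) (S : forall i : 'I_N, 'I_(m i) -> point -> point).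
Context (r : forall i : 'I_N, 'I_(m i) -> R).
Context (cK : ecompact K) (K0 : K !=set0) (m0 : forall i, (0 < m i)%N).
Context (r01 : forall i (j : 'I_(m i)), 0 < r j < 1) (SK : forall i (j : 'I_(m i)), S j @` K `<=` K).
Context (simS : forall i (j : 'I_(m i)), similarity_on K (S j) (r j)).
Implicit Types (w : nat -> 'I_N) (A : set point).

Notation F := (F_omega S K).

Lemma PhiE i A : Phi S i A = \bigcup_(j in [set: 'I_(m i)]) S j @` A.
Proof.
apply/seteqP; split=> [y [j [x Ax ->]]|y [j _ [x Ax <-]]]; first by exists j.
by exists j, x.
Qed.

Lemma Phi_mono i A B : A `<=` B -> Phi S i A `<=` Phi S i B.
Proof. by move=> AB y [j [x Ax ->]]; exists j, x; [exact: AB|]. Qed.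

Lemma Phi_sub i A : A `<=` K -> Phi S i A `<=` K.
Proof. by move=> AK y [j [x Ax ->]]; apply: SK; exists x => //; exact: AK. Qed.

Lemma iter_maps_sub w k : iter_maps S w k K `<=` K.
Proof. by elim: k w => [|k IH] w //=; exact: Phi_sub. Qed.

Lemma iter_maps_dec w k : iter_maps S w k.+1 K `<=` iter_maps S w k K.
Proof.
elim: k w => [|k IH] w; first exact: iter_maps_sub.
exact: (@Phi_mono _ (iter_maps S (shift w) k.+1 K)).
Qed.

Lemma iter_maps_le w j k : (j <= k)%N -> iter_maps S w k K `<=` iter_maps S w j K.
Proof.
elim: k => [|k IH]; first by rewrite leqn0 => /eqP ->.
rewrite leq_eqVlt => /predU1P[->//|/IH jk]; exact: subset_trans (@iter_maps_dec w k) jk.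
Qed.

Lemma r_gt0 i (j : 'I_(m i)) : 0 < r j. Proof. by have /andP[] := r01 j. Qed.

Lemma ecompact_iter_maps w k : ecompact (iter_maps S w k K).
Proof.
elim: k w => [|k IH] w //=; rewrite PhiE; apply: ecompact_finite_union => j.
apply: (@ecompact_image _ _ K (S j) (r j)).
- exact: r_gt0.
- exact: simS.
- exact: iter_maps_sub.
- exact: IH.
Qed.

Lemma iter_maps_nonempty w k : iter_maps S w k K !=set0.
Proof.
elim: k w => [|k IH] w //=; have [x hx] := IH (shift w).
by exists (S (Ordinal (m0 (w 0%N))) x); exists (Ordinal (m0 (w 0%N))), x.
Qed.

Lemma F_nonempty w : F w !=set0.
Proof.
apply: ecompact_nested_nonempty; [exact: ecompact_iter_maps| |exact: iter_maps_nonempty].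
exact: iter_maps_dec.
Qed.

Lemma F_sub w : F w `<=` K.
Proof. by move=> x /(_ 0%N I). Qed.

Lemma ecompact_F w : ecompact (F w).
Proof.
apply: ecompact_subset cK _ (@F_sub w); rewrite /eclosed /F_omega setC_bigcap.
by apply: eopen_bigcup => k _; apply/ecompact_closed/ecompact_iter_maps.
Qed.

Lemma S_inj i (j : 'I_(m i)) x y : K x -> K y -> S j x = S j y -> x = y.
Proof.
move=> Kx Ky h; apply: edist_eq0; have := simS j Kx Ky.
by rewrite h edistxx => /esym/eqP; rewrite mulf_eq0 gt_eqF ?r_gt0//= => /eqP.
Qed.

(** A point of [F w] has a first letter at every level [k]. Some letter [j] serves for arbitrarily
    large [k], and as [S j] is injective on [K] the corresponding preimages coincide, so one
    preimage lies in all levels. *)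
Lemma F_unfold w : F w = \bigcup_(j in [set: 'I_(m (w 0%N))]) S j @` F (shift w).
Proof.
apply/seteqP; split=> [x Fx|_ [j _ [x Fx <-]] k _]; last first.
  case: k => [|k]; first by apply: SK; exists x => //; exact: (@F_sub (shift w)).
  by exists j, x => //; apply: Fx.
have /choice[jy hjy] : forall k, exists jy : 'I_(m (w 0%N)) * point,
    iter_maps S (shift w) k K jy.2 /\ x = S jy.1 jy.2.
  by move=> k; have [j [y hy ->]] := Fx k.+1 I; exists (j, y).
have [j hj] : exists j, forall k, exists2 k', (k <= k')%N & (jy k').1 = j.
  apply: contrapT => /forallNP nj.
  have /choice[k0 hk0] : forall j, exists k, forall k', (k <= k')%N -> (jy k').1 <> j.
    by move=> j; have /existsNP[k hk] := nj j; exists k => k' kk' e; apply: hk; exists k'.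
  by apply: (hk0 (jy (\max_j k0 j)%N).1 (\max_j k0 j)%N) => //; exact: leq_bigmax.
have [k1 _ k1j] := hj 0%N; have [h1 x1] := hjy k1.
exists j => //; exists (jy k1).2; last by rewrite x1 k1j.
move=> k _; have [k' kk' k'j] := hj k; have [h' x'] := hjy k'.
have -> : (jy k1).2 = (jy k').2.
  apply: (@S_inj _ j); [exact: iter_maps_sub h1|exact: iter_maps_sub h'|].
  by rewrite -{1}k1j -x1 -k'j -x'.
exact: iter_maps_le h'.
Qed.

Lemma iter_maps_eq (v w : nat -> 'I_N) k A : (forall p, (p < k)%N -> v p = w p) ->
  iter_maps S v k A = iter_maps S w k A.
Proof.
elim: k v w => [//|k IH] v w h /=; rewrite h//.
by congr (Phi _ _ _); apply: IH => p pk; apply: h.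
Qed.

(** Upper semicontinuity of [F]: by compactness some finite stage already lies in [V], and it
    depends on [k] letters only. *)
Lemma F_nbhd w V : eopen V -> F w `<=` V ->
  exists k, forall v, (forall p, (p < k)%N -> v p = w p) -> F v `<=` V.
Proof.
move=> oV FV; have [|k hk] := ecompact_nested_sub cK oV (@ecompact_iter_maps w) (@iter_maps_dec w).
  by move=> x [_ /FV].
exists k => v vw x Fx; apply: hk; split; first exact: (@F_sub v).
by rewrite -(iter_maps_eq _ vw); exact: Fx.
Qed.

(** Tagging each map index with its system makes words plain lists, independent of [w]; [admissible]
    then says that the tags follow [w]. *)
Definition letter : eqType := {i : 'I_N & 'I_(m i)}.
Implicit Types (u v : seq letter).
Definition lmap (a : letter) := S (tagged a).
Definition lratio (a : letter) : R := r (tagged a).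

Definition wmap u : point -> point := foldr (fun a f => lmap a \o f) idfun u.
Definition wratio u : R := \prod_(a <- u) lratio a.

Fixpoint admissible w u : bool :=
  if u is a :: u' then (tag a == w 0%N) && admissible (shift w) u' else true.

Fixpoint words w L : seq (seq letter) :=
  if L is L'.+1 then
    [seq (Tagged (fun i => 'I_(m i)) j) :: u | j <- enum 'I_(m (w 0%N)), u <- words (shift w) L']
  else [:: [::]].

Lemma lratio_gt0 a : 0 < lratio a. Proof. exact: r_gt0. Qed.

Lemma lratio_lt1 a : lratio a < 1. Proof. by have /andP[] := r01 (tagged a). Qed.

Lemma wratio_cons a u : wratio (a :: u) = lratio a * wratio u.
Proof. by rewrite /wratio big_cons. Qed.

Lemma wratio_gt0 u : 0 < wratio u.
Proof. by apply: prodr_gt0 => a _; exact: lratio_gt0. Qed.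

Lemma wmap_sub u x : K x -> K (wmap u x).
Proof. by elim: u => [//|a u IH] Kx /=; apply: SK; exists (wmap u x) => //; exact: IH. Qed.

Lemma wmap_sim u : similarity_on K (wmap u) (wratio u).
Proof.
elim: u => [|a u IH] x y Kx Ky; first by rewrite /wratio big_nil mul1r.
rewrite /= /lmap simS; [|exact: wmap_sub|exact: wmap_sub].
by rewrite (IH x y Kx Ky) wratio_cons mulrA.
Qed.

Lemma wmap_cat u v x : wmap (u ++ v) x = wmap u (wmap v x).
Proof. by elim: u => [//|a u IH] /=; rewrite IH. Qed.

Lemma mem_words w L u : u \in words w L = (size u == L) && admissible w u.
Proof.
elim: L w u => [|L IH] w [|a u] //=.
  by apply/negbTE/negP => /allpairsP[[j v] [_ _]].
rewrite eqSS; apply/allpairsP/andP => [[[j v] [_ /=]]|[su /andP[/eqP ta adm]]].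
  by rewrite IH => /andP[sv av] [-> ->]; rewrite sv eqxx.
case: a ta => i j /= ta; subst i; exists (j, u); split=> //=; first by rewrite mem_enum.
by rewrite IH su.
Qed.

Lemma words_eq (v w : nat -> 'I_N) L : (forall p, (p < L)%N -> v p = w p) -> words v L = words w L.
Proof.
elim: L v w => [//|L IH] v w h /=; rewrite h// (IH (shift v) (shift w))// => p pL.
exact: h.
Qed.

Lemma F_words w L : F w = \bigcup_(u in [set` words w L]) wmap u @` F (iter L shift w).
Proof.
elim: L w => [|L IH] w.
  apply/seteqP; split=> [x Fx|x [u]]; first by exists [::] => //; exists x.
  by rewrite /= inE => /eqP -> [y Fy <-].
rewrite F_unfold (IH (shift w)) -iterSr; apply/seteqP; split.
  move=> _ [j _ [_ [u uw [x Fx <-]] <-]]; exists (Tagged _ j :: u); last by exists x.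
  by apply/allpairsP; exists (j, u); split=> //=; rewrite mem_enum.
move=> _ [u0 /allpairsP[[j u] [_ /= uw ->]] [x Fx <-]].
by exists j => //; exists (wmap u x) => //; exists u => //; exists x.
Qed.

Lemma ratio_bounds : exists2 c : R, 0 < c <= 1 & forall a, c <= lratio a <= 1 - c.
Proof.
have [|c c0 hc] := @finite_lower_bound R _ (enum (predT : pred {i : 'I_N & 'I_(m i)}))
    (fun a => Num.min (lratio a) (1 - lratio a)).
  by move=> a _; rewrite lt_min lratio_gt0 subr_gt0 lratio_lt1.
exists (Num.min c 1); first by rewrite lt_min c0 ltr01 ge_min lexx orbT.
move=> a; have := hc a; rewrite mem_enum => /(_ isT); rewrite le_min => /andP[h1 h2].
have : Num.min c 1 <= c by rewrite ge_min lexx.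
by lra.
Qed.

Lemma wratio_small (e : R) : 0 < e -> exists L, forall u, (L <= size u)%N -> wratio u < e.
Proof.
move=> e0; have [c /andP[c0 c1] hc] := ratio_bounds.
have [L hL] : exists L, (1 - c) ^+ L < e.
  by apply: expr_small => //; lra.
exists L => u sL; apply: le_lt_trans hL; apply: (@le_trans _ _ ((1 - c) ^+ size u)).
  elim: u {sL} => [|a u IH]; first by rewrite /wratio big_nil expr0.
  rewrite wratio_cons exprS ler_pM//; [exact/ltW/lratio_gt0|exact/ltW/wratio_gt0|].
  by have /andP[] := hc a.
by apply: ler_wiXn2l => //; lra.
Qed.

(** The usual stopping rule: the shortest prefix of [u] with ratio at most [rho], or all of [u] if
    there is none. *)
Fixpoint stop (rho : R) u : seq letter :=
  if u is a :: u' then (if 1 <= rho then [::] else a :: stop (rho / lratio a) u') else [::].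

Lemma stop_prefix rho u : prefix (stop rho u) u.
Proof.
elim: u rho => [//|a u IH] rho /=; case: ifP => // _.
by rewrite eqxx IH.
Qed.

Lemma stop_le rho u : wratio u <= rho -> wratio (stop rho u) <= rho.
Proof.
elim: u rho => [//|a u IH] rho /=; case: ifP => [h _|_]; first by rewrite /wratio big_nil.
rewrite !wratio_cons -!ler_pdivlMl ?lratio_gt0// mulrC; exact: IH.
Qed.

(** Before its last letter a stopped word still has ratio above [rho], and one letter costs at most
    the factor [c]. *)
Lemma stop_ge c rho u : 0 < c <= 1 -> (forall a, c <= lratio a) -> 0 < rho < 1 ->
  c * rho <= wratio (stop rho u).
Proof.
move=> /andP[c0 c1] hc; elim: u rho => [|a u IH] rho /andP[rho0 rho1] /=.
  by rewrite /wratio big_nil; nra.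
case: ifP => [h|_]; first by rewrite ltNge h in rho1.
rewrite wratio_cons; have a0 := lratio_gt0 a.
have [h|h] := ltP (rho / lratio a) 1.
  by rewrite -ler_pdivrMl// mulrC -mulrA; apply: IH; rewrite h divr_gt0.
have -> : stop (rho / lratio a) u = [::] by case: u {IH} => //= b u; rewrite h.
rewrite /wratio big_nil mulr1; apply: le_trans (hc a); nra.
Qed.

(** The hypothesis on [u] ensures that stopping occurs; beyond that point [stop rho v] cannot
    continue either. Stopped words thus form an antichain. *)
Lemma stop_incomparable rho u v : wratio u <= rho ->
  prefix (stop rho u) (stop rho v) -> stop rho u = stop rho v.
Proof.
elim: u v rho => [|a u IH] v rho.
  rewrite /wratio big_nil => rho1 _ /=; case: v => //= b v; by rewrite rho1.
move=> /= h; case: ifP => [rho1 _|rho1]; first by case: v => //= b v; rewrite rho1.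
case: v => // b v /=; rewrite rho1 prefix_cons => /andP[/eqP <- p]; congr cons.
by apply: IH p; rewrite ler_pdivlMr ?lratio_gt0// mulrC -wratio_cons.
Qed.

Lemma admissible_prefix w u v : prefix u v -> admissible w v -> admissible w u.
Proof.
elim: u v w => [//|a u IH] [//|b v] w /=.
by move=> /andP[/eqP <- p] /andP[-> /(IH _ _ p)].
Qed.

Lemma prefix_comparable u v u' : prefix u u' -> prefix v u' -> prefix u v || prefix v u.
Proof.
elim: u' u v => [|a u' IH] [|b u] [|c v] //=; rewrite ?prefix_cons ?prefix0s ?orbT//.
by move=> /andP[/eqP -> h1] /andP[/eqP -> h2]; rewrite eqxx; exact: IH.
Qed.

(** * Mass of words, and the upper bound for packings *)

Section Mass.
Context (s : 'I_N -> R) (sumS : forall i, \sum_(j < m i) (r j) `^ (s i) = 1).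

Definition wmass u : R := \prod_(a <- u) lratio a `^ s (tag a).

Lemma wmass_cons a u : wmass (a :: u) = lratio a `^ s (tag a) * wmass u.
Proof. by rewrite /wmass big_cons. Qed.

Lemma wmass_ge0 u : 0 <= wmass u.
Proof. by apply: prodr_ge0 => a _; exact: powR_ge0. Qed.

Lemma wmass_words w L : \sum_(u <- words w L) wmass u = 1.
Proof.
elim: L w => [|L IH] w; first by rewrite big_seq1 /wmass big_nil.
rewrite /= big_allpairs_dep /= big_enum /= -[RHS](sumS (w 0%N)); apply: eq_bigr => j _.
by under eq_bigr do rewrite wmass_cons; rewrite -mulr_sumr IH mulr1.
Qed.

Lemma wmass_prefix w L v : admissible w v -> (size v <= L)%N ->
  \sum_(u <- words w L | prefix v u) wmass u = wmass v.
Proof.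
elim: v w L => [|a v IH] w L.
  move=> _ _; under eq_bigl do rewrite prefix0s.
  by rewrite wmass_words /wmass big_nil.
case: L => // L /= /andP[/eqP ta adm] sv.
case: a ta => i j /= ta; subst i.
rewrite big_mkcond big_allpairs_dep /= big_enum /= (bigD1 j)//= [X in _ + X]big1 ?addr0.
  rewrite wmass_cons /= -(IH _ _ adm sv) mulr_sumr [RHS]big_mkcond /=.
  apply: eq_bigr => u _; rewrite eqxx /=; case: ifP => // _.
  by rewrite wmass_cons.
move=> j' j'j; rewrite big1// => u _; rewrite eq_Tagged /= eq_sym (negbTE j'j).
by [].
Qed.

Lemma sum_at_most_one (T : eqType) (l : seq T) (P : pred T) (x : R) : 0 <= x -> uniq l ->
  (forall t t', t \in l -> t' \in l -> P t -> P t' -> t = t') ->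
  \sum_(t <- l | P t) x <= x.
Proof.
move=> x0 ul h; have [/hasP[t tl Pt]|/hasPn nP] := boolP (has P l); last first.
  by rewrite big_seq_cond big1// => t /andP[/nP/negbTE ->].
rewrite (big_rem t)//= Pt big_seq_cond big1 ?addr0// => t' /andP[].
by rewrite mem_rem_uniq// inE => /andP[/eqP t't t'l] Pt'; case: t't; apply: h.
Qed.

(** A Kraft inequality: spread each mass over the extensions of a common length [L]; every word of
    length [L] extends at most one member of the antichain. *)
Lemma wmass_antichain w (l : seq (seq letter)) : uniq l ->
  (forall v, v \in l -> admissible w v) ->
  (forall v v', v \in l -> v' \in l -> prefix v v' -> v = v') ->
  \sum_(v <- l) wmass v <= 1.
Proof.
move=> ul adm anti; pose L := (\max_(v <- l) size v)%N.
rewrite -(wmass_words w L) big_seq.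
rewrite (eq_bigr (fun v => \sum_(u <- words w L | prefix v u) wmass u)); last first.
  by move=> v vl; rewrite wmass_prefix ?adm// /L leq_bigmax_seq.
rewrite -big_seq (exchange_big_dep xpredT) //=; apply: ler_sum => u _.
apply: sum_at_most_one => //; first exact: wmass_ge0.
move=> v v' vl v'l pv pv'; have /orP[] := prefix_comparable pv pv'.
  exact: anti.
by move=> /(anti _ _ v'l vl).
Qed.

Lemma wmass_le w v t : admissible w v -> (forall q, t <= s (w q)) ->
  wmass v <= wratio v `^ t.
Proof.
elim: v w => [|a v IH] w /=; first by rewrite /wmass /wratio !big_nil powR1.
move=> /andP[/eqP ta adm] ts; rewrite wmass_cons wratio_cons.
rewrite powRM ?(ltW (lratio_gt0 _)) ?(ltW (wratio_gt0 _))//.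
apply: ler_pM; rewrite ?powR_ge0 ?wmass_ge0//; last by apply: IH adm _ => q; apply: ts.
by apply: ger_powR; rewrite ?lratio_gt0 ?(ltW (lratio_lt1 _))// ta.
Qed.

Lemma wmass_ge w v t : admissible w v -> (forall q, s (w q) <= t) ->
  wratio v `^ t <= wmass v.
Proof.
elim: v w => [|a v IH] w /=; first by rewrite /wmass /wratio !big_nil powR1.
move=> /andP[/eqP ta adm] ts; rewrite wmass_cons wratio_cons.
rewrite powRM ?(ltW (lratio_gt0 _)) ?(ltW (wratio_gt0 _))//.
apply: ler_pM; rewrite ?powR_ge0 ?wmass_ge0//; last by apply: IH adm _ => q; apply: ts.
by apply: ger_powR; rewrite ?lratio_gt0 ?(ltW (lratio_lt1 _))// ta.
Qed.

Lemma cylinder_diam : exists2 D : R, 0 < D & forall u x y, K x -> K y ->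
  edist (wmap u x) (wmap u y) < wratio u * D.
Proof.
have [D D0 hD] := ecompact_bounded cK; exists D => // u x y Kx Ky.
by rewrite wmap_sim// ltr_pM2l ?wratio_gt0// hD.
Qed.

Lemma F_word_mem w L u x : u \in words w L -> F (iter L shift w) x -> F w (wmap u x).
Proof. by move=> uw Fx; rewrite (F_words w L); exists u => //; exists x. Qed.

(** Each ball of a packing contains the cylinder of a word through its centre stopped at ratio
    $r/D$. Separated balls give incomparable words, so the masses sum to at most $1$; as the stopped
    ratio is at least $c r/D$, each term $(2r)^t$ is at most $(2D/c)^t$ times the mass. *)
Lemma packing_upper t : 0 <= t -> exists C, forall w,
  (forall q, s (w q) <= t) -> ple t (F w) C.
Proof.
move=> t0; have [D D0 hD] := cylinder_diam; have [c c01 hc] := ratio_bounds.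
have /andP[c0 c1] := c01.
exists ((2 * (D / c)) `^ t) => w sw.
(* Radii at most $D/2$ give stopping thresholds below $1$, as [stop_ge] requires. *)
move=> c' cc'; exists (D / 2); first by rewrite divr_gt0.
move=> l hl; apply: le_trans (ltW cc').
have [|e e0 he] := @finite_lower_bound R _ l (fun a => a.2 / D).
  by move=> a /hl.2[_ /andP[a0 _]]; rewrite divr_gt0.
have [L hL] := wratio_small e0.
have /choice[g hg] : forall a : point * R, exists u, a \in l ->
    [/\ u \in words w L, wratio u <= a.2 / D & exists2 x, K x & a.1 = wmap u x].
  move=> a; case: (boolP (a \in l)) => [al|_]; last by exists [::].
  have [+ _] := hl.2 a al; rewrite (F_words w L) => -[u uw [x Fx <-]].
  exists u => _; split=> //; last by exists x => //; exact: F_sub Fx.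
  apply: le_trans (he a al); apply: ltW; apply: hL.
  by move: uw; rewrite /= mem_words => /andP[/eqP ->].
pose v a := stop (a.2 / D) (g a).
have [k0 Kk0] := K0.
have vball a k : a \in l -> K k -> edist a.1 (wmap (v a) k) < a.2.
  move=> al Kk; have [_ ga [x Kx ax]] := hg a al.
  have /prefixP[u' gE] := stop_prefix (a.2 / D) (g a).
  rewrite ax gE wmap_cat; apply: lt_le_trans (hD _ _ _ _ Kk) _; first exact: wmap_sub.
  by rewrite -ler_pdivlMr//; exact: stop_le.
have incomp a b : a \in l -> b \in l -> separated a b -> ~~ prefix (v a) (v b).
  move=> al bl; rewrite /separated => sab; apply/negP => /prefixP[u' vE].
  have h1 := vball b k0 bl Kk0; rewrite vE wmap_cat in h1.
  have h2 := vball a (wmap u' k0) al (wmap_sub _ Kk0).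
  have := edist_triangle (wmap (v a) (wmap u' k0)) a.1 b.1.
  rewrite (edistC (wmap (v a) (wmap u' k0)) b.1); lra.
have pinc : pairwise (fun u u' => ~~ prefix u u' && ~~ prefix u' u) [seq v a | a <- l].
  rewrite pairwise_map; have : all [in l] l by apply/allP.
  move=> /sub_in_pairwise; apply; last exact: hl.1.
  move=> a b al bl sab /=; rewrite incomp//= incomp//.
  by rewrite separatedC.
have uni : uniq [seq v a | a <- l].
  by apply: pairwise_uniq pinc => u; rewrite prefix_refl.
have anti u u' : u \in [seq v a | a <- l] -> u' \in [seq v a | a <- l] ->
    prefix u u' -> u = u'.
  move=> ul u'l p; apply: contrapT => /eqP uu'.
  have := pinc; rewrite -[X in pairwise _ X]/([seq v a | a <- l]).
  move: ul u'l; set vl := [seq v a | a <- l] => ul u'l /(pairwiseP [::]) h.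
  have i1 : (index u vl < size vl)%N by rewrite index_mem.
  have i2 : (index u' vl < size vl)%N by rewrite index_mem.
  have := h _ _ i1 i2; have := h _ _ i2 i1; rewrite !nth_index// p !andbF /=.
  case: (ltngtP (index u vl) (index u' vl)) => [_ _ /(_ isT)//|_ /(_ isT)//|ie].
  by move: uu'; rewrite -(nth_index [::] ul) ie nth_index// eqxx.
have adm u : u \in [seq v a | a <- l] -> admissible w u.
  move=> /mapP[a /hg[gw _ _] ->]; apply: admissible_prefix (stop_prefix _ _) _.
  by move: gw; rewrite mem_words => /andP[].
have := wmass_antichain uni adm anti; rewrite big_map => le1.
apply: (@le_trans _ _ (\sum_(a <- l) (2 * (D / c)) `^ t * wmass (v a))); last first.
  by rewrite -mulr_sumr ler_piMr ?powR_ge0.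
rewrite /pmass !big_seq; apply: ler_sum => a al.
have [_ /andP[a0 ad]] := hl.2 a al.
have Dc0 : 0 < D / c by rewrite divr_gt0.
have vge : c * (a.2 / D) <= wratio (v a).
  apply: stop_ge => //; first by move=> b; have /andP[] := hc b.
  by rewrite divr_gt0//= ltr_pdivrMr// mul1r; lra.
apply: (@le_trans _ _ ((2 * (D / c) * wratio (v a)) `^ t)).
  apply: ge0_ler_powR => //; rewrite ?nnegrE.
  - by rewrite mulr_ge0// ltW.
  - by apply: mulr_ge0; [apply: mulr_ge0 => //; exact: ltW|exact/ltW/wratio_gt0].
  rewrite -mulrA ler_pM2l// -ler_pdivrMl// invf_div.
  by apply: le_trans vge; rewrite mulrAC -mulrA lexx.
rewrite powRM//; first last.
- exact/ltW/wratio_gt0.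
- by rewrite mulr_ge0// ltW.
rewrite ler_wpM2l ?powR_ge0//; apply: wmass_ge sw.
by apply: adm; apply/mapP; exists a.
Qed.

(** * Consequences of the open set condition *)

Section OpenSet.
Context (O : set point) (o : point) (eps : R) (eps0 : 0 < eps).
Context (ballO : forall x, edist o x < eps -> O x) (subOK : O `<=` K).
Context (SO : forall i (j : 'I_(m i)), S j @` O `<=` O).
Context (disjO : forall i (j j' : 'I_(m i)), j <> j' -> S j @` O `&` S j' @` O = set0).

Lemma wmap_open u x : O x -> O (wmap u x).
Proof. by elim: u => [//|a u IH] Ox /=; apply: SO; exists (wmap u x) => //; exact: IH. Qed.

Lemma disjoint_words w u v : admissible w u -> admissible w v ->
  ~~ prefix u v -> ~~ prefix v u -> wmap u @` O `&` wmap v @` O = set0.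
Proof.
elim: u v w => [|a u IH] [|b v] w //=; rewrite ?prefix0s//.
move=> /andP[/eqP ta au] /andP[/eqP tb bv] nuv nvu.
apply/seteqP; split=> // _ [[x Ox <-] [y Oy /= yx]].
have [ab|ab] := eqVneq a b.
  subst b; rewrite eqxx /= in nuv nvu.
  suff : (wmap u @` O `&` wmap v @` O) (wmap u x) by rewrite (IH _ _ au bv nuv nvu).
  split; first by exists x.
  exists y => //; apply: (@S_inj _ (tagged a)) => //; apply/wmap_sub/subOK => //.
case: a b ta tb ab yx {nuv nvu} => i j [i' j'] /= ta tb; subst i i' => ab yx.
have jj' : j <> j' by move=> jj'; rewrite jj' eqxx in ab.
suff : (S j @` O `&` S j' @` O) (S j (wmap u x)) by rewrite disjO.
by split; [exists (wmap u x) => //; exact: wmap_open|exists (wmap v y) => //; exact: wmap_open].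
Qed.

(** A closer centre [wmap v o] would be attained by [wmap u] on the ball around [o] inside [O],
    because a similarity maps this ball onto a full ball; the images of [O] would then meet. *)
Lemma wcenter_separated w u v : admissible w u -> admissible w v ->
  ~~ prefix u v -> ~~ prefix v u -> eps * wratio u <= edist (wmap u o) (wmap v o).
Proof.
move=> au av nuv nvu; rewrite leNgt mulrC; apply/negP => lt.
have Oo : O o by apply: ballO; rewrite edistxx.
have [x ox ux] := similarity_onto_ball (wratio_gt0 u) eps0 (wmap_sim u)
  (fun x h => subOK (ballO h)) lt.
suff : (wmap u @` O `&` wmap v @` O) (wmap v o) by rewrite (disjoint_words au av).
by split; [exists x => //; exact: ballO|exists o].
Qed.

(** The centres [wmap v o] are within $(1+D)\rho$ of [z] and at least $\mathrm{eps}\, c\, \rho$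
    apart; the quotient of the two, free of $\rho$, goes into [separated_count]. *)
Lemma bounded_overlap (c : R) : 0 < c -> exists M : nat,
  forall w (rho : R) (l : seq (seq letter)) (z : point), 0 < rho -> uniq l ->
  (forall v, v \in l -> admissible w v) ->
  (forall v v', v \in l -> v' \in l -> prefix v v' -> v = v') ->
  (forall v, v \in l -> c * rho <= wratio v <= rho) ->
  (forall v, v \in l -> exists2 x, K x & edist z (wmap v x) <= rho) ->
  (size l <= M)%N.
Proof.
move=> c0; have [D D0 hD] := cylinder_diam.
have Oo : O o by apply: ballO; rewrite edistxx.
have [M hM] := @separated_count R n ((1 + D) / (eps * c)).
exists M => w rho l z rho0 ul adm anti ratios near.
apply: (hM _ l (fun v => wmap v o) z (eps * (c * rho))) => //.
- by rewrite !mulr_gt0.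
- move=> v vl; have [x Kx xz] := near v vl; have /andP[_ vr] := ratios v vl.
  have -> : (1 + D) / (eps * c) * (eps * (c * rho)) = rho + rho * D.
    by rewrite (mulrA eps) mulrA divfK ?mulf_neq0 ?gt_eqF//; ring.
  apply: le_trans (edist_triangle (wmap v x) _ _) _; apply: lerD => //.
  apply: le_trans (ltW (hD v x o Kx (subOK Oo))) _.
  by rewrite ler_pM2r.
- move=> v v' vl v'l vv'; have /andP[rv _] := ratios v vl.
  apply: le_trans (wcenter_separated (adm v vl) (adm v' v'l) _ _).
  + by rewrite ler_pM2l.
  + by apply/negP => /(anti _ _ vl v'l).
  + by apply/negP => /(anti _ _ v'l vl) /esym.
Qed.

(* Mass distribution: a set of diameter [d < 1] meets boundedly many cylinders
   stopped at scale [d], each of mass at most [d ^ t]. *)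
Lemma hausdorff_lower : exists2 c : R, 0 < c & forall w t b, 0 <= t ->
  (forall q, t <= s (w q)) -> hle t (F w) b -> c <= b.
Proof.
have [c c01 hc] := ratio_bounds; have /andP[c0 c1] := c01.
have [M hM] := bounded_overlap c0.
pose M' : R := M%:R + 1; have M'0 : 0 < M' by rewrite ltr_wpDl.
exists M'^-1; first by rewrite invr_gt0.
move=> w t b t0 sw hb; rewrite leNgt; apply/negP => bM.
have [l hl lm] := hb 1 _ ltr01 bM.
suff : 1 <= M' * cmass t l by rewrite -ler_pdivrMl// mulr1 leNgt lm.
have [|e e0 he] := @finite_lower_bound R _ l (fun a => a.2).
  by move=> a /hl.2[_ /andP[]].
(* At length [L] all ratios are below every diameter bound in the cover, so each word really stops
   at scale [a.2]. *)
have [L hL] := wratio_small e0.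
(* One point [wmap u y] represents the cylinder of [u]: its mass is charged to the covering sets
   that contain this point. *)
have [y Fy] := F_nonempty (iter L shift w).
pose meets (a : set point * R) u := `[< a.1 (wmap u y) >].
rewrite -(wmass_words w L) /cmass mulr_sumr.
apply: (@le_trans _ _ (\sum_(u <- words w L) \sum_(a <- l | meets a u) wmass u)).
  rewrite !big_seq; apply: ler_sum => u uw.
  have [a al au] := hl.1 _ (F_word_mem uw Fy).
  rewrite (big_rem a)//= ifT; last exact/asboolP.
  by rewrite lerDl sumr_ge0// => *; exact: wmass_ge0.
rewrite (exchange_big_dep xpredT) //= !big_seq; apply: ler_sum => a al.
have [da /andP[a0 a1]] := hl.2 a al.
pose Q := undup [seq stop a.2 u | u <- words w L & meets a u].
have QP v : v \in Q -> exists u, [/\ u \in words w L, meets a u, wratio u <= a.2 & v = stop a.2 u].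
  rewrite mem_undup => /mapP[u]; rewrite mem_filter => /andP[mu uw] ->.
  exists u; split=> //; apply: le_trans (he a al); apply/ltW/hL.
  by move: uw; rewrite mem_words => /andP[/eqP ->].
have Qadm v : v \in Q -> admissible w v.
  move=> /QP[u [uw _ _ ->]]; apply: admissible_prefix (stop_prefix _ _) _.
  by move: uw; rewrite mem_words => /andP[].
have Qsize v : v \in Q -> (size v <= L)%N.
  move=> /QP[u [uw _ _ ->]]; apply: leq_trans (size_prefix (stop_prefix _ _)) _.
  by move: uw; rewrite mem_words => /andP[/eqP ->].
have KF : K y := F_sub Fy.
have sizeQ : (size Q <= M)%N.
  have [Q0|] := posnP (size Q); first by rewrite Q0.
  case: (Q) QP Qadm Qsize (undup_uniq _ : uniq Q) => // v0 Q' QP' Qadm' Qsize' uQ _.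
  have [u0 [u0w /asboolP m0' _ _]] := QP' v0 (mem_head _ _).
  apply: (hM w a.2 _ (wmap u0 y)) => //.
  - by move=> v v' /QP'[u [_ _ ur ->]] /QP'[u' [_ _ _ ->]]; exact: stop_incomparable.
  - move=> v /QP'[u [_ _ ur ->]]; rewrite stop_le// andbT.
    by apply: stop_ge => //; [move=> b'; have /andP[] := hc b'|rewrite a0].
  - move=> v /QP'[u [_ /asboolP mu _ ->]].
    have /prefixP[u' uE] := stop_prefix a.2 u.
    exists (wmap u' y); first exact: wmap_sub.
    by rewrite -wmap_cat -uE; exact: da.
apply: (@le_trans _ _ (\sum_(v <- Q) wmass v)); last first.
  apply: (@le_trans _ _ (\sum_(v <- Q) a.2 `^ t)).
    rewrite !big_seq; apply: ler_sum => v vQ.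
    apply: le_trans (wmass_le (Qadm v vQ) sw) _.
    have [u [_ _ ur ->]] := QP v vQ.
    by apply: ge0_ler_powR; rewrite ?nnegrE ?(ltW a0) ?(ltW (wratio_gt0 _))// stop_le.
  rewrite sum_const_seq ler_wpM2r ?powR_ge0//.
  by apply: le_trans (_ : M%:R <= _); rewrite ?ler_nat// /M' lerDl.
rewrite [leRHS]big_seq.
rewrite [leRHS](eq_bigr (fun v => \sum_(u <- words w L | prefix v u) wmass u)); last first.
  by move=> v vQ; rewrite wmass_prefix ?Qadm ?Qsize.
rewrite -[leRHS]big_seq (exchange_big_dep xpredT) //= !(big_mkcond (meets a)) /=.
rewrite !big_seq; apply: ler_sum => u uw; case: ifP => mu; last first.
  by apply: sumr_ge0 => *; exact: wmass_ge0.
have sQ : stop a.2 u \in Q by rewrite mem_undup; apply/mapP; exists u; rewrite // mem_filter mu.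
rewrite (big_rem _ sQ) /= stop_prefix lerDl sumr_ge0// => *; exact: wmass_ge0.
Qed.

(** The multiplier in dimension [t] for prepending the letter [i]; it equals $1$ at [t = s i]. *)
Definition powsum (t : R) i : R := \sum_(j < m i) (r j) `^ t.

Lemma powsum_gt0 t i : 0 < powsum t i.
Proof.
rewrite /powsum (bigD1 (Ordinal (m0 i)))//= ltr_pwDl ?powR_gt0 ?r_gt0//.
by rewrite sumr_ge0// => j _; exact: powR_ge0.
Qed.

Lemma powsum_lt t t' i : t < t' -> powsum t' i < powsum t i.
Proof.
move=> tt'; have lt (j : 'I_(m i)) : (r j) `^ t' < (r j) `^ t.
  have rj := r_gt0 j; rewrite -(subrK t t') powRD; last by rewrite (gt_eqF rj) implybT.
  rewrite gtr_pMl ?powR_gt0//; have := @gt0_ltr_powR R (t' - t).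
  rewrite subr_gt0 => /(_ tt')/(_ (r j) 1); rewrite powR1; apply; rewrite ?nnegrE ?(ltW rj)//.
  by have /andP[] := r01 j.
rewrite /powsum (bigD1 (Ordinal (m0 i)))//= [ltRHS](bigD1 (Ordinal (m0 i)))//=.
by apply: ltr_leD => //; apply: ler_sum => j _; exact: ltW.
Qed.

Lemma hle_shift t w c : hle t (F (shift w)) c -> hle t (F w) (powsum t (w 0%N) * c).
Proof.
move=> h; rewrite F_unfold /powsum mulr_suml -big_enum /=.
have := @hle_bigU _ _ t _ (enum 'I_(m (w 0%N))) (fun j => S j @` F (shift w)) (fun j => (r j) `^ t * c).
move=> /(_ _)/hleS; apply => //; last first.
  move=> j _; apply: (hle_image (r_gt0 j) (simS j)) => //; exact: (@F_sub (shift w)).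
by move=> x [j _ fx]; exists j => //=; rewrite mem_enum.
Qed.

Lemma ple_shift t w c : ple t (F (shift w)) c -> ple t (F w) (powsum t (w 0%N) * c).
Proof.
move=> h; rewrite F_unfold /powsum mulr_suml -big_enum /=.
have := @ple_bigU _ _ t _ (enum 'I_(m (w 0%N))) (fun j => S j @` F (shift w)) (fun j => (r j) `^ t * c).
move=> /(_ _)/pleS; apply => //; last first.
  move=> j _; apply: (ple_image (r_gt0 j) (simS j)) => //; exact: (@F_sub (shift w)).
by move=> x [j _ fx]; exists j => //=; rewrite mem_enum.
Qed.

Lemma typical_hle t (c : R) : 0 <= t ->
  (forall e, 0 < e -> exists w0, forall k (u : nat -> 'I_N), hle t (F (glue k u w0)) (c + e)) ->
  residual [set w | hle t (F w) c].
Proof.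
move=> t0 h; pose e k : R := k.+1%:R^-1.
have e0 k : 0 < e k by rewrite invr_gt0.
(* The open set [V] is part of the condition so that [F_nbhd] makes [G k] open. *)
pose G k := [set w | exists V, [/\ eopen V, F w `<=` V & hcov t (e k) V (c + e k)]].
apply: (@residualS _ (\bigcap_k G k)).
  move=> w hG d c' d0 cc'; have [|k hk] := @inv_nat_lt R (Num.min d (c' - c)).
    by rewrite lt_min d0 subr_gt0.
  have [V [_ FV]] := hG k I; apply: hcovS => //; apply/ltW.
    by apply: lt_le_trans hk _; rewrite ge_min lexx.
  rewrite -ltrBrDl; apply: lt_le_trans hk _; rewrite ge_min lexx orbT//.
apply: residual_bigcap => k; apply: residual_open_dense.
  move=> w [V [oV FV hV]]; have [q hq] := F_nbhd oV FV.
  by exists q => v /hq FvV; exists V.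
have [|w0 hw0] := h (e k / 2); first by rewrite divr_gt0.
apply: (@glue_dense _ _ w0) => q u.
have [|V [oV FV hV]] := hcov_nbhd t0 (hw0 q u (e k) (c + e k) (e0 k) _); last by exists V.
by rewrite ltrD2l; have := e0 k; lra.
Qed.

(** If [v] agrees with [w] on [L] letters, [F v] has a point in every cylinder of level [L] that
    contains a centre, and these cylinders are smaller than the tolerance of [fpack_perturb]. *)
Lemma fpack_nbhd w d l t : fpack (F w) d l -> exists k, forall v : nat -> 'I_N,
  (forall p, (p < k)%N -> v p = w p) ->
  exists2 l', fpack (F v) d l' & pmass t l' = pmass t l.
Proof.
move=> hl; have [e e0 he] := fpack_perturb hl.
have [D D0 hD] := cylinder_diam; have [|L hL] := @wratio_small (e / D); first by rewrite divr_gt0.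
exists L => v vw; apply: he => a al.
have [+ _] := hl.2 a al; rewrite {1}(F_words w L) => -[u uw [x Fx <-]].
have [y Fy] := F_nonempty (iter L shift v); exists (wmap u y).
  by apply: (@F_word_mem v L) => //; rewrite (words_eq vw).
apply: lt_trans (hD _ _ _ (F_sub Fx) (F_sub Fy)) _.
rewrite -ltr_pdivlMr//; apply: hL.
by move: uw; rewrite /= mem_words => /andP[/eqP ->].
Qed.

Lemma typical_pge t (c : R) :
  (forall e, 0 < e -> exists w0, forall k (u : nat -> 'I_N), pge t (F (glue k u w0)) (c - e)) ->
  residual [set w | pge t (F w) c].
Proof.
move=> h; pose e k : R := k.+1%:R^-1.
have e0 k : 0 < e k by rewrite invr_gt0.
pose G k := [set w | exists2 l, fpack (F w) (e k) l & c - e k < pmass t l].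
apply: (@residualS _ (\bigcap_k G k)).
  move=> w hG c' d c'c d0; have [|k hk] := @inv_nat_lt R (Num.min d (c - c')).
    by rewrite lt_min d0 subr_gt0.
  have [l hl lm] := hG k I; exists l.
    by apply: fpackS hl => //; apply/ltW; apply: lt_le_trans hk _; rewrite ge_min lexx.
  apply: le_lt_trans lm; have : e k < c - c'.
    by apply: lt_le_trans hk _; rewrite ge_min lexx orbT.
  by lra.
apply: residual_bigcap => k; apply: residual_open_dense.
  move=> w [l hl lm]; have [q hq] := fpack_nbhd t hl.
  by exists q => v /hq[l' hl' l'm]; exists l'; rewrite // l'm.
have [|w0 hw0] := h (e k / 2); first by rewrite divr_gt0.
apply: (@glue_dense _ _ w0) => q u.
have [|l hl lm] := hw0 q u (c - e k) (e k) _ (e0 k); last by exists l.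
by have := e0 k; lra.
Qed.

(** A negative exponent would make the sum exceed its value at exponent $0$, the number of maps,
    which is at least $1$. *)
Lemma s_ge0 i : 0 <= s i.
Proof.
rewrite leNgt; apply/negP => si; have := sumS i.
have rj := r_gt0 (Ordinal (m0 i)).
have := powsum_lt i si; rewrite /powsum => + s1; rewrite s1.
under eq_bigr do rewrite powRr0.
by rewrite sumr_const card_ord ltNge ler1n m0.
Qed.

(* By Baire, one set of a countable cover of [F w] is dense in a cylinder, and
   passing to the closure does not change the packing premeasure. *)
Lemma packing_neq0 w t t' : 0 <= t -> t <= t' ->
  (forall L (q : nat), pge t' (F (iter L shift w)) q%:R) -> packing t (F w) <> 0%E.
Proof.
move=> t0 tt' big P0.
have [A [p [FA hA _]]] : exists (A : nat -> set point) (p : nat -> R),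
    [/\ F w `<=` \bigcup_k A k, forall k, ple t (A k) (p k) &
      (\esum_(k in [set: nat]) (p k)%:E < 1%:E)%E].
  by apply: packing_le_cover; rewrite P0 lte_fin.
have [k [x [e [Fx e0 dense]]]] := ecompact_baire (@ecompact_F w) (F_nonempty w) FA.
have [D D0 hD] := cylinder_diam; have [|L hL] := @wratio_small (e / D); first by rewrite divr_gt0.
move: (Fx); rewrite {1}(F_words w L) => -[u uw [y Fy yx]].
have ru : wratio u < e / D.
  by apply: hL; move: uw; rewrite /= mem_words => /andP[/eqP ->].
have hu : ple t (wmap u @` F (iter L shift w)) (p k).
  apply: ple_dense (hA k) => _ e' [z Fz <-] e'0; apply: dense => //.
    exact: F_word_mem uw Fz.
  rewrite -yx; apply: lt_trans (hD _ _ _ (F_sub Fy) (F_sub Fz)) _.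
  by rewrite -ltr_pdivlMr.
(* A premeasure finite in dimension [t] is finite in dimension [t'], whereas the similar copy
   inherits arbitrarily large lower bounds from [big]. *)
have [c' hc'] := ple_exponent_le t0 tt' hu.
have ru0 : 0 < wratio u `^ t' by rewrite powR_gt0 ?wratio_gt0.
have := pge_ple (pge_image (wratio_gt0 u) (wmap_sim u) (@F_sub _)
  (big L (Num.bound (c' / wratio u `^ t')))) hc'.
rewrite -ler_pdivlMl// mulrC leNgt => /negP; apply; apply: archi_boundP.
by rewrite mulr_ge0 ?invr_ge0 ?(ple_ge0 hc') ?(ltW ru0).
Qed.

(** * Typical sequences *)

Section Typical.
Context (smin smax : R) (smin_in : exists i, s i = smin) (smin_le : forall i, smin <= s i).
Context (smax_in : exists i, s i = smax) (smax_ge : forall i, s i <= smax).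
Context (sepP : forall w (l : 'I_N) (j j' : 'I_(m l)), j <> j' ->
  packing smin (S j @` F w `&` S j' @` F w) = 0%E).

Lemma smin_ge0 : 0 <= smin.
Proof. by have [i <-] := smin_in; exact: s_ge0. Qed.

Lemma ecompact_piece w l (j : 'I_(m l)) : ecompact (S j @` F w).
Proof.
apply: (@ecompact_image _ _ K (S j) (r j)); [exact: r_gt0|exact: simS|exact: F_sub|].
exact: ecompact_F.
Qed.

(** The converse of [hle_shift]; here the null overlaps enter, carried over to Hausdorff measure by
    [hle_packing]. *)
Lemma hle_unshift w c : hle smin (F w) c -> hle smin (F (shift w)) (c / powsum smin (w 0%N)).
Proof.
rewrite {1}F_unfold => h.
apply: (@hle_image_union _ _ smin (m (w 0%N)) K (fun j => S j) (fun j => r j)) => //.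
- exact: smin_ge0.
- by move=> j; exact: r_gt0.
- exact: F_sub.
- exact: ecompact_F.
- move=> j j' jj'; apply: hle_packing; first exact: smin_ge0.
    by apply: ecompactI; exact: ecompact_piece.
  by rewrite sepP.
Qed.

(** Finiteness of the premeasure is what turns the null packing measure of the overlaps into null
    premeasure, as [pge_additive] demands. *)
Lemma pge_shift w c C : ple smin (F w) C -> pge smin (F (shift w)) c ->
  pge smin (F w) (powsum smin (w 0%N) * c).
Proof.
move=> hC hc; rewrite /powsum mulr_suml.
apply: (@pge_additive _ _ smin _ (fun j => S j @` F (shift w)) _ (F w) C) => //.
- exact: smin_ge0.
- by move=> j; exact: ecompact_piece.
- by move=> j x Fx; rewrite F_unfold; exists j.
- by move=> j j'; exact: sepP.
- by move=> j; apply: (pge_image (r_gt0 j) (simS j)) => //; exact: F_sub.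
Qed.

Lemma powsum_min i : 1 <= powsum smin i.
Proof.
have [->|h] := eqVneq smin (s i); first by rewrite /powsum sumS.
by rewrite -[leLHS](sumS i); apply/ltW/powsum_lt; rewrite lt_neqAle h smin_le.
Qed.

Lemma powsum_max i : powsum smax i <= 1.
Proof.
have [->|h] := eqVneq smax (s i); first by rewrite /powsum sumS.
by rewrite -[leRHS](sumS i); apply/ltW/powsum_lt; rewrite lt_neqAle eq_sym h smax_ge.
Qed.

Lemma typical_equal :
  let Hmin := ereal_inf [set hausdorff smin (F w) | w in [set: nat -> 'I_N]] in
  let Pmax := ereal_sup [set packing smax (F w) | w in [set: nat -> 'I_N]] in
  smin = smax ->
  residual [set w | dimH (F w) = smin /\ dimP (F w) = smin /\
    (0 < hausdorff smin (F w))%E /\ hausdorff smin (F w) = Hmin /\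
    (Hmin <= Pmax)%E /\ Pmax = packing smin (F w) /\
    (packing smin (F w) < +oo)%E].
Proof.
move=> Hmin Pmax eqs; have s0 := smin_ge0.
have sE i : s i = smin by apply/eqP; rewrite eq_le smin_le andbT eqs smax_ge.
have ps1 i : powsum smin i = 1 by rewrite /powsum -{1}(sE i) sumS.
have [C hC'] := packing_upper s0.
have hC w : ple smin (F w) C by apply: hC' => q; rewrite sE.
have [c0 c00 hlow] := hausdorff_lower.
have low w b : hle smin (F w) b -> c0 <= b by apply: hlow => // q; rewrite sE.
have pup w : (packing smin (F w) <= C%:E)%E.
  by apply: le_trans (packing_le_pre _ _) _; apply/packing_pre_le.
have hup w : (hausdorff smin (F w) <= C%:E)%E by apply/hausdorff_hle/ple_hle.
have [i0 _] := smin_in; pose w1 : nat -> 'I_N := fun=> i0.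
have [h HminE] : exists h, Hmin = h%:E.
  have le1 : (0 <= Hmin)%E by apply: le_ereal_inf_tmp => _ [w _ <-]; exact: hausdorff_ge0.
  have le2 : (Hmin <= C%:E)%E.
    by apply: le_trans (hup w1); apply: ereal_inf_lbound; exists w1.
  by move: le1 le2; case: (Hmin) => [h| |]// _ _; exists h.
have [p PmaxE] : exists p, Pmax = p%:E.
  have le1 : (0 <= Pmax)%E.
    by apply: le_trans (packing_ge0 smax (F w1)) _; apply: ereal_sup_ubound; exists w1.
  have le2 : (Pmax <= C%:E)%E by apply/ereal_supP => _ [w _ <-]; rewrite -eqs.
  by move: le1 le2; case: (Pmax) => [p| |]// _ _; exists p.
have rH : residual [set w | hle smin (F w) h].
  apply: typical_hle => // e e0.
  have /ereal_inf_lt[_ [w0 _ <-] lt] : (Hmin < (h + e)%:E)%E.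
    by rewrite HminE lte_fin ltrDl.
  exists w0; refine (@glue_ind N (fun w' => hle smin (F w') (h + e)) w0 _ _).
    by move=> v /hle_shift; rewrite ps1 mul1r.
  by apply: hle_hausdorff => //; [exact: ecompact_F|exact: ltW].
have rP : residual [set w | pge smin (F w) p].
  apply: typical_pge => e e0.
  have /ereal_sup_gt[_ [w0 _ <-] lt] : ((p - e)%:E < Pmax)%E.
    by rewrite PmaxE lte_fin ltrBlDr ltrDl.
  exists w0; refine (@glue_ind N (fun w' => pge smin (F w') (p - e)) w0 _ _).
    by move=> v hv; have := pge_shift (hC v) hv; rewrite ps1 mul1r.
  apply/packing_pre_ge; apply: le_trans (packing_le_pre _ _).
  by rewrite eqs; exact: ltW.
apply: residualS (residualI rH rP) => w [hw pw].
have hE : hausdorff smin (F w) = Hmin.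
  apply/eqP; rewrite eq_le HminE hausdorff_hle//= -HminE.
  by apply: ereal_inf_lbound; exists w.
have pE : Pmax = packing smin (F w).
  apply/eqP; rewrite eq_le; apply/andP; split; last first.
    by rewrite eqs; apply: ereal_sup_ubound; exists w.
  rewrite PmaxE (packing_compact s0 (@ecompact_F w) (hC w)).
  exact/packing_pre_ge.
(* A null measure in dimension [t] would remain null in dimension [smin], against the uniform bound
   [c0]. *)
have pos t : 0 <= t < smin -> ~ hle t (F w) 0.
  move=> /andP[t0 ts] ht; have := low w 0 (hle_exponent t0 ts ht); lra.
split; last split; last split; last split; last split; last split => //.
- apply: dimH_eq => //; first exact: ecompact_F.
  by move=> t st; exact: hle_exponent hw.
- apply: dimP_eq => // [t st|t ts P0]; first exact: ple_exponent (hC w).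
  have /andP[t0 _] := ts; apply: (pos t ts); apply: hle_packing => //.
    exact: ecompact_F.
  by rewrite P0.
- by rewrite hE HminE lte_fin; apply: lt_le_trans c00 (low _ _ hw).
- exact: hE.
- rewrite -hE PmaxE; apply/hausdorff_hle => //; apply: hle_packing => //.
    exact: ecompact_F.
  by rewrite -pE PmaxE.
- exact: le_lt_trans (pup w) (ltry _).
Qed.

Lemma typical_distinct : smin < smax ->
  residual [set w | dimH (F w) = smin /\ dimP (F w) = smax /\
    hausdorff smin (F w) = +oo%E /\ packing smax (F w) = 0%E].
Proof.
move=> lts; have s0 := smin_ge0; have S0 : 0 < smax by apply: le_lt_trans lts.
have [imin iminE] := smin_in; have [imax imaxE] := smax_in.
have [C hC'] := packing_upper (ltW S0).
have hC w : ple smax (F w) C by apply: hC' => q; exact: smax_ge.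
have [c0 c00 hlow] := hausdorff_lower.
have low w b : hle smin (F w) b -> c0 <= b by apply: hlow => // q; exact: smin_le.
pose t_ k := smin + k.+1%:R^-1; have t_gt k : smin < t_ k by rewrite ltrDl invr_gt0.
have rH : residual (\bigcap_k [set w | hle (t_ k) (F w) 0]).
  apply: residual_bigcap => k; apply: typical_hle => [|e e0].
    exact: le_trans s0 (ltW (t_gt k)).
  exists (fun=> imin) => q u; apply: (@hleS _ _ _ _ (F (glue q u (fun=> imin))) 0) => //.
    by rewrite add0r ltW.
  (* The bound [0] survives every multiplier, including those above $1$. *)
  move: q u; refine (@glue_ind N (fun w' => hle (t_ k) (F w') 0) _ _ _).
    by move=> v /hle_shift; rewrite mulr0.
  have [C2 hC2] := packing_upper s0.
  apply: hle_exponent s0 (t_gt k) (ple_hle s0 (hC2 _ _)).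
  by move=> q; rewrite iminE.
(* These exponents increase to [smax]; the product form keeps them nonnegative. *)
pose T_ k := smax * (1 - k.+2%:R^-1); have T_lt k : 0 <= T_ k < smax.
  have : 0 < k.+2%:R^-1 :> R by rewrite invr_gt0.
  have : k.+2%:R^-1 <= 1 :> R by rewrite invf_le1// ler1n.
  by rewrite /T_; set z := _^-1 => z1 z0; apply/andP; split; nra.
(* All tails are included because the cylinder supplied by the Baire argument is not known in
   advance. *)
have rP : residual (\bigcap_L (\bigcap_k (\bigcap_q [set w | pge (T_ k) (F (iter L shift w)) q%:R]))).
  apply: residual_bigcap => L.
  suff : residual (\bigcap_k (\bigcap_q [set w | pge (T_ k) (F w) q%:R])).
    elim: L => [//|L IH] h0; have := residual_shift (IH h0).
    by apply: residualS => w hw k kT q qT; have := hw k kT q qT; rewrite /= -iterSr; exact.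
  apply: residual_bigcap => k; apply: residual_bigcap => q.
  have /andP[T0 Tlt] := T_lt k.
  apply: typical_pge => e e0; exists (fun=> imax) => j u.
  (* Arbitrary [x] is needed in the induction: passing to one similar copy multiplies the bound by a
     factor below $1$ or equal to it. *)
  suff h x : pge (T_ k) (F (glue j u (fun=> imax))) x by exact: h.
  move: j u x; refine (@glue_ind N (fun w' => forall x, pge (T_ k) (F w') x) _ _ _); last first.
    (* A finite premeasure in dimension [T_ k] would give zero Hausdorff measure in dimension
       [smax], against the lower bound for the constant sequence [imax]. *)
    move=> x; apply: contrapT => /npge_ple[c' _ hc'].
    have := hlow (fun=> imax) smax 0 (ltW S0) _ (ple_hle (ltW S0) (ple_exponent T0 Tlt hc')).
    by move=> h; have : c0 <= 0 by [apply: h => _; rewrite imaxE]; rewrite leNgt c00.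
  move=> v hv x; pose j0 := Ordinal (m0 (v 0%N)).
  have rT : 0 < r j0 `^ T_ k by rewrite powR_gt0 ?r_gt0.
  have := pge_image (r_gt0 j0) (simS j0) (@F_sub _) (hv (x / r j0 `^ T_ k)).
  rewrite mulrCA mulfV ?gt_eqF// mulr1; apply: pgeS => // y Fy.
  by rewrite F_unfold; exists j0.
pose inf i := [set w : nat -> 'I_N | forall k, exists2 q, (k <= q)%N & w q = i].
have inf_shift i w : inf i w -> inf i (shift w).
  by move=> h k; have [[//|q] kq wq] := h k.+1; exists q.
have ple_back w L c : ple smax (F (iter L shift w)) c -> ple smax (F w) c.
  move=> hc; have cp := ple_ge0 hc; elim: L w hc => [//|L IH] w; rewrite iterSr.
  by move=> /IH/ple_shift; apply: pleS => //; rewrite ler_piMl// powsum_max.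
have hle_forth w L c : hle smin (F w) c -> hle smin (F (iter L shift w)) c.
  move=> hc; elim: L => [//|L /hle_unshift]; rewrite /= iter_shiftE addn0; apply: hleS => //.
  by rewrite ler_pdivrMr ?powsum_gt0// ler_peMr ?(hle_ge0 hc)// powsum_min.
have Pzero w : inf imin w -> ple smax (F w) 0.
  pose nu := powsum smax imin; have nu1 : 0 <= nu < 1.
    rewrite ltW ?powsum_gt0//= /nu -(sumS imin); apply: powsum_lt; by rewrite iminE.
  (* The induction runs over all sequences at once: [C] bounds every tail, each occurrence of [imin]
     gains the factor [nu], and other letters lose nothing. *)
  have step k : forall w, inf imin w -> ple smax (F w) (C * nu ^+ k).
    elim: k => [|k IH] v iv; first by rewrite expr0 mulr1.
    have [q _ vq] := iv 0%N; apply: (ple_back _ q).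
    have -> : C * nu ^+ k.+1 = powsum smax (iter q shift v 0%N) * (C * nu ^+ k).
      by rewrite iter_shiftE addn0 vq exprS mulrCA.
    apply: ple_shift; rewrite -iterS; apply: IH; elim: (q.+1) => [//|q' IH']; exact: inf_shift.
  move=> iw; apply: ple_lim => e e0.
  have C1 : 0 < C + 1 by rewrite ltr_wpDl// (ple_ge0 (hC w)).
  have [|k hk] := expr_small nu1 (_ : 0 < e / (C + 1)); first by rewrite divr_gt0.
  apply: pleS (step k w iw) => //; rewrite add0r; move: hk; rewrite ltr_pdivlMr// => hk.
  have nk : 0 <= nu ^+ k by have /andP[? _] := nu1; rewrite exprn_ge0.
  nra.
have Hinf w : inf imax w -> forall c, ~ hle smin (F w) c.
  pose nu := (powsum smin imax)^-1; have nu1 : 0 <= nu < 1.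
    rewrite invr_ge0 ltW ?powsum_gt0//= invf_lt1 ?powsum_gt0// -(sumS imax).
    by apply: powsum_lt; rewrite imaxE.
  move=> iw c hc; have cp := hle_ge0 hc.
  (* A finite bound [c] shrinks along the tails, by the factor [nu] at each occurrence of [imax],
     until it falls below the lower bound [c0] valid for every tail. *)
  have step k : exists L, hle smin (F (iter L shift w)) (c * nu ^+ k).
    elim: k => [|k [L hL]]; first by exists 0%N; rewrite expr0 mulr1.
    have [q Lq wq] := iw L; exists q.+1.
    have := hle_forth _ (q - L)%N _ hL; rewrite -iterD subnK// => /hle_unshift.
    by rewrite iter_shiftE addn0 wq exprS mulrCA mulrC mulrA.
  have [|k hk] := expr_small nu1 (_ : 0 < c0 / (c + 1)); first by rewrite divr_gt0// ltr_wpDl.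
  have [L hL] := step k; have := low _ _ hL.
  move: hk; rewrite ltr_pdivlMr ?ltr_wpDl// => hk.
  have nk : 0 <= nu ^+ k by have /andP[? _] := nu1; rewrite exprn_ge0.
  nra.
have rmin := residual_infinitely_often imin; have rmax := residual_infinitely_often imax.
apply: residualS (residualI (residualI rH rP) (residualI rmin rmax)) => w [[hw pw] [iw aw]].
have cF := @ecompact_F w.
have pos t : 0 <= t < smin -> ~ hle t (F w) 0.
  move=> /andP[t0 ts] ht; have := low w 0 (hle_exponent t0 ts ht); lra.
split; last split; last split.
- apply: dimH_eq => // t st; have [|k hk] := @inv_nat_lt R (t - smin); first by rewrite subr_gt0.
  apply: hle_exponent (hw k I); first exact: le_trans s0 (ltW (t_gt k)).
  by rewrite /t_ -ltrBrDl.
- apply: dimP_eq => [|t st|t /andP[t0 ts]]; first exact: ltW.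
    exact: ple_exponent (ltW S0) st (hC w).
  have [|k hk] := @inv_nat_lt R (1 - t / smax); first by rewrite subr_gt0 ltr_pdivrMr// mul1r.
  apply: (@packing_neq0 w t (T_ k)) => //; last by move=> L q; exact: pw.
  have k2 : k.+2%:R^-1 <= k.+1%:R^-1 :> R by rewrite lef_pV2 ?posrE// ler_nat.
  by rewrite /T_ mulrC -ler_pdivrMr// lerBrDr -lerBrDl (le_trans k2)// ltW.
- case hE : (hausdorff smin (F w)) => [c| |]//.
    by case: (Hinf w aw c); apply: hle_hausdorff => //; rewrite hE.
  by have := hausdorff_ge0 smin (F w); rewrite hE.
- exact/ple_packing_eq0/Pzero.
Qed.

End Typical.

End OpenSet.
End Mass.
End Words.

Unset Implicit Arguments.

Theorem theorem2p5 (R : realType) (n N : nat) (K : set 'rV[R]_n)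
  (m : 'I_N -> nat) (S : forall i : 'I_N, 'I_(m i) -> 'rV[R]_n -> 'rV[R]_n)
  (r : forall i : 'I_N, 'I_(m i) -> R) (s : 'I_N -> R) (smin smax : R) :
  (0 < N)%N ->
  compact K ->
  (forall i, (0 < m i)%N) ->
  (forall i j, 0 < r i j < 1) ->
  (forall i j, S i j @` K `<=` K) ->
  (forall i j, similarity_on K (S i j) (r i j)) ->
  (forall i, \sum_(j < m i) (r i j) `^ (s i) = 1) ->
  ((exists i, s i = smin) /\ (forall i, smin <= s i)) ->
  ((exists i, s i = smax) /\ (forall i, s i <= smax)) ->
  (* uniform open set condition *)
  (exists O : set 'rV[R]_n, O !=set0 /\ eopen O /\ O `<=` K /\
     forall i, (forall j, S i j @` O `<=` O) /\
       (forall j j', j <> j' -> S i j @` O `&` S i j' @` O = set0)) ->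
  (* P^{smin}-measure separated condition *)
  (forall (w : nat -> 'I_N) (l : 'I_N) (j j' : 'I_(m l)), j <> j' ->
     packing smin (S l j @` F_omega S K w `&` S l j' @` F_omega S K w) = 0%E) ->
  let Hmin := ereal_inf [set hausdorff smin (F_omega S K w) | w in [set: nat -> 'I_N]] in
  let Pmax := ereal_sup [set packing smax (F_omega S K w) | w in [set: nat -> 'I_N]] in
  (smin = smax ->
     residual [set w | dimH (F_omega S K w) = smin /\ dimP (F_omega S K w) = smin /\
        (0 < hausdorff smin (F_omega S K w))%E /\ hausdorff smin (F_omega S K w) = Hmin /\
        (Hmin <= Pmax)%E /\ Pmax = packing smin (F_omega S K w) /\
        (packing smin (F_omega S K w) < +oo)%E])
  /\
  (smin < smax ->
     residual [set w | dimH (F_omega S K w) = smin /\ dimP (F_omega S K w) = smax /\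
        hausdorff smin (F_omega S K w) = +oo%E /\ packing smax (F_omega S K w) = 0%E]).
Proof.
move=> _ cK m0 r01 SK simS sumS [smin_in smin_le] [smax_in smax_ge] [U [[x0 Ux0] [oU [UK SU]]]] sepP.
have [eps eps0 ballU] := oU x0 Ux0.
have K0 : K !=set0 by exists x0; exact: UK.
have {}cK := compact_ecompact cK.
have SU' i (j : 'I_(m i)) : S i j @` U `<=` U by case: (SU i).
have disjU i (j j' : 'I_(m i)) : j <> j' -> S i j @` U `&` S i j' @` U = set0.
  by case: (SU i) => _; exact.
split.
  exact: (typical_equal cK K0 m0 r01 SK simS sumS eps0 ballU UK SU' disjU
    smin_in smin_le smax_ge sepP).
exact: (typical_distinct cK K0 m0 r01 SK simS sumS eps0 ballU UK SU' disjU
  smin_in smin_le smax_in smax_ge sepP).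
Qed.
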